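(* Let $\lambda,\mu$ be probability measures on $\mathbb{R}^d$ with supports $\Omega_0,\Omega_1$ satisfying the standing assumptions of the context, let $p\in(1,2]$, let $\nabla\varphi=T$ be the optimal transport map from $\lambda$ to $\mu$, and for $\varepsilon>0$ let $\varphi_\varepsilon$, $\mathcal S_x$ and $\mathrm{d}(\mathcal S_{(\cdot)},\nabla\varphi)$ be as in the context. Fix $K_0\Subset\Omega_0$. Then there exist constants $C>0$ and $\varepsilon_0>0$ such that, for every $\varepsilon\in(0,\varepsilon_0]$, $$\|\nabla\varphi_\varepsilon-\nabla\varphi\|_{L^2(K_0)}\le\|\mathrm{d}(\mathcal S_{(\cdot)},\nabla\varphi)\|_{L^2(K_0)}\le C\,\varepsilon^{\frac{1}{d(p-1)+2}}.$$ If $\Omega_1$ is convex, the result holds for all $\varepsilon\in(0,1]$.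
   Context: Standing assumptions. $\lambda$ and $\mu$ are probability measures on $\mathbb{R}^d$ with compact supports $\Omega_0:=\operatorname{supp}\lambda$ and $\Omega_1:=\operatorname{supp}\mu$. For some $\alpha>0$, both admit $C^{0,\alpha}$ densities (with respect to Lebesgue measure) that are bounded above and bounded away from zero on their supports. The optimal transport map $T=\nabla\varphi:\Omega_0\to\Omega_1$ from $\lambda$ to $\mu$ for the cost $\frac12\|x-y\|^2$ is a $C^{1,\alpha}$ diffeomorphism with $C^{1,\alpha}$ inverse. Notation. $p\in(1,2]$ and $q=\frac{p}{p-1}$. $(t)_+=\max(t,0)$, with the convention $(t)_+^0=\mathbf 1_{t\ge0}$. $A\Subset B$ means that there is a compact set $K$ with $A\subset K\subset\operatorname{int}B$. Regularized transport. For $\varepsilon>0$, $\pi_\varepsilon$ is the unique minimizer of $$\inf_{\pi\in\Pi(\lambda,\mu),\ \pi\ll\lambda\otimes\mu}\int\tfrac12\|x-y\|^2\,d\pi+\varepsilon\int h_p\Big(\frac{d\pi}{d(\lambda\otimes\mu)}\Big)\,d(\lambda\otimes\mu),\qquad h_p(z)=\frac{|z|^p-1}{p-1},$$ where $\Pi(\lambda,\mu)$ is the set of couplings of $\lambda$ and $\mu$. Its density is $$\rho_\varepsilon(x,y)=\frac{d\pi_\varepsilon}{d(\lambda\otimes\mu)}(x,y)=\frac{1}{\varepsilon^{q-1}q^{q-1}}\left(f_\varepsilon(x)+g_\varepsilon(y)-\tfrac12\|x-y\|^2\right)_+^{q-1},$$ where $f_\varepsilon:\Omega_0\to\mathbb{R}$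 and $g_\varepsilon:\Omega_1\to\mathbb{R}$ are bounded dual optimizers, in the version satisfying $$\int\left(f_\varepsilon(x)+g_\varepsilon(y)-\tfrac12\|x-y\|^2\right)_+^{q-1}d\mu(y)=\varepsilon^{q-1}q^{q-1}\quad\text{for all }x\in\Omega_0,$$ $$\int\left(f_\varepsilon(x)+g_\varepsilon(y)-\tfrac12\|x-y\|^2\right)_+^{q-1}d\lambda(x)=\varepsilon^{q-1}q^{q-1}\quad\text{for all }y\in\Omega_1.$$ Such a version exists. Set $\varphi_\varepsilon=\frac12\|\cdot\|^2-f_\varepsilon$, $\psi_\varepsilon=\frac12\|\cdot\|^2-g_\varepsilon$, and $\xi(x,y)=\langle x,y\rangle-\varphi_\varepsilon(x)-\psi_\varepsilon(y)$. For $x\in\Omega_0$ let $$\mathcal S_x=\{y\in\Omega_1:\rho_\varepsilon(x,y)>0\}=\{y\in\Omega_1:\xi(x,y)>0\}.$$ The gradient of $\varphi_\varepsilon$ is $$\nabla\varphi_\varepsilon(x)=\frac{\int_{\mathcal S_x}y\,\xi(x,y)^{q-2}\,d\mu(y)}{\int_{\mathcal S_x}\xi(x,y)^{q-2}\,d\mu(y)}.$$ $\mathrm{d}(\mathcal S_{(\cdot)},\nabla\varphi)$ denotes the function $x\mapsto\sup_{y\in\mathcal S_x}\|y-\nabla\varphi(x)\|$. *)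

(* Defs.v *)
From HB Require Import structures.
From mathcomp Require Import all_boot all_order all_algebra.
From mathcomp Require Import all_classical all_reals all_analysis.

Set Implicit Arguments.
Unset Strict Implicit.
Unset Printing Implicit Defensive.

Import Order.TTheory GRing.Theory Num.Theory.
Import numFieldNormedType.Exports.

Local Open Scope classical_set_scope.
Local Open Scope ring_scope.

(* 'rV[T]_n carries the product sigma-algebra, generated by the coordinates
   (for T the reals, this is the Borel sigma-algebra), as n.-tuple T does in
   the library. *)
Definition measure_rV_display : measure_display -> measure_display.
Proof. exact. Qed.

Section measurable_rV.
Context {d : measure_display} {T : measurableType d} {n : nat}.

Let coors : 'I_n -> 'rV[T]_n -> T := fun i x => x ord0 i.

Let rV_set0 : g_sigma_preimage coors set0.
Proof. exact: sigma_algebra0. Qed.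

Let rV_setC A : g_sigma_preimage coors A -> g_sigma_preimage coors (~` A).
Proof. exact: sigma_algebraC. Qed.

Let rV_bigcup (F : (set _)^nat) : (forall i, g_sigma_preimage coors (F i)) ->
  g_sigma_preimage coors (\bigcup_i (F i)).
Proof. exact: sigma_algebra_bigcup. Qed.

HB.instance Definition _ := @isMeasurable.Build (measure_rV_display d)
  'rV[T]_n (g_sigma_preimage coors) rV_set0 rV_setC rV_bigcup.

End measurable_rV.

Section lebesgue_measure_rV.
Context {R : realType}.

(* lebesgue_measure lives on measurableTypeR R, which has the same measurable
   sets as R but another display. *)

Definition cons_rV n (z : measurableTypeR R * 'rV[R]_n) : 'rV[R]_n.+1 :=
  row_mx (z.1%:M : 'rV[R]_1) z.2.

Definition uncons_rV n (x : 'rV[R]_n.+1) : measurableTypeR R * 'rV[R]_n :=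
  (x ord0 ord0, rsubmx (x : 'rV[R]_(1 + n))).

Lemma cons_rV0 n (z : measurableTypeR R * 'rV[R]_n) : cons_rV z ord0 ord0 = z.1.
Proof.
transitivity (row_mx (z.1%:M : 'rV_1) z.2 ord0 (lshift n ord0)).
  by congr (row_mx _ _ _ _); exact: val_inj.
by rewrite row_mxEl mxE eqxx mulr1n.
Qed.

Lemma cons_rVS n (z : measurableTypeR R * 'rV[R]_n) (i : 'I_n) :
  cons_rV z ord0 (lift ord0 i) = z.2 ord0 i.
Proof.
transitivity (row_mx (z.1%:M : 'rV_1) z.2 ord0 (rshift 1 i)).
  by congr (row_mx _ _ _ _); exact: val_inj.
by rewrite row_mxEr.
Qed.

Lemma cons_rVK n : cancel (@cons_rV n) (@uncons_rV n).
Proof.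
by case=> a v; rewrite /uncons_rV cons_rV0; congr pair; rewrite row_mxKr.
Qed.

Lemma measurable_fun_rVP (d : measure_display) (T : measurableType d) n
    (f : T -> 'rV[R]_n) :
  (forall i, measurable_fun [set: T] (fun t => f t ord0 i)) ->
  measurable_fun [set: T] f.
Proof.
move=> mf _ A mA; rewrite setTI.
have : (g_sigma_preimage (fun i => (fun x : 'rV[R]_n => x ord0 i) \o f)
    `<=` measurable).
  apply: smallest_sub; first exact: sigma_algebra_measurable.
  rewrite -bigcup_seq => B [i _] [C mC <-].
  exact: mf.
rewrite g_sigma_preimage_comp; apply.
by exists A => //; rewrite setTI.
Qed.

Lemma measurable_coord_rV n (i : 'I_n) :
  measurable_fun [set: 'rV[R]_n] (fun x => x ord0 i).
Proof.
move=> _ Y mY; apply: sub_sigma_algebra.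
rewrite -bigcup_seq; exists i; first by rewrite /= mem_index_enum.
by exists Y.
Qed.

Lemma measurable_cons_rV n : measurable_fun [set: measurableTypeR R * 'rV[R]_n] (@cons_rV n).
Proof.
apply: measurable_fun_rVP => i.
have [j ->|->] := unliftP ord0 i.
- by under eq_fun do rewrite cons_rVS; exact: measurableT_comp (measurable_coord_rV _) _.
- by under eq_fun do rewrite cons_rV0; exact: measurable_fst.
Qed.

Lemma measurable_uncons_rV n :
  measurable_fun [set: 'rV[R]_n.+1] (@uncons_rV n).
Proof.
apply: measurable_fun_pair; first exact: measurable_coord_rV.
apply: measurable_fun_rVP => i; under eq_fun do rewrite mxE.
exact: measurable_coord_rV.
Qed.

HB.instance Definition _ n :=
  isMeasurableFun.Build _ _ _ _ (@cons_rV n) (@measurable_cons_rV n).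

Local Open Scope ereal_scope.

Section lebesgue_cons.
Context n (m : {sigma_finite_measure set 'rV[R]_n -> \bar R}).

Definition lebesgue_cons : set 'rV[R]_n.+1 -> \bar R :=
  pushforward (@lebesgue_measure R \x m) (@cons_rV n).

Let lebesgue_cons0 : lebesgue_cons set0 = 0.
Proof. by rewrite /lebesgue_cons /pushforward preimage_set0 measure0. Qed.

Let lebesgue_cons_ge0 A : 0 <= lebesgue_cons A.
Proof. by rewrite /lebesgue_cons /pushforward; exact: measure_ge0. Qed.

Let lebesgue_cons_sigma_additive : semi_sigma_additive lebesgue_cons.
Proof.
exact: (@measure_semi_sigma_additive _ _ _
  (pushforward (@lebesgue_measure R \x m) (@cons_rV n))).
Qed.

HB.instance Definition _ := isMeasure.Build _ _ _ lebesgue_cons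
  lebesgue_cons0 lebesgue_cons_ge0 lebesgue_cons_sigma_additive.

Let lebesgue_cons_sigma_finite : sigma_finite setT lebesgue_cons.
Proof.
have [F TF Foo] : sigma_finite setT (@lebesgue_measure R \x m).
  have /sigma_finiteP[G [TG ndG Goo]] := sigma_finiteT (@lebesgue_measure R).
  have /sigma_finiteP[H [TH ndH Hoo]] := sigma_finiteT m.
  exists (fun k => G k `*` H k).
    rewrite -setXTT TG TH; apply/seteqP; split => -[x y] /=.
      move=> [[i _ Gx] [j _ Hy]]; exists (maxn i j) => //; split.
        by move: x Gx; exact/subsetPset/ndG/leq_maxl.
      by move: y Hy; exact/subsetPset/ndH/leq_maxr.
    by move=> [k _ []/= ? ?]; split; exists k.
  move=> k; have [? ?] := Goo k; have [? ?] := Hoo k.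
  split; first exact: measurableX.
  by rewrite product_measure1E// lte_mul_pinfty// ge0_fin_numE.
exists (fun k => @uncons_rV n @^-1` F k).
  by rewrite -preimage_bigcup -TF preimage_setT.
move=> k; have [mF Fk] := Foo k; split.
  by rewrite -[X in measurable X]setTI; exact: measurable_uncons_rV.
rewrite /lebesgue_cons /pushforward -comp_preimage.
by rewrite (_ : _ \o _ = id) //; apply/funext => z /=; rewrite cons_rVK.
Qed.

HB.instance Definition _ := Measure_isSigmaFinite.Build _ _ _ lebesgue_cons
  lebesgue_cons_sigma_finite.

End lebesgue_cons.

Fixpoint lebesgue_rV (n : nat) : {sigma_finite_measure set 'rV[R]_n -> \bar R} :=
  match n with
  | 0 => \d_(0%R : 'rV[R]_0)
  | k.+1 => lebesgue_cons (lebesgue_rV k)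
  end.

Lemma lebesgue_rV_box n (A : 'I_n -> set R) : (forall i, measurable (A i)) ->
  lebesgue_rV n [set x : 'rV[R]_n | forall i, A i (x ord0 i)] =
  \prod_(i < n) lebesgue_measure (A i).
Proof.
elim: n A => [|n IH] A mA.
  rewrite big_ord0 /= diracE mem_set //=.
  by move=> [].
rewrite big_ord_recl /= -(IH (fun i => A (lift ord0 i)));
  last by move=> i; exact: mA.
rewrite -product_measure1E //.
  congr (product_measure1 _ _ _); apply/seteqP; split => -[a v] /=.
    move=> H; split; first by have := H ord0; rewrite cons_rV0.
    by move=> i; have := H (lift ord0 i); rewrite cons_rVS.
  move=> [Ha Hv] i; have [j ->|->] := unliftP ord0 i.
    by rewrite cons_rVS; exact: Hv.
  by rewrite cons_rV0.
  exact: (mA ord0).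
rewrite (_ : [set _ | _] = \bigcap_(i in [set: 'I_n])
    ((fun x : 'rV[R]_n => x ord0 i) @^-1` A (lift ord0 i))); last first.
  by apply/seteqP; split => x H i; [move=> _|]; exact: H.
apply: fin_bigcap_measurable; first exact: finite_finset.
by move=> i _; rewrite -[X in measurable X]setTI; exact: measurable_coord_rV.
Qed.

End lebesgue_measure_rV.

Section euclidean.
Context {R : realType} {d : nat}.
Implicit Types (x y : 'rV[R]_d) (A : set 'rV[R]_d).

(* The norm `|x| of the library on 'rV[R]_d is the sup norm; it induces the
   same topology as the Euclidean norm used here for distances and costs. *)
Definition enorm x : R := Num.sqrt (\sum_(i < d) x ord0 i ^+ 2).

Definition grad (h : 'rV[R]_d -> R) x : 'rV[R]_d :=
  \row_(i < d) 'D_(delta_mx ord0 i) (h : 'rV[R]_d -> R^o) x.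

Definition holder_on (V : normedModType R) (alpha : R) A (F : 'rV[R]_d -> V) :=
  exists L : R, forall x y, A x -> A y ->
    `|F x - F y| <= L * enorm (x - y) `^ alpha.

(* C^{1,alpha} on a set that need not be open: restriction to the set of a
   map that is C^{1,alpha} on an open neighbourhood. *)
Definition C1_holder_on (m : nat) (alpha : R) A (F : 'rV[R]_d -> 'rV[R]_m) :=
  exists (U : set 'rV[R]_d) (G : 'rV[R]_d -> 'rV[R]_m),
    [/\ open U, A `<=` U, {in A, F =1 G},
        forall x, U x -> differentiable G x
      & holder_on alpha U (fun x => 'J G x)].

End euclidean.

Section transport.
Context {R : realType} {d : nat}.
Local Notation E := 'rV[R]_d.
Implicit Types (lambda mu : probability E R) (x y : E) (K A B : set E).

Definition C1_holder_diffeo (alpha : R) A B (T : E -> E) :=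
  exists S : E -> E,
    [/\ T @` A = B, {in A, cancel T S}, C1_holder_on alpha A T
      & C1_holder_on alpha B S].

Definition msupport lambda : set E :=
  [set x | forall U : set E, open U -> U x -> (0 < lambda U)%E].

Definition compactly_inside K A :=
  exists K', [/\ compact K', K `<=` K' & K' `<=` A^°].

(* The density is only prescribed on the support; it is 0 outside. *)
Definition regular_density (alpha : R) lambda :=
  exists rho : E -> R,
    [/\ measurable_fun (msupport lambda) rho,
        (forall A, measurable A -> lambda A =
           \int[lebesgue_rV d]_(x in A `&` msupport lambda) (rho x)%:E)%E,
        holder_on alpha (msupport lambda) (rho : E -> R^o)
      & exists a b : R, 0 < a /\
          forall x, msupport lambda x -> a <= rho x <= b].

Definition cost x y : R := 2^-1 * enorm (x - y) ^+ 2.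

Definition coupling lambda mu (plan : probability (E * E)%type R) :=
  forall A, measurable A ->
    plan (A `*` [set: E]) = lambda A /\ plan ([set: E] `*` A) = mu A.

(* T transports lambda to mu and the coupling (id, T)_# lambda it induces has
   minimal cost among all couplings. *)
Definition optimal_transport_map lambda mu (T : E -> E) :=
  [/\ measurable_fun (msupport lambda) T,
      (forall B, measurable B ->
         lambda (msupport lambda `&` T @^-1` B) = mu B)
    & forall plan, coupling lambda mu plan ->
        (\int[lambda]_(x in msupport lambda) (cost x (T x))%:E
           <= \int[plan]_z (cost z.1 z.2)%:E)%E].

Definition product_probability lambda mu : probability (E * E)%type R :=
  (lambda \x mu)%E.

Definition h_p (p z : R) : R := (`|z| `^ p - 1) / (p - 1).

Definition density lambda mu (plan : probability (E * E)%type R) : E * E -> \bar R :=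
  Radon_Nikodym (charge_of_finite_measure plan) (product_probability lambda mu).

Definition reg_cost (p eps : R) lambda mu (plan : probability (E * E)%type R) :=
  (\int[plan]_z (cost z.1 z.2)%:E + eps%:E *
   \int[product_probability lambda mu]_z
      (h_p p (fine (density lambda mu plan z)))%:E)%E.

Definition reg_optimal (p eps : R) lambda mu (plan : probability (E * E)%type R) :=
  [/\ coupling lambda mu plan, plan `<< product_probability lambda mu
    & forall plan' : probability (E * E)%type R, coupling lambda mu plan' ->
        plan' `<< product_probability lambda mu ->
        (reg_cost p eps lambda mu plan <= reg_cost p eps lambda mu plan')%E].

Definition conj_exp (p : R) : R := p / (p - 1).

Definition slack_pow (p : R) (f g : E -> R) x y : R :=
  Num.max (f x + g y - cost x y) 0 `^ (conj_exp p - 1).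

Definition rho_eps (p eps : R) (f g : E -> R) x y : R :=
  (eps `^ (conj_exp p - 1) * conj_exp p `^ (conj_exp p - 1))^-1
  * slack_pow p f g x y.

(* The two integral equations, required at every point of the supports, are the
   first-order conditions of the (concave) dual problem; the last clause is the
   formula for the density of the optimal plan. *)
Definition dual_optimizers (p eps : R) lambda mu
    (plan : probability (E * E)%type R) (f g : E -> R) :=
  let W0 := msupport lambda in
  let W1 := msupport mu in
  let c := eps `^ (conj_exp p - 1) * conj_exp p `^ (conj_exp p - 1) in
  [/\ (measurable_fun W0 f /\ measurable_fun W1 g),
      (exists M : R, (forall x, W0 x -> `|f x| <= M) /\
                     (forall y, W1 y -> `|g y| <= M)),
      (forall x, W0 x -> \int[mu]_(y in W1) (slack_pow p f g x y)%:E = c%:E)%E,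
      (forall y, W1 y -> \int[lambda]_(x in W0) (slack_pow p f g x y)%:E = c%:E)%E
    & ae_eq (product_probability lambda mu) (W0 `*` W1)
        (density lambda mu plan) (fun z => (rho_eps p eps f g z.1 z.2)%:E)].

Definition phi_eps (f : E -> R) x : R := 2^-1 * enorm x ^+ 2 - f x.

Definition section_supp (p eps : R) mu (f g : E -> R) x : set E :=
  [set y | msupport mu y /\ 0 < rho_eps p eps f g x y].

Definition sup_dist (S : E -> set E) (G : E -> E) x : \bar R :=
  ereal_sup [set (enorm (y - G x))%:E | y in S x].

Definition L2norm K (h : E -> \bar R) : \bar R :=
  ('N[lebesgue_rV d]_(2%:E)[h \_ K])%E.

End transport.

(* Main.v *)
(* Everything rests on the dual slack xi(x,y) = f(x) + g(y) - |x-y|^2/2.  The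
   marginal equations make xi(x,.) concave along segments of the support of mu,
   uniformly Lipschitz and small as eps -> 0, and optimality of the plan gives
   the integral of xi(x, T x) against lambda a sign; hence -xi is almost 0 on
   the graph of T, and, at interior points x, it is bounded below by
   c |y - T x|^2 up to a vanishing error.  Letting eps -> 0 in this bound shows
   that the excess cost of any coupling controls the integral of |y - T x|^2.
   For the regularized plan the excess cost is at most C eps^(2/(d(p-1)+2)), by
   comparison with a coupling that mixes cells of side eps^(1/(d(p-1)+2)).
   Finally, concavity of xi(x,.) gives the density at the midpoint of y and z at
   least 2^(1-q) times its value at z, so that |y - T x|^2 is at most a constant
   times its average over the section for every y in the section, and the
   gradient of phi_eps is itself an average over the section. *)

From HB Require Import structures.
From mathcomp Require Import all_boot all_order all_algebra.
From mathcomp Require Import all_classical all_reals all_analysis.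
From mathcomp Require Import measurable_realfun ring lra.
Require Import Defs.

Set Implicit Arguments.
Unset Strict Implicit.
Unset Printing Implicit Defensive.

Import Order.TTheory GRing.Theory Num.Theory.
Import numFieldNormedType.Exports.

Local Open Scope classical_set_scope.
Local Open Scope ring_scope.

(** * Positive parts of powers *)

(** The supports need not be convex, so the quadratic bound is not read off from convexity of a
    potential: the regularized potentials for tiny eps serve as approximate Kantorovich potentials.
    Their bound has a constant depending only on the distance of K0 to the complement of the
    support, on the size of the supports and on the Lipschitz constant of T, and an error that tends
    to 0. The resulting control of the distance to T by the excess cost does not mention eps, and
    applies to the plan of every eps in (0,1]. The side delta of the cells balances two errors:
    delta^2 in transport cost, because only the symmetrized cost counts, and eps delta^(-d(p-1)) in
    the penalty. Convexity of the support of mu enters through midpoints of points of a section.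
    Without it, eps must be small enough for the section to lie in a ball about T x contained in the
    support; that such a ball exists is proved by a descent argument. The gradient formula is
    derived: difference quotients are squeezed between weighted means over two sections. Continuity
    of these means requires the zero level of the slack to be negligible, as the weight is an
    indicator when p = 2. *)

Section real_powers.
Context {R : realType}.
Implicit Types (a b k : R).

Definition pos a : R := Num.max a 0.

Lemma pos_ge0 a : 0 <= pos a.
Proof. by rewrite /pos le_max lexx orbT. Qed.

Lemma pos_ge a : a <= pos a.
Proof. by rewrite /pos le_max lexx. Qed.

Lemma pos_le a b : (pos a <= b) = (a <= b) && (0 <= b).
Proof. by rewrite /pos ge_max. Qed.

Lemma gt0_pos a : 0 < a -> pos a = a.
Proof. by move=> a0; rewrite /pos max_l// ltW. Qed.

Lemma le0_pos a : a <= 0 -> pos a = 0.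
Proof. by move=> a0; rewrite /pos max_r. Qed.

(* Derivative of [t |-> pos t `^ k], up to the factor [k]; it is the
   indicator of positive numbers when [k = 1], where powR would give 1. *)
Definition wpos k a : R := if 0 < a then a `^ (k - 1) else 0.

Lemma wpos_ge0 k a : 0 <= wpos k a.
Proof. by rewrite /wpos; case: ifP => // _; exact: powR_ge0. Qed.

(** Young's inequality for a^(k-1) and b with the conjugate exponents k/(k-1) and k, multiplied by
    k. The case k = 1, where k/(k-1) makes no sense, is linear. *)
Lemma powR_tangent k a b : 1 <= k -> 0 < a -> 0 <= b ->
  a `^ k + k * (a `^ (k - 1) * (b - a)) <= b `^ k.
Proof.
rewrite le_eqVlt => /predU1P[<-|k1] a0 b0.
  by rewrite subrr powRr0 !powRr1// ?(ltW a0)//; lra.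
have k0 : 0 < k by lra.
pose k' := k / (k - 1).
have k'0 : 0 < k' by rewrite divr_gt0//; lra.
have := @conjugate_powR _ (a `^ (k - 1)) b k' k (powR_ge0 _ _) b0 k'0 k0.
have -> : k'^-1 + k^-1 = 1 by rewrite /k'; field; lra.
move=> /(_ erefl); rewrite -powRrM.
have -> : (k - 1) * k' = k by rewrite /k'; field; lra.
have ak : a * a `^ (k - 1) = a `^ k by rewrite mulr_powRB1// ltW.
rewrite -[X in _ <= X + _](_ : a `^ k * (k - 1) / k = _); last first.
  by rewrite /k'; field; lra.
set A := a `^ (k - 1) in ak *; set B := b `^ k.
move=> h.
have := ler_wpM2r (ltW k0) h.
have -> : (a `^ k * (k - 1) / k + B / k) * k = a `^ k * (k - 1) + B.
  by field; lra.
have alg (A' B' D b' : R) : a * A' = D -> A' * b' * k <= D * (k - 1) + B' ->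
    D + k * (A' * (b' - a)) <= B'.
  by move=> <- h'; lra.
exact: alg.
Qed.

Lemma pos_tangent k a b : 1 <= k ->
  pos a `^ k + k * (wpos k a * (b - a)) <= pos b `^ k.
Proof.
move=> k1; rewrite /wpos; case: ltP => a0; last first.
  by rewrite le0_pos// powR0 ?mul0r ?mulr0 ?addr0 ?powR_ge0// gt_eqF//; lra.
rewrite (gt0_pos a0); apply: le_trans (powR_tangent k1 a0 (pos_ge0 b)).
rewrite lerD2l ler_wpM2l//; first lra.
by rewrite ler_wpM2l ?powR_ge0// lerD2r pos_ge.
Qed.

(** The supporting line at the intermediate point lies below both end values; in the weighted sum
    its slope cancels. *)
Lemma pos_convex k t a b : 1 <= k -> 0 <= t <= 1 ->
  pos ((1 - t) * a + t * b) `^ k <= (1 - t) * pos a `^ k + t * pos b `^ k.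
Proof.
move=> k1 /andP[t0 t1]; set s := (X in pos X).
have ha := @pos_tangent k s a k1; have hb := @pos_tangent k s b k1.
have /(ler_wpM2l (_ : 0 <= 1 - t)) {}ha := ha; have {}ha := ha ltac:(lra).
have {}hb := ler_wpM2l t0 hb.
have e : (1 - t) * (k * (wpos k s * (a - s))) + t * (k * (wpos k s * (b - s))) = 0.
  by rewrite /s; ring.
by rewrite !mulrDr in ha hb; lra.
Qed.

End real_powers.

(** * Bounded measurable functions *)

Section bounded_measurable.
Context {R : realType}.

(** A class stable under all the operations below whose members are integrable for every
    probability, so that linearity and Fubini carry no further integrability conditions. *)
Definition bmf d (T : measurableType d) (f : T -> R) :=
  measurable_fun [set: T] f /\ exists M : R, forall x, `|f x| <= M.

Section one_space.
Context d (T : measurableType d).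
Implicit Types f g : T -> R.

Lemma bmf_cst c : bmf (fun _ : T => c).
Proof. by split; [exact: measurable_cst|exists `|c|]. Qed.

Lemma bmfD f g : bmf f -> bmf g -> bmf (fun x => f x + g x).
Proof.
move=> [mf [M fM]] [mg [N gN]]; split; first exact: measurable_funD.
by exists (M + N) => x; rewrite (le_trans (ler_normD _ _))// lerD.
Qed.

Lemma bmfN f : bmf f -> bmf (fun x => - f x).
Proof.
move=> [mf [M fM]]; split; first exact: measurableT_comp.
by exists M => x; rewrite normrN.
Qed.

Lemma bmfB f g : bmf f -> bmf g -> bmf (fun x => f x - g x).
Proof. by move=> bf bg; apply: bmfD => //; exact: bmfN. Qed.

Lemma bmfM f g : bmf f -> bmf g -> bmf (fun x => f x * g x).
Proof.
move=> [mf [M fM]] [mg [N gN]]; split; first exact: measurable_funM.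
by exists (M * N) => x; rewrite normrM ler_pM.
Qed.

Lemma bmfZ c f : bmf f -> bmf (fun x => c * f x).
Proof. by move=> bf; apply: bmfM => //; exact: bmf_cst. Qed.

Lemma bmf_sum (I : finType) (h : I -> T -> R) : (forall i, bmf (h i)) ->
  bmf (fun x => \sum_i h i x).
Proof.
move=> bh; suff H (s : seq I) : bmf (fun x => \sum_(i <- s) h i x) by exact: H.
elim: s => [|i s IH].
  by under eq_fun do rewrite big_nil; exact: bmf_cst.
by under eq_fun do rewrite big_cons; exact: bmfD.
Qed.

Lemma bmf_pos f : bmf f -> bmf (fun x => pos (f x)).
Proof.
move=> [mf [M fM]]; split; first exact: measurable_maxr.
exists M => x; rewrite ger0_norm ?pos_ge0// /pos ge_max.
by rewrite (le_trans (ler_norm _) (fM x)) (le_trans _ (fM x)).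
Qed.

Lemma bmf_powR k f : 0 <= k -> bmf f -> (forall x, 0 <= f x) ->
  bmf (fun x => f x `^ k).
Proof.
move=> k0 [mf [M fM]] f0; split.
  exact: (measurableT_comp (measurable_powR k)).
exists (M `^ k) => x; rewrite ger0_norm ?powR_ge0//.
have fM' : f x <= M by rewrite (le_trans (ler_norm _) (fM x)).
by apply: ge0_ler_powR => //; rewrite nnegrE ?f0// (le_trans (f0 x)).
Qed.

Lemma bmf_comp d' (T' : measurableType d') (h : T' -> T) f :
  measurable_fun [set: T'] h -> bmf f -> bmf (f \o h).
Proof.
by move=> mh [mf [M fM]]; split; [exact: measurableT_comp|exists M => x /=].
Qed.

Lemma bmf_indic (A : set T) : measurable A -> bmf (\1_A : T -> R).
Proof.
move=> mA; split; first exact: measurable_indic.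
by exists 1 => x; rewrite indicE; case: (_ \in _); rewrite ?normr1 ?normr0.
Qed.

Context (P : probability T R).

Lemma bmf_integrable f : bmf f -> P.-integrable [set: T] (EFin \o f).
Proof.
move=> [mf [M fM]]; apply: measurable_bounded_integrable => //.
  by rewrite (le_lt_trans (probability_le1 P measurableT)) ?ltry.
exists M; split; first exact: num_real.
by move=> N MN x _ /=; rewrite (le_trans (fM x))// ltW.
Qed.

Lemma intD f g : bmf f -> bmf g ->
  \int[P]_x (f x + g x) = \int[P]_x f x + \int[P]_x g x.
Proof. by move=> bf bg; rewrite RintegralD//; exact: bmf_integrable. Qed.

Lemma intB f g : bmf f -> bmf g ->
  \int[P]_x (f x - g x) = \int[P]_x f x - \int[P]_x g x.
Proof. by move=> bf bg; rewrite RintegralB//; exact: bmf_integrable. Qed.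

Lemma intZ c f : bmf f -> \int[P]_x (c * f x) = c * \int[P]_x f x.
Proof. by move=> bf; rewrite RintegralZl//; exact: bmf_integrable. Qed.

Lemma int_cst c : \int[P]_(_ in setT) c = c.
Proof. by rewrite Rintegral_cst//= probability_setT mulr1. Qed.

Lemma le_int f g : bmf f -> bmf g -> (forall x, f x <= g x) ->
  \int[P]_x f x <= \int[P]_x g x.
Proof. by move=> bf bg fg; apply: le_Rintegral => //; exact: bmf_integrable. Qed.

Lemma int_EFin f : bmf f -> (\int[P]_x f x)%:E = (\int[P]_x (f x)%:E)%E.
Proof.
move=> bf; rewrite /Rintegral fineK//.
exact: integrable_fin_num (bmf_integrable bf).
Qed.

End one_space.

Lemma int_pushforward d1 d2 (X : measurableType d1) (Y : measurableType d2)
    (P : probability X R) (Q : probability Y R) (h : X -> Y) (f : Y -> R) :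
  measurable_fun [set: X] h ->
  (forall B, measurable B -> P (h @^-1` B) = Q B) ->
  bmf f -> \int[Q]_y f y = \int[P]_x f (h x).
Proof.
move=> mh PQ bf; rewrite /Rintegral; congr fine.
rewrite [LHS](_ : _ = \int[pushforward P h]_y (f y)%:E)%E; last first.
  by apply: eq_measure_integral => A mA _; exact/esym/PQ.
rewrite (@integral_pushforward _ _ _ _ _ h mh P setT (EFin \o f))//.
- by apply/measurable_EFinP; exact: bf.1.
- rewrite preimage_setT; exact: (bmf_integrable P (bmf_comp mh bf)).
Qed.

Section two_spaces.
Context d1 d2 (X : measurableType d1) (Y : measurableType d2).
Context (P : probability X R) (Q : probability Y R).
Implicit Types f : X * Y -> R.

Lemma bmf_pair1 f x : bmf f -> bmf (fun y => f (x, y)).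
Proof. by apply: bmf_comp; exact: measurable_pair1. Qed.

Lemma bmf_pair2 f y : bmf f -> bmf (fun x => f (x, y)).
Proof. by apply: bmf_comp; exact: measurable_pair2. Qed.

Lemma bmf_fst (f : X -> R) : bmf f -> bmf (fun z : X * Y => f z.1).
Proof. by apply: bmf_comp; exact: measurable_fst. Qed.

Lemma bmf_snd (f : Y -> R) : bmf f -> bmf (fun z : X * Y => f z.2).
Proof. by apply: bmf_comp; exact: measurable_snd. Qed.

Lemma bmf_integrableX f : bmf f -> (P \x Q)%E.-integrable [set: X * Y] (EFin \o f).
Proof. exact: (@bmf_integrable _ _ ((P \x Q)%E : probability (X * Y)%type R)). Qed.

Lemma bmf_int f : bmf f -> bmf (fun x => \int[Q]_y f (x, y)).
Proof.
move=> bf; have [M fM] := bf.2; split.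
  exact: (measurableT_comp (@fine_measurable _ _ measurableT)
    (measurable_fubini_F (bmf_integrableX bf))).
exists M => x; have bx := bmf_pair1 x bf.
rewrite (le_trans (le_normr_Rintegral measurableT (bmf_integrable Q bx)))//.
rewrite -[leRHS](int_cst Q); apply: le_int => //; last exact: bmf_cst.
split; first by apply: measurableT_comp => //; exact: bx.1.
by exists M => y; rewrite normr_id.
Qed.

Lemma fubini f : bmf f ->
  \int[P]_x \int[Q]_y f (x, y) = \int[Q]_y \int[P]_x f (x, y).
Proof.
move=> bf; rewrite /Rintegral; congr fine.
under eq_integral do rewrite -/(Rintegral _ _ _) (int_EFin Q (bmf_pair1 _ bf)).
under [RHS]eq_integral do rewrite -/(Rintegral _ _ _) (int_EFin P (bmf_pair2 _ bf)).
apply: (@Fubini _ _ _ _ _ _ _ (EFin \o f)).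
exact: bmf_integrableX.
Qed.

End two_spaces.
End bounded_measurable.

Section double_integral.
Context {R : realType} d1 d2 (X : measurableType d1) (Y : measurableType d2).
Context (P : probability X R) (Q : probability Y R).
Implicit Types h : X * Y -> R.

(** Iterated, rather than taken against the product measure, so that marginal equations apply
    directly to the inner integral. *)
Definition dint h : R := \int[P]_x \int[Q]_y h (x, y).

Lemma eq_dint h h' : h =1 h' -> dint h = dint h'.
Proof. by move=> /funext ->. Qed.

Lemma dintD h h' : bmf h -> bmf h' ->
  dint (fun z => h z + h' z) = dint h + dint h'.
Proof.
move=> bh bh'; rewrite /dint -intD; [|exact: bmf_int..].
by apply: eq_Rintegral => x _; rewrite intD//; exact: bmf_pair1.
Qed.

Lemma dintZ c h : bmf h -> dint (fun z => c * h z) = c * dint h.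
Proof.
move=> bh; rewrite /dint -intZ; last exact: bmf_int.
by apply: eq_Rintegral => x _; rewrite intZ//; exact: bmf_pair1.
Qed.

Lemma dintB h h' : bmf h -> bmf h' ->
  dint (fun z => h z - h' z) = dint h - dint h'.
Proof.
move=> bh bh'; rewrite /dint -intB; [|exact: bmf_int..].
by apply: eq_Rintegral => x _; rewrite intB//; exact: bmf_pair1.
Qed.

Lemma le_dint h h' : bmf h -> bmf h' -> (forall z, h z <= h' z) ->
  dint h <= dint h'.
Proof.
move=> bh bh' hh'; apply: le_int; [exact: bmf_int..|].
by move=> x; apply: le_int => //; exact: bmf_pair1.
Qed.

Lemma dint_sum (I : finType) (h : I -> X * Y -> R) : (forall i, bmf (h i)) ->
  dint (fun z => \sum_i h i z) = \sum_i dint (h i).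
Proof.
move=> bh; suff H (s : seq I) : bmf (fun z => \sum_(i <- s) h i z) /\
    dint (fun z => \sum_(i <- s) h i z) = \sum_(i <- s) dint (h i).
  exact: (H _).2.
elim: s => [|i s [b IH]].
  split; first by under eq_fun do rewrite big_nil; exact: bmf_cst.
  rewrite big_nil -[RHS](int_cst P 0); apply: eq_Rintegral => x _.
  by under eq_Rintegral do rewrite big_nil; rewrite int_cst.
split; first by under eq_fun do rewrite big_cons; exact: bmfD.
rewrite big_cons -IH -(dintD (bh i) b).
by apply: eq_dint => z; rewrite big_cons.
Qed.

Lemma dint_prod (u : X -> R) (v : Y -> R) : bmf u -> bmf v ->
  dint (fun z => u z.1 * v z.2) = (\int[P]_x u x) * \int[Q]_y v y.
Proof.
move=> bu bv; rewrite /dint mulrC -intZ//.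
by apply: eq_Rintegral => x _; rewrite /= intZ// mulrC.
Qed.

End double_integral.

Lemma dint_swap {R : realType} d1 d2 (X : measurableType d1)
    (Y : measurableType d2) (P : probability X R) (Q : probability Y R) h :
  bmf h -> dint P Q h = dint Q P (fun z => h (z.2, z.1)).
Proof. exact: fubini. Qed.

Section marginals.
Context {R : realType} d1 d2 (X : measurableType d1) (Y : measurableType d2).
Context (P : probability X R) (Q : probability Y R).
Context (F : X -> R) (G : Y -> R) (c rho : X * Y -> R).
Hypotheses (bF : bmf F) (bG : bmf G) (bc : bmf c) (brho : bmf rho).

(** The duality identity: against a density with the right marginals, the slack integrates to the
    dual value minus the transport cost. *)
Lemma dint_marginals :
  dint P Q (fun z => F z.1 * rho z) = \int[P]_x F x ->
  dint P Q (fun z => G z.2 * rho z) = \int[Q]_y G y ->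
  dint P Q (fun z => (F z.1 + G z.2 - c z) * rho z) =
  \int[P]_x F x + \int[Q]_y G y - dint P Q (fun z => c z * rho z).
Proof.
have b1 : bmf (fun z => F z.1 * rho z) by apply: bmfM brho; exact: bmf_fst.
have b2 : bmf (fun z => G z.2 * rho z) by apply: bmfM brho; exact: bmf_snd.
have b3 : bmf (fun z => c z * rho z) by exact: bmfM brho.
move=> <- <-; rewrite -(dintD P Q b1 b2) -(dintB P Q (bmfD b1 b2) b3).
by apply: eq_dint => z; rewrite mulrBl mulrDl.
Qed.

Lemma dint_marginal_fst : (forall x, \int[Q]_y rho (x, y) = 1) ->
  dint P Q (fun z => F z.1 * rho z) = \int[P]_x F x.
Proof.
move=> rhoX; apply: eq_Rintegral => x _; rewrite /= intZ ?rhoX ?mulr1//.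
exact: bmf_pair1 brho.
Qed.

Lemma dint_marginal_snd : (forall y, \int[P]_x rho (x, y) = 1) ->
  dint P Q (fun z => G z.2 * rho z) = \int[Q]_y G y.
Proof.
move=> rhoY; rewrite dint_swap; last by apply: bmfM brho; exact: bmf_snd.
apply: eq_Rintegral => y _; rewrite /= intZ ?rhoY ?mulr1//.
exact: bmf_pair2 brho.
Qed.

End marginals.

(** * Comparison of the regularized plan with a competitor *)

Section regularized_gap.
Context {R : realType} (p eps : R).
Hypotheses (p1 : 1 < p) (eps0 : 0 < eps).
Let k := conj_exp p - 1.
Let c0 : R := eps `^ k * conj_exp p `^ k.

Lemma conj_exp_subE : k = (p - 1)^-1.
Proof.
have := p1; rewrite /k /conj_exp => h; field.
by rewrite subr_eq0 gt_eqF.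
Qed.

Lemma conj_exp_gt1 : 1 < conj_exp p.
Proof. by have := p1 => h; rewrite /conj_exp ltr_pdivlMr; lra. Qed.

(* Convexity of [t |-> t `^ p] at the optimal density: the slack is the
   derivative of the regularization there. *)
Lemma slack_young xi r : 0 <= r ->
  xi * r - xi * (c0^-1 * pos xi `^ k) <= eps / (p - 1) * r `^ p.
Proof.
move=> r0; have q1 := conj_exp_gt1; have kE := conj_exp_subE.
have h1 := p1; have h2 := eps0; have p10 : 0 < p - 1 by lra.
have k0 : 0 < k by rewrite kE invr_gt0.
have [xi0|xi0] := leP xi 0.
  rewrite (le0_pos xi0) powR0 ?gt_eqF// !mulr0 subr0.
  by rewrite (@le_trans _ _ 0) ?mulr_le0_ge0// mulr_ge0 ?powR_ge0// divr_ge0// ltW.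
rewrite gt0_pos//.
have -> : c0^-1 * xi `^ k = (xi / (eps * conj_exp p)) `^ k.
  rewrite powRM ?invr_ge0 ?(ltW xi0)// ?mulr_ge0//; try lra.
  rewrite /c0 -powRM; [|lra..].
  by rewrite -[in RHS]powR_inv1 ?mulr_ge0//; try lra; rewrite powRAC powR_inv1 ?powR_ge0// mulrC.
(* The optimal density is t^k. As k (p - 1) = 1, the derivative of s^p at s = t^k is p t, and eps /
   (p - 1) times it is [xi]. *)
set t := xi / (eps * conj_exp p).
have t0 : 0 < t by rewrite divr_gt0// mulr_gt0//; lra.
have := @powR_tangent _ p (t `^ k) r (ltW p1) (powR_gt0 _ t0) r0.
rewrite -[_ `^ (p - 1)]powRrM (_ : k * (p - 1) = 1) ?powRr1 ?(ltW t0)//; last first.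
  by rewrite kE; field; lra.
move=> h; have A0 : 0 <= (t `^ k) `^ p by exact: powR_ge0.
have -> : xi = eps / (p - 1) * (p * t).
  by rewrite /t /conj_exp; field; rewrite !gt_eqF//=; lra.
have E0 : 0 <= eps / (p - 1) by rewrite divr_ge0// ltW.
have := ler_wpM2l E0 h; have := mulr_ge0 E0 A0.
move: (eps / (p - 1)) ((t `^ k) `^ p) (r `^ p) (t `^ k) => e S B s.
by move=> hS hB; lra.
Qed.

Context d1 d2 (X : measurableType d1) (Y : measurableType d2).
Context (P : probability X R) (Q : probability Y R).
Context (F : X -> R) (G : Y -> R) (c r : X * Y -> R).
Hypotheses (bF : bmf F) (bG : bmf G) (bc : bmf c) (br : bmf r).
Let xi z := F z.1 + G z.2 - c z.
Let rho z := c0^-1 * pos (xi z) `^ k.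
Hypothesis rhoX : forall x, \int[Q]_y rho (x, y) = 1.
Hypothesis rhoY : forall y, \int[P]_x rho (x, y) = 1.
Hypothesis r0 : forall z, 0 <= r z.
Hypothesis rF : dint P Q (fun z => F z.1 * r z) = \int[P]_x F x.
Hypothesis rG : dint P Q (fun z => G z.2 * r z) = \int[Q]_y G y.

Lemma bmf_xi : bmf xi.
Proof. by apply: bmfB => //; apply: bmfD; [exact: bmf_fst|exact: bmf_snd]. Qed.

Lemma bmf_rho : bmf rho.
Proof.
apply: bmfZ; apply: bmf_powR => [||z]; last exact: pos_ge0.
  by rewrite conj_exp_subE invr_ge0 subr_ge0 ltW.
exact/bmf_pos/bmf_xi.
Qed.

(** Integrate [slack_young]: [rho] and [r] pair equally with [F] and [G], so only the costs survive.
    The competitor [r] is only asked for these pairings, because the block coupling has marginal 0,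
    not 1, over blocks of mass zero. *)
Lemma regularized_gap :
  dint P Q (fun z => c z * rho z) <=
  dint P Q (fun z => c z * r z) + eps / (p - 1) * dint P Q (fun z => r z `^ p).
Proof.
have bxr : bmf (fun z => xi z * rho z) by exact: bmfM bmf_xi bmf_rho.
have bp : bmf (fun z => r z `^ p).
  by apply: bmf_powR => //; rewrite ltW// (lt_trans ltr01).
have bxr' : bmf (fun z => xi z * r z) by exact: bmfM bmf_xi br.
have : dint P Q (fun z => xi z * r z - xi z * rho z) <=
    dint P Q (fun z => eps / (p - 1) * r z `^ p).
  apply: le_dint; [exact: bmfB|exact: bmfZ|].
  by move=> z; exact: slack_young.
rewrite (dintB P Q bxr' bxr) (dintZ P Q _ bp).
rewrite (dint_marginals bF bG bc br rF rG).
rewrite (dint_marginals bF bG bc bmf_rho); last 2 first.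
- exact: (dint_marginal_fst P F bmf_rho rhoX).
- exact: (dint_marginal_snd Q bG bmf_rho rhoY).
move: (Rintegral _ _ F) (Rintegral _ _ G) (dint _ _ _) (dint _ _ _) (_ * _).
by move=> a b u v w; lra.
Qed.

End regularized_gap.

Lemma half_sum_le (R : realFieldType) (a b c : R) : a + a <= b + b + c -> a <= b + c / 2.
Proof. by move=> h; lra. Qed.

(** * Couplings that mix the points of each cell of a finite partition *)

Section block_coupling.
Context {R : realType} d (X : measurableType d) (P : probability X R).
Context (J : finType) (k : X -> J).
Hypothesis mk : forall j, measurable (k @^-1` [set j]).
Implicit Types (u v : X -> R) (a : J -> R).

Let ind j : X -> R := \1_(k @^-1` [set j]).
Let w j : R := \int[P]_x ind j x.

Let bind j : bmf (ind j). Proof. exact: bmf_indic. Qed.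

Let indE j x : ind j x = (k x == j)%:R.
Proof.
rewrite /ind indicE; congr ((nat_of_bool _)%:R).
by apply/idP/eqP => [|kj]; rewrite inE.
Qed.

Definition block a (z : X * X) : R := a (k z.1) * (k z.1 == k z.2)%:R.

Let block_sum a z : block a z = \sum_j a j * (ind j z.1 * ind j z.2).
Proof.
rewrite (bigD1 (k z.1))//= big1 ?addr0 => [|j jz].
  by rewrite !indE eqxx mul1r /block eq_sym.
by rewrite !indE eq_sym (negbTE jz) mul0r mulr0.
Qed.

Lemma bmf_block a : bmf (block a).
Proof.
rewrite (_ : block a = fun z => \sum_j a j * (ind j z.1 * ind j z.2)); last first.
  by apply/funext => z; rewrite block_sum.
apply: bmf_sum => j; apply: bmfZ; apply: bmfM.
  exact: (bmf_fst _ (bind j)).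
exact: (bmf_snd _ (bind j)).
Qed.

Lemma dint_block a u v : bmf u -> bmf v ->
  dint P P (fun z => u z.1 * v z.2 * block a z) =
  \sum_j a j * ((\int[P]_x (u x * ind j x)) * \int[P]_x (v x * ind j x)).
Proof.
move=> bu bv.
have b j : bmf (fun x => u x * ind j x) by exact: bmfM.
have b' j : bmf (fun x => v x * ind j x) by exact: bmfM.
transitivity (dint P P (fun z => \sum_j
    a j * ((u z.1 * ind j z.1) * (v z.2 * ind j z.2)))).
  apply: eq_dint => z; rewrite block_sum mulr_sumr; apply: eq_bigr => j _.
  by ring.
rewrite dint_sum => [|j]; last first.
  apply: bmfZ; apply: bmfM; first exact: (bmf_fst _ (b j)).
  exact: (bmf_snd _ (b' j)).
apply: eq_bigr => j _; rewrite dintZ.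
  by rewrite (dint_prod P P (b j) (b' j)).
apply: bmfM; first exact: (bmf_fst _ (b j)).
exact: (bmf_snd _ (b' j)).
Qed.

Lemma block_weight_ge0 j : 0 <= w j.
Proof. by apply: Rintegral_ge0 => x _; rewrite indE. Qed.

Lemma int_block_sum u : bmf u -> \sum_j \int[P]_x (u x * ind j x) = \int[P]_x u x.
Proof.
move=> bu; have b1 := bmf_cst X (1 : R).
(* A trivial second factor makes [dint_sum] available for exchanging sum and integral. *)
transitivity (dint P P (fun z => \sum_j (u z.1 * ind j z.1) * 1)).
  rewrite dint_sum => [|j]; last first.
    by apply: bmfM; [exact: (bmf_fst _ (bmfM bu (bind j)))|exact: bmf_cst].
  apply: eq_bigr => j _.
  rewrite (dint_prod P P (u := fun x => u x * ind j x) (v := fun=> 1))//.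
    by rewrite int_cst mulr1.
  exact: bmfM.
rewrite /dint; apply: eq_Rintegral => x _ /=.
rewrite int_cst (bigD1 (k x))//= big1 ?addr0 => [|j jx].
  by rewrite indE eqxx !mulr1.
by rewrite indE eq_sym (negbTE jx) mulr0 mul0r.
Qed.

Lemma block_weight_sum : \sum_j w j = 1.
Proof.
rewrite -(int_cst P 1) -(int_block_sum (bmf_cst X 1)).
by apply: eq_bigr => j _; apply: eq_Rintegral => x _; rewrite mul1r.
Qed.

Lemma int_null_block u j : bmf u -> w j = 0 -> \int[P]_x (u x * ind j x) = 0.
Proof.
move=> bu wj; have [M uM] := bu.2.
have bi : bmf (fun x => M * ind j x) by exact: bmfZ.
have bui : bmf (fun x => u x * ind j x) by exact: bmfM.
apply/eqP; rewrite eq_le; apply/andP; split.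
  rewrite (_ : 0 = \int[P]_x (M * ind j x)); last by rewrite intZ// -/(w j) wj mulr0.
  apply: le_int => // x; rewrite ler_wpM2r// ?indE//.
  by rewrite (le_trans (ler_norm _)).
rewrite (_ : 0 = \int[P]_x ((- M) * ind j x)); last by rewrite intZ// -/(w j) wj mulr0.
apply: le_int => //; first exact: bmfZ.
by move=> x; rewrite ler_wpM2r// ?indE// lerNl (le_trans _ (uM x))// -normrN ler_norm.
Qed.

(** The density of the coupling of [P] with itself that draws a cell by its mass and then two
    independent points of that cell. On a cell of mass zero the inverse is 0, and so is the
    density. *)
Definition block_coupling : X * X -> R := block (fun j => (w j)^-1).

Lemma block_coupling_ge0 z : 0 <= block_coupling z.
Proof. by rewrite mulr_ge0// invr_ge0 block_weight_ge0. Qed.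

Lemma bmf_block_coupling : bmf block_coupling.
Proof. exact: bmf_block. Qed.

Let one_ind j : \int[P]_x (1 * ind j x) = w j.
Proof. by apply: eq_Rintegral => x _; rewrite mul1r. Qed.

Lemma block_coupling_fst u : bmf u ->
  dint P P (fun z => u z.1 * block_coupling z) = \int[P]_x u x.
Proof.
move=> bu; rewrite -int_block_sum//.
transitivity (dint P P (fun z => u z.1 * 1 * block_coupling z)).
  by apply: eq_dint => z; rewrite mulr1.
rewrite (dint_block _ bu (bmf_cst X 1)); apply: eq_bigr => j _.
rewrite one_ind; have [w0|w0] := eqVneq (w j) 0.
  by rewrite int_null_block// mul0r mulr0.
by rewrite mulrCA mulVf ?mulr1.
Qed.

Lemma block_coupling_sym z : block_coupling (z.2, z.1) = block_coupling z.
Proof.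
case: z => x y; rewrite /block_coupling /block /=.
rewrite eq_sym; case: eqP => [->//|_].
by rewrite !mulr0.
Qed.

Lemma block_coupling_snd u : bmf u ->
  dint P P (fun z => u z.2 * block_coupling z) = \int[P]_x u x.
Proof.
move=> bu; have b1 := bmfM (bmf_snd _ bu) bmf_block_coupling.
rewrite -(block_coupling_fst bu) (dint_swap _ _ b1).
by apply: eq_dint => z /=; rewrite block_coupling_sym.
Qed.

(* The block coupling is symmetric, so that only the symmetrized cost matters:
   for the squared distance it is of second order in the size of the blocks. *)
Lemma block_coupling_cost (C : X * X -> R) eta : bmf C ->
  (forall x y, k x = k y -> C (x, y) + C (y, x) <= C (x, x) + C (y, y) + eta) ->
  dint P P (fun z => C z * block_coupling z) <=
    \int[P]_x C (x, x) + eta / 2.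
Proof.
move=> bC hC; have bb := bmf_block_coupling.
have bd : bmf (fun x => C (x, x)).
  by apply: (bmf_comp (h := fun x => (x, x)) _ bC); exact: measurable_fun_pair.
have bsw : bmf (fun z => C (z.2, z.1)).
  apply: (bmf_comp (h := fun z : X * X => (z.2, z.1)) _ bC).
  by apply: measurable_fun_pair; [exact: measurable_snd|exact: measurable_fst].
have b1 := bmfM bC bb; have b2 := bmfM bsw bb.
have b3 := bmfM (bmf_fst _ bd) bb; have b4 := bmfM (bmf_snd _ bd) bb.
have b5 := bmfZ eta bb.
have e1 : dint P P (fun z => C (z.2, z.1) * block_coupling z) =
    dint P P (fun z => C z * block_coupling z).
  rewrite (dint_swap _ _ b2); apply: eq_dint => -[x y] /=.
  by rewrite -[in RHS]block_coupling_sym.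
have e2 : dint P P (fun z => eta * block_coupling z) = eta.
  have := block_coupling_fst (bmf_cst X eta).
  by rewrite int_cst.
have : dint P P (fun z => C z * block_coupling z + C (z.2, z.1) * block_coupling z) <=
    dint P P (fun z => (C (z.1, z.1) * block_coupling z +
       C (z.2, z.2) * block_coupling z) + eta * block_coupling z).
  apply: le_dint; [exact: bmfD|exact: bmfD (bmfD b3 b4) b5|].
  move=> -[x y] /=; rewrite -!mulrDl.
  have [kxy|kxy] := eqVneq (k x) (k y).
    by rewrite ler_wpM2r ?block_coupling_ge0// hC.
  by rewrite /block_coupling /block /= (negbTE kxy) !mulr0.
rewrite (dintD P P b1 b2) (dintD P P (bmfD b3 b4) b5) (dintD P P b3 b4).
rewrite e1 e2 (block_coupling_fst bd) (block_coupling_snd bd).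
move=> h; exact: half_sum_le.
Qed.

(** The integral is the sum of w_j^(2-p). A term with w_j <= 1/N is at most N^(p-2), any other at
    most w_j N^(p-1); there are at most N terms, and the w_j add up to 1. *)
Lemma block_coupling_pow (p N : R) : 1 < p <= 2 -> 0 < N -> #|J|%:R <= N ->
  dint P P (fun z => block_coupling z `^ p) <= 2 * N `^ (p - 1).
Proof.
move=> /andP[p1 p2] N0 JN.
have -> : dint P P (fun z => block_coupling z `^ p) =
    \sum_j ((w j)^-1) `^ p * (w j * w j).
  transitivity (dint P P (fun z => 1 * 1 * block (fun j => ((w j)^-1) `^ p) z)).
    apply: eq_dint => z; rewrite /block_coupling /block !mul1r.
    case: eqP => _; first by rewrite !mulr1.
    by rewrite !mulr0 powR0// gt_eqF//; lra.
  rewrite (dint_block _ (bmf_cst X 1) (bmf_cst X 1)).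
  by apply: eq_bigr => j _; rewrite one_ind.
have NE : N `^ (p - 1) = N * N `^ (p - 2).
  by rewrite -{2}[N]powRr1 ?(ltW N0)// -powRD; [congr (_ `^ _); ring|rewrite (gt_eqF N0) implybT].
apply: (@le_trans _ _ (\sum_(j in J) (w j * N `^ (p - 1) + N `^ (p - 2)))).
  apply: ler_sum => j _; have := block_weight_ge0 j.
  rewrite le_eqVlt => /predU1P[<-|w0].
    by rewrite !mulr0 mul0r add0r powR_ge0.
  have -> : ((w j)^-1) `^ p * (w j * w j) = w j `^ (2 - p).
    rewrite -powR_inv1 ?(ltW w0)// -powRrM -[w j * w j]expr2 -powR_mulrn ?(ltW w0)//.
    rewrite -powRD; last by rewrite (gt_eqF w0) implybT.
    by congr (_ `^ _); ring.
  have [wN|wN] := leP (w j) N^-1.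
    apply: (@le_trans _ _ (N^-1 `^ (2 - p))).
      by apply: ge0_ler_powR; rewrite ?nnegrE ?(ltW w0) ?invr_ge0 ?(ltW N0)//; lra.
    rewrite -powR_inv1 ?(ltW N0)// -powRrM (_ : -1 * (2 - p) = p - 2); last by ring.
    by rewrite lerDr mulr_ge0 ?powR_ge0// ltW.
  have -> : w j `^ (2 - p) = w j * ((w j)^-1) `^ (p - 1).
    rewrite -[X in X * _]powRr1 ?(ltW w0)// -powR_inv1 ?(ltW w0)// -powRrM.
    rewrite -powRD; last by rewrite (gt_eqF w0) implybT.
    by congr (_ `^ _); ring.
  rewrite -[leLHS]addr0 lerD ?powR_ge0// ler_wpM2l ?(ltW w0)//.
  apply: ge0_ler_powR; rewrite ?nnegrE ?invr_ge0 ?(ltW w0) ?(ltW N0)//; first lra.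
  by rewrite -[leRHS]invrK lef_pV2 ?posrE ?invr_gt0// ltW.
rewrite big_split/= -mulr_suml block_weight_sum mul1r sumr_const.
rewrite [2 * _]mulr_natl mulr2n lerD2l NE -[leLHS]mulr_natl.
by rewrite ler_wpM2r// powR_ge0.
Qed.

End block_coupling.

(** * Euclidean geometry and Lebesgue measure *)

Section euclidean_space.
Context {R : realType} {d : nat}.
Local Notation E := 'rV[R]_d.
Implicit Types (x y z t : E) (a b : R).

Definition dot x y : R := \sum_(i < d) x ord0 i * y ord0 i.

Lemma dotC x y : dot x y = dot y x.
Proof. by apply: eq_bigr => i _; rewrite mulrC. Qed.

Lemma dotDl x y z : dot (x + y) z = dot x z + dot y z.
Proof. by rewrite -big_split/=; apply: eq_bigr => i _; rewrite mxE mulrDl. Qed.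

Lemma dotZl a x y : dot (a *: x) y = a * dot x y.
Proof. by rewrite mulr_sumr; apply: eq_bigr => i _; rewrite mxE mulrA. Qed.

Lemma dotNl x y : dot (- x) y = - dot x y.
Proof. by rewrite -scaleN1r dotZl mulN1r. Qed.

Lemma dotDr x y z : dot x (y + z) = dot x y + dot x z.
Proof. by rewrite dotC dotDl !(dotC x). Qed.

Lemma dotZr a x y : dot x (a *: y) = a * dot x y.
Proof. by rewrite dotC dotZl dotC. Qed.

Lemma dotNr x y : dot x (- y) = - dot x y.
Proof. by rewrite dotC dotNl dotC. Qed.

Lemma enorm_ge0 x : 0 <= enorm x.
Proof. exact: sqrtr_ge0. Qed.

Lemma enorm_sqr x : enorm x ^+ 2 = dot x x.
Proof.
rewrite /enorm sqr_sqrtr; first by apply: eq_bigr => i _; rewrite expr2.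
by apply: sumr_ge0 => i _; exact: sqr_ge0.
Qed.

Lemma enorm0 : enorm (0 : E) = 0.
Proof. by rewrite /enorm big1 ?sqrtr0// => i _; rewrite mxE expr0n. Qed.

Lemma enorm_coord x i : `|x ord0 i| <= enorm x.
Proof.
rewrite -sqrtr_sqr; apply: ler_wsqrtr; rewrite (bigD1 i)//= lerDl.
by apply: sumr_ge0 => j _; exact: sqr_ge0.
Qed.

Lemma enorm_eq0 x : enorm x = 0 -> x = 0.
Proof.
move=> x0; apply/rowP => i; rewrite mxE; apply/eqP; rewrite -normr_eq0.
by rewrite eq_le normr_ge0 andbT -x0 enorm_coord.
Qed.

Lemma dot_le x y : dot x y <= enorm x * enorm y.
Proof.
have [y0|y0] := eqVneq (enorm y) 0.
  rewrite (enorm_eq0 y0) enorm0 mulr0 dotC -(scale0r 0) dotZl mul0r//.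
have B0 : 0 < enorm y by rewrite lt_neqAle eq_sym y0 enorm_ge0.
set w := (enorm y ^+ 2) *: x - (dot x y) *: y.
have := sqr_ge0 (enorm w).
rewrite enorm_sqr /w !(dotDl, dotDr, dotZl, dotZr, dotNl, dotNr) (dotC y x).
rewrite -!enorm_sqr; set A := enorm x; set B := enorm y; set C := dot x y => h.
have : 0 <= B ^+ 2 * (A ^+ 2 * B ^+ 2 - C ^+ 2) by move: h; lra.
rewrite pmulr_rge0 ?exprn_gt0// subr_ge0 -exprMn => CAB.
rewrite (le_trans (ler_norm _))// -[leRHS]ger0_norm ?mulr_ge0 ?enorm_ge0//.
by rewrite -ler_sqr ?nnegrE// !real_normK// num_real.
Qed.

Lemma enormD x y : enorm (x + y) <= enorm x + enorm y.
Proof.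
have := dot_le x y.
rewrite -(@ler_sqr _ (enorm (x + y))) ?nnegrE ?addr_ge0 ?enorm_ge0// enorm_sqr.
rewrite dotDl !dotDr (dotC y x) sqrrD -!enorm_sqr mulr2n.
by move: (dot x y) (_ * _) => a b; lra.
Qed.

Lemma enorm_sqrB x y :
  enorm (x - y) ^+ 2 = enorm x ^+ 2 - 2 * dot x y + enorm y ^+ 2.
Proof.
rewrite !enorm_sqr !(dotDl, dotDr, dotNl, dotNr) (dotC y x).
by move: (dot _ _) (dot _ _) (dot _ _) => a b c; ring.
Qed.

Lemma enormN x : enorm (- x) = enorm x.
Proof. by congr Num.sqrt; apply: eq_bigr => i _; rewrite mxE sqrrN. Qed.

Lemma enormB x y : enorm (x - y) = enorm (y - x).
Proof. by rewrite -enormN opprB. Qed.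

Lemma enormZ a x : enorm (a *: x) = `|a| * enorm x.
Proof.
rewrite -sqrtr_sqr -sqrtrM ?sqr_ge0// mulr_sumr; congr Num.sqrt.
by apply: eq_bigr => i _; rewrite mxE exprMn.
Qed.

Lemma enorm_triangle x y z : enorm (x - z) <= enorm (x - y) + enorm (y - z).
Proof. by rewrite (le_trans _ (enormD _ _))// addrA subrK. Qed.

Lemma ler_enorm_dist x y : `|enorm x - enorm y| <= enorm (x - y).
Proof.
have h1 := enormD (x - y) y; have h2 := enormD (y - x) x.
rewrite subrK in h1; rewrite subrK enormB in h2.
by rewrite ler_norml; apply/andP; split; lra.
Qed.

Lemma norm_le_enorm x : `|x| <= enorm x.
Proof.
rewrite /Num.norm/= mx_normrE; apply: bigmax_le; first exact: enorm_ge0.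
by move=> -[i j] _; rewrite ord1 enorm_coord.
Qed.

Lemma coord_le_norm x i : `|x ord0 i| <= `|x|.
Proof. by rewrite [leRHS]/Num.norm/= mx_normrE (le_bigmax _ _ (ord0, i)). Qed.

Lemma enorm_le_norm x : enorm x <= d%:R * `|x|.
Proof.
have : enorm x <= \sum_(i < d) `|x ord0 i|.
  rewrite -ler_sqr ?nnegrE ?enorm_ge0 ?sumr_ge0// enorm_sqr expr2 mulr_suml.
  apply: ler_sum => i _; rewrite (le_trans (ler_norm _))// normrM.
  rewrite ler_wpM2l// (bigD1 i)//= lerDl; exact: sumr_ge0.
move=> /le_trans; apply; rewrite mulr_natl -[X in _ *+ X]card_ord -sumr_const.
by apply: ler_sum => i _; exact: coord_le_norm.
Qed.

Lemma costE x y : cost x y = 2^-1 * enorm x ^+ 2 + 2^-1 * enorm y ^+ 2 - dot x y.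
Proof.
by rewrite /cost enorm_sqr !(dotDl, dotDr, dotNl, dotNr) (dotC y x) -!enorm_sqr; field.
Qed.

Lemma cost_ge0 x y : 0 <= cost x y.
Proof. by rewrite mulr_ge0 ?sqr_ge0. Qed.

(** In an alternating sum over a rectangle all functions of one variable cancel, and so do the
    potentials when the same sum is taken of slacks. Every monotonicity argument below rests on
    this. *)
Lemma cost_cross x y z t :
  cost x y - cost z y - cost x t + cost z t = dot (x - z) (t - y).
Proof. by rewrite !costE !(dotDl, dotDr, dotNl, dotNr); lra. Qed.

Lemma costC x y : cost x y = cost y x.
Proof. by rewrite /cost enormB. Qed.

Lemma cost_lip M x y z : enorm x <= M -> enorm y <= M -> enorm z <= M ->
  `|cost x y - cost x z| <= 2 * M * enorm (y - z).
Proof.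
move=> xM yM zM; rewrite /cost -mulrBr subr_sqr.
have h := ler_enorm_dist (x - y) (x - z).
rewrite (_ : x - y - (x - z) = z - y) in h; last by rewrite opprB addrC addrA subrK.
rewrite normrM ger0_norm ?invr_ge0// normrM [enorm (y - z)]enormB.
rewrite [X in _ * (_ * X)]ger0_norm ?addr_ge0 ?enorm_ge0//.
have h1 := enormD x (- y); have h2 := enormD x (- z).
rewrite !enormN in h1 h2.
have hM : enorm (x - y) + enorm (x - z) <= 4 * M by lra.
have := ler_pM (normr_ge0 _) (addr_ge0 (enorm_ge0 _) (enorm_ge0 _)) h hM.
by lra.
Qed.

Lemma cost_le M x y : enorm x <= M -> enorm y <= M -> `|cost x y| <= 2 * M ^+ 2.
Proof.
move=> xM yM; rewrite ger0_norm ?cost_ge0// /cost.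
have h := enormD x (- y); rewrite enormN in h.
have h2 : enorm (x - y) <= 2 * M by lra.
have M0 : 0 <= M by exact: le_trans (enorm_ge0 _) xM.
have : enorm (x - y) ^+ 2 <= (2 * M) ^+ 2.
  by rewrite ler_sqr ?nnegrE ?enorm_ge0 ?mulr_ge0.
by rewrite exprMn; lra.
Qed.

Lemma dot_sum x (I : finType) (v : I -> E) (a : I -> R) :
  dot (\sum_i a i *: v i) x = \sum_i a i * dot (v i) x.
Proof.
elim/big_rec2 : _ => [|i u w _ <-].
  by rewrite -(scale0r 0) dotZl mul0r.
by rewrite dotDl dotZl.
Qed.

End euclidean_space.

Section measurability_rV.
Context {R : realType} {d : nat}.
Local Notation E := 'rV[R]_d.

Lemma measurable_enorm : measurable_fun [set: E] (@enorm R d).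
Proof.
pose s (x : E) := \sum_(i < d) x ord0 i ^+ 2.
have -> : @enorm R d = (fun a => a `^ 2^-1) \o s.
  by apply/funext => x /=; rewrite powR12_sqrt// sumr_ge0// => i _; exact: sqr_ge0.
apply: (measurableT_comp (measurable_powR _)).
apply: measurable_sum => i; apply: measurable_funX; exact: measurable_coord_rV.
Qed.

Lemma measurable_addrV d' (T : measurableType d') (u v : T -> E) :
  measurable_fun [set: T] u -> measurable_fun [set: T] v ->
  measurable_fun [set: T] (fun t => u t + v t).
Proof.
move=> mu mv; apply: measurable_fun_rVP => i; under eq_fun do rewrite mxE.
by apply: measurable_funD; apply: measurableT_comp (measurable_coord_rV _) _.
Qed.

Lemma measurable_scalerV d' (T : measurableType d') (a : R) (v : T -> E) :
  measurable_fun [set: T] v -> measurable_fun [set: T] (fun t => a *: v t).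
Proof.
move=> mv; apply: measurable_fun_rVP => i; under eq_fun do rewrite mxE.
by apply: measurable_funM => //; apply: measurableT_comp (measurable_coord_rV _) _.
Qed.

Lemma measurable_cost d' (T : measurableType d') (u v : T -> E) :
  measurable_fun [set: T] u -> measurable_fun [set: T] v ->
  measurable_fun [set: T] (fun t => cost (u t) (v t)).
Proof.
move=> mu mv; apply: measurable_funM => //; apply: measurable_funX.
apply: (measurableT_comp measurable_enorm); apply: measurable_addrV => //.
under eq_fun do rewrite -scaleN1r; exact: measurable_scalerV.
Qed.

Lemma measurable_ball_rV (x : E) r : measurable (ball x r).
Proof.
(* The test on [r] matters in dimension 0, where the empty intersection is everything while a ball
   of nonpositive radius is empty. *)
rewrite (_ : ball x r = if 0 < r then \bigcap_(i in [set: 'I_d])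
    ((fun y : E => y ord0 i) @^-1` ball (x ord0 i) r) else set0).
  case: ifP => // _; apply: fin_bigcap_measurable; first exact: finite_finset.
  move=> i _; rewrite -[X in measurable X]setTI; apply: measurable_coord_rV => //.
  exact: measurable_ball.
case: ifPn => [r0|]; last first.
  by rewrite -leNgt => r0; apply/seteqP; split => // y []; rewrite ltNge r0.
apply/seteqP; split => [y [_ xy] i _|y xy]; first exact: xy.
by split => // i j; rewrite ord1; exact: xy.
Qed.

(** The sigma-algebra is generated by the coordinates. An open set is the union of the balls inside
    it with rational centre and radius 1/(n+1), and [unpickle] enumerates these. *)
Lemma open_measurable_rV (U : set E) : open U -> measurable U.
Proof.
move=> oU; pose q2r (q : 'rV[rat]_d) : E := map_mx ratr q.
pose D := [set qn : 'rV[rat]_d * nat | ball (q2r qn.1) qn.2.+1%:R^-1 `<=` U].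
pose F (n : nat) := if unpickle n is Some qn then
  (if qn \in D then ball (q2r qn.1) qn.2.+1%:R^-1 else set0) else set0.
have -> : U = \bigcup_n F n; last first.
  apply: bigcup_measurable => n _; rewrite /F; case: unpickle => // qn.
  by case: ifP => _; [exact: measurable_ball_rV|exact: measurable0].
apply/seteqP; split; last first.
  move=> y [n _]; rewrite /F; case: unpickle => // qn.
  by case: ifPn => //; rewrite inE => DU /DU.
move=> x Ux; have /nbhs_ballP[e /= e0 xeU] := open_nbhs_nbhs (conj oU Ux).
  have [n nE] : exists n : nat, 2 * n.+1%:R^-1 < e.
    have [n] := ltr_add_invr (y := 0) (x := e / 2) ltac:(lra).
    by rewrite add0r => h; exists n; rewrite mulrC -ltr_pdivlMr.
  have n0 : 0 < n.+1%:R^-1 :> R by rewrite invr_gt0.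
  have [q qx] : exists q : 'rV[rat]_d, ball x n.+1%:R^-1 (q2r q).
    have h i : exists q : rat, ball (x ord0 i) n.+1%:R^-1 (ratr q : R).
      have [q] := @rat_in_itvoo R (x ord0 i) (x ord0 i + n.+1%:R^-1) ltac:(by rewrite ltrDl).
      rewrite in_itv/= => /andP[q1 q2]; exists q.
      by rewrite /ball/= ltr_norml; move: n0 q1 q2; set v := (n.+1%:R^-1) => n0 q1 q2;
        apply/andP; split; lra.
    exists (\row_i projT1 (cid (h i))); split => // i j; rewrite ord1 !mxE.
    by case: cid.
exists (pickle (q, n)) => //; rewrite /F pickleK mem_set; first exact: ball_sym.
  move=> y /= qy; apply: xeU; apply: (@le_ball _ _ _ (n.+1%:R^-1 + n.+1%:R^-1)).
    have -> (u : R) : u + u = 2 * u by ring.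
    exact: ltW.
  exact: ball_triangle qx qy.
Qed.

Lemma closed_measurable_rV (A : set E) : closed A -> measurable A.
Proof.
by move=> cA; rewrite -(setCK A); apply: measurableC; apply: open_measurable_rV; exact: closed_openC.
Qed.

Lemma compact_enorm_bounded (A : set E) : compact A ->
  exists M : R, 0 < M /\ forall x, A x -> enorm x <= M.
Proof.
move=> /compact_bounded [M [_ HM]]; exists (d%:R * (`|M| + 1) + 1).
have h0 : 0 <= d%:R * (`|M| + 1) by rewrite mulr_ge0// addr_ge0.
split; first lra.
move=> x Ax; have := HM (`|M| + 1) ltac:(by rewrite (le_lt_trans (ler_norm _))//; lra) x Ax.
by move=> /(ler_wpM2l (ler0n R d)); have := enorm_le_norm x; lra.
Qed.

End measurability_rV.

(** * Lebesgue measure under translations and dilations *)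

Section lebesgue_affine.
Context {R : realType}.
Local Open Scope ereal_scope.

Lemma pushforward_measure d1 d2 (T1 : measurableType d1) (T2 : measurableType d2)
    (m : {measure set T1 -> \bar R}) (h : T1 -> T2) :
  measurable_fun [set: T1] h ->
  {m' : {measure set T2 -> \bar R} | forall A, m' A = m (h @^-1` A)}.
Proof.
move=> mh.
by unshelve refine (exist _ (pushforward m h : {measure set T2 -> \bar R}) _).
Qed.

Lemma lebesgue_measure_affine (a s : R) (A : set R) : (0 < s)%R -> measurable A ->
  lebesgue_measure ((fun t => a + s * t)%R @^-1` A) =
  (s^-1)%:E * lebesgue_measure A.
Proof.
move=> s0 mA; pose h (t : measurableTypeR R) : measurableTypeR R := (a + s * t)%R.
have mh : measurable_fun [set: measurableTypeR R] h.
  by apply: measurable_funD => //; exact: measurable_funM.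
have [m' m'E] := pushforward_measure (@lebesgue_measure R) mh.
pose m := mscale (NngNum (ltW s0)) m'.
have mE X : m X = s%:E * lebesgue_measure (h @^-1` X) by rewrite /m /mscale/= m'E.
suff -> : lebesgue_measure A = s%:E * lebesgue_measure (h @^-1` A).
  by rewrite muleA -EFinM mulVf ?gt_eqF// mul1e.
apply: (etrans _ (mE A)); apply: lebesgue_measure_unique => //.
move=> _ [[u v]] _ <-; apply: (etrans _ (esym (mE _))).
rewrite (_ : h @^-1` _ = `](s^-1 * (u - a))%R, (s^-1 * (v - a))%R]%classic).
  rewrite !lebesgue_measure_itv/= !lte_fin ltr_pM2l ?invr_gt0// ltrD2r.
  case: ifP => _; last by rewrite mule0.
  by rewrite -!EFinD -EFinM; congr EFin; field; rewrite gt_eqF.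
apply/seteqP; split => t /=; rewrite !in_itv/= /h.
  by rewrite ltr_pdivrMl// ler_pdivlMl// ltrBlDl lerBrDl.
by rewrite ltr_pdivrMl// ler_pdivlMl// ltrBlDl lerBrDl.
Qed.

Lemma lebesgue_measure_symmetric_itv (u : R) : (0 <= u)%R ->
  lebesgue_measure (`[(- u)%R, u]%classic : set R) = (u + u)%:E.
Proof.
move=> u0; rewrite lebesgue_measure_itv/= lte_fin.
by case: ltP => h; [rewrite opprK|congr EFin; lra].
Qed.

Let box n : set (set 'rV[R]_n) :=
  [set B | exists A : 'I_n -> set R, (forall i, measurable (A i)) /\
           B = [set x : 'rV[R]_n | forall i, A i (x ord0 i)]].

Let box_measurable n : @box n `<=` measurable.
Proof.
move=> _ [A [mA ->]].
rewrite (_ : [set _ | _] = \bigcap_(i in [set: 'I_n])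
    ((fun x : 'rV[R]_n => x ord0 i) @^-1` A i)); last first.
  by apply/seteqP; split => x H i; [move=> _|]; exact: H.
apply: fin_bigcap_measurable; first exact: finite_finset.
by move=> i _; rewrite -[X in measurable X]setTI; exact: measurable_coord_rV.
Qed.

Let box_generates n : (measurable : set (set 'rV[R]_n)) = <<s (@box n) >>.
Proof.
apply/seteqP; split; last first.
  by apply: smallest_sub; [exact: sigma_algebra_measurable|exact: box_measurable].
apply: sub_smallest2r; first exact: smallest_sigma_algebra.
rewrite -bigcup_seq => B [i _] [C mC <-].
exists (fun j => if j == i then C else setT); split => [j|].
  by case: ifP.
rewrite setTI; apply/seteqP; split => x /=.
  by move=> Cx j; case: eqP => // ->.
by move=> /(_ i); rewrite eqxx.
Qed.

(** Both sides are measures in [A]. They agree on boxes by the one-dimensional case, and boxes are a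
    generating family stable under intersection and exhausted by cubes of finite measure. *)
Lemma lebesgue_rV_affine n (a : 'rV[R]_n) (s : R) (A : set 'rV[R]_n) :
  (0 < s)%R -> measurable A ->
  lebesgue_rV n ((fun x => a + s *: x)%R @^-1` A) =
  (s^-1 ^+ n)%:E * lebesgue_rV n A.
Proof.
move=> s0 mA; pose h (x : 'rV[R]_n) : 'rV[R]_n := (a + s *: x)%R.
have mh : measurable_fun [set: 'rV[R]_n] h.
  by apply: measurable_addrV => //; exact: measurable_scalerV.
have sn0 : (0 <= s^-1 ^+ n)%R by rewrite exprn_ge0// invr_ge0 ltW.
pose m := mscale (NngNum sn0) (lebesgue_rV n).
have [m' m'E] := pushforward_measure (lebesgue_rV n) mh.
suff : m' A = m A by rewrite m'E.
apply: (measure_unique (@box n) (fun k =>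
    [set x : 'rV[R]_n | forall i, `[(- k%:R)%R, k%:R]%classic (x ord0 i)])) => //.
- exact: box_generates.
- move=> _ _ [B [mB ->]] [C [mC ->]]; exists (fun i => B i `&` C i); split.
    by move=> i; exact: measurableI.
  apply/seteqP; split => x /=; first by move=> [H K] i; split.
  by move=> H; split => i; have [] := H i.
- by move=> k; exists (fun=> `[(- k%:R)%R, k%:R]%classic).
- apply/seteqP; split => // x _.
  exists (Num.bound (`|x|)) => // i /=; rewrite in_itv/= -ler_norml.
  rewrite (le_trans (coord_le_norm _ _))// ltW// archi_boundP//.
- move=> _ [B [mB ->]]; rewrite /m /mscale/= m'E.
  rewrite (_ : h @^-1` _ = [set x : 'rV[R]_n | forall i,
      ((fun t => a ord0 i + s * t)%R @^-1` B i) (x ord0 i)]); last first.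
    by apply/seteqP; split => x /= H i; have := H i; rewrite !mxE.
  apply: (etrans (@lebesgue_rV_box _ _
      (fun i => (fun t => a ord0 i + s * t)%R @^-1` B i) _)).
    move=> i; rewrite -[X in measurable X]setTI.
    have : measurable_fun setT (fun t : R => a ord0 i + s * t)%R.
      by apply: measurable_funD => //; exact: measurable_funM.
    by move=> /(_ measurableT _ (mB i)).
  rewrite (eq_bigr (fun i => (s^-1)%:E * lebesgue_measure (B i))) => [|i _].
    rewrite big_split/= prodEFin prodr_const card_ord.
    by rewrite -(@lebesgue_rV_box _ _ B mB).
  exact: lebesgue_measure_affine.
- move=> k; rewrite m'E.
  rewrite (_ : h @^-1` _ = [set x : 'rV[R]_n | forall i,
      ((fun t => a ord0 i + s * t)%R @^-1` `[(- k%:R)%R, k%:R]%classic) (x ord0 i)]); last first.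
    by apply/seteqP; split => x /= H i; have := H i; rewrite !mxE.
  rewrite (@le_lt_trans _ _ (\prod_(i < n) (s^-1 * (k%:R + k%:R))%:E))//.
    rewrite le_eqVlt; apply/orP; left; apply/eqP; apply: (etrans (@lebesgue_rV_box _ _ (fun i =>
        (fun t => a ord0 i + s * t)%R @^-1` `[(- k%:R)%R, k%:R]%classic) _)).
      move=> i; rewrite -[X in measurable X]setTI.
      have : measurable_fun setT (fun t : R => a ord0 i + s * t)%R.
        by apply: measurable_funD => //; exact: measurable_funM.
      by move=> /(_ measurableT _ (measurable_itv _)).
    apply: eq_bigr => i _; rewrite lebesgue_measure_affine//.
    by rewrite lebesgue_measure_symmetric_itv// -EFinM.
  by rewrite prodEFin ltry.
Qed.

Lemma lebesgue_rV_bounded n (M : R) (A : set 'rV[R]_n) : measurable A ->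
  (forall x, A x -> (enorm x <= M)%R) -> lebesgue_rV n A < +oo.
Proof.
move=> mA AM; pose B := [set x : 'rV[R]_n | forall i, `[(- M)%R, M]%classic (x ord0 i)].
apply: (@le_lt_trans _ _ (lebesgue_rV n B)).
  apply: le_measure; rewrite ?inE//; first by apply: box_measurable; exists (fun=> `[(- M)%R, M]%classic).
  move=> x Ax i /=; rewrite in_itv/= -ler_norml.
  by rewrite (le_trans (enorm_coord _ _))// AM.
rewrite (@lebesgue_rV_box _ _ (fun=> `[(- M)%R, M]%classic))//.
have [M0|M0] := leP 0%R M.
  under eq_bigr => i _ do rewrite lebesgue_measure_symmetric_itv//.
  by rewrite prodEFin ltry.
rewrite (eq_bigr (fun=> 0%R%:E)) => [|i _]; first by rewrite prodEFin ltry.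
by rewrite lebesgue_measure_itv/= lte_fin ltNge (_ : M <= - M)%R//; lra.
Qed.

End lebesgue_affine.

(** * Supports and densities *)

Section supports.
Context {R : realType} {d : nat}.
Local Notation E := 'rV[R]_d.
Implicit Types (P : probability E R).

Lemma closed_msupport P : closed (msupport P).
Proof.
move=> x cx U oU Ux.
have [y [Sy Uy]] := cx U (open_nbhs_nbhs (conj oU Ux)).
exact: Sy.
Qed.

Lemma measurable_msupport P : measurable (msupport P).
Proof. by apply: closed_measurable_rV; exact: closed_msupport. Qed.

(** The density formula integrates over the support only, so the complement has measure 0. *)
Lemma msupport_full alpha P : regular_density alpha P -> P (msupport P) = 1%E.
Proof.
move=> [rho [_ PE _ _]]; have mS := measurable_msupport P.
have : P (~` msupport P) = 0%E by rewrite PE ?setICl ?integral_set0//; exact: measurableC.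
rewrite probability_setC// => h; apply/eqP.
have := fin_num_measure P _ mS; case: (P (msupport P)) h => // r.
by rewrite -EFinB => -[h] _; rewrite eqe; apply/eqP; lra.
Qed.

Lemma density_bounds alpha P : regular_density alpha P ->
  exists a b : R, [/\ 0 < a, a <= b & forall A, measurable A ->
    A `<=` msupport P ->
    (a%:E * lebesgue_rV d A <= P A)%E /\ (P A <= b%:E * lebesgue_rV d A)%E].
Proof.
move=> rP; have PS := msupport_full rP.
move: rP => [rho [mrho PE _ [a [b [a0 ab]]]]].
have [x Sx] : exists x, msupport P x.
  apply/set0P; apply: contraPneq PS => ->; rewrite measure0 => /eqP.
  by rewrite eq_sym onee_eq0.
exists a, b; split => //; first by have /andP[h1 h2] := ab x Sx; exact: le_trans h2.
move=> A mA AS; rewrite PE// setIidl//.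
have mrA : measurable_fun A (EFin \o rho).
  by apply/measurable_EFinP; apply: measurable_funS mrho => //; exact: measurable_msupport.
have h0 y : A y -> 0 <= rho y.
  by move=> /AS /ab/andP[+ _]; apply: le_trans; exact: ltW.
split.
  rewrite -integral_cst//; apply: ge0_le_integral => //.
  - by move=> y _; rewrite lee_fin ltW.
  - by move=> y /AS/ab/andP[? _]; rewrite lee_fin.
rewrite -integral_cst//; apply: ge0_le_integral => //.
- by move=> y /AS/ab/andP[_ ?]; rewrite lee_fin.
Qed.

(* Every point of the support carries positive mass nearby; compactness makes
   this uniform. *)
Lemma uniform_ball_mass P (r : R) : compact (msupport P) -> 0 < r ->
  exists m : R, 0 < m /\ forall x, msupport P x -> (m%:E <= P (ball x r))%E.
Proof.
move=> cS r0.
have /compact_near_coveringP nc := cS.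
have := nc R (0 : R)^'+ (fun m x => (m%:E <= P (ball x r))%E) _.
case.
  move=> x Sx.
  have r20 : 0 < r / 2 by lra.
  have Pp : (0 < P (ball x (r / 2)))%E.
    by apply: Sx; [exact: ball_open|exact: ballxx].
  have Pfin : P (ball x (r / 2)) \is a fin_num.
    by apply: fin_num_measure; exact: measurable_ball_rV.
  exists (ball x (r / 2), [set m | m <= fine (P (ball x (r / 2)))]).
    split; first exact: nbhsx_ballx.
    by apply: nbhs_right_le; rewrite fine_gt0// Pp ltey_eq Pfin.
  move=> [y m] /= [xy mle]; apply: (@le_trans _ _ (P (ball x (r / 2)))).
    by rewrite -(fineK Pfin) lee_fin.
  apply: le_measure; rewrite ?inE; [exact: measurable_ball_rV..|].
  move=> z xz; rewrite [r]splitr; apply: ball_triangle xz; exact: ball_sym.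
move=> e /= e0 H; exists (e / 2); split; first lra.
move=> x Sx; apply: H => //=; last lra.
by rewrite sub0r normrN gtr0_norm//; lra.
Qed.

(** A Chebyshev bound: [h] dominates [L] times the indicator of the part of the ball inside the
    support, and this part carries all the mass of the ball. *)
Lemma ball_mass_le_int P (h : E -> R) (L s m : R) x :
  P (msupport P) = 1%E -> bmf h -> (forall y, 0 <= h y) -> 0 < s ->
  (m%:E <= P (ball x s))%E ->
  (forall y, msupport P y -> ball x s y -> L <= h y) -> 0 <= L ->
  m * L <= \int[P]_y h y.
Proof.
move=> PS bh h0 s0 mP hL L0; have mS := measurable_msupport P.
have mx := measurable_ball_rV x s.
have mb : measurable (ball x s `&` msupport P) by exact: measurableI.
have {}mP : (m%:E <= P (ball x s `&` msupport P))%E.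
  apply: (le_trans mP); rewrite (measureDI P mx mS).
  rewrite [X in (X + _ <= _)%E](_ : _ = 0%E) ?add0e//.
  apply/eqP; rewrite eq_le measure_ge0 andbT.
  have <- : P (~` msupport P) = 0%E by rewrite probability_setC// PS subee.
  apply: le_measure; rewrite ?inE; [exact: measurableD|exact: measurableC|].
  by move=> z [].
pose B := ball x s `&` msupport P.
have bi : bmf (fun y => L * \1_B y : R) by apply: bmfZ; exact: bmf_indic.
apply: (@le_trans _ _ (\int[P]_y (L * \1_B y))); last first.
  apply: le_int => // y; rewrite indicE; case: (boolP (y \in _)) => /=.
    by rewrite inE mulr1 => -[xy Sy]; exact: hL.
  by rewrite mulr0.
rewrite intZ; last exact: bmf_indic.
rewrite mulrC ler_wpM2l// /Rintegral integral_indic// setIT -lee_fin fineK//.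
exact: fin_num_measure.
Qed.

End supports.

(** * Lipschitz bounds from differentiability near a compact set *)

Section lipschitz_maps.
Context {R : realType}.

Lemma is_derive_path d m (G : 'rV[R]_d -> 'rV[R]_m) (x v : 'rV[R]_d) (t : R) i :
  differentiable G (x + t *: v) ->
  is_derive t 1 (fun s : R => G (x + s *: v) ord0 i : R^o)
    ((v *m 'J G (x + t *: v)) ord0 i).
Proof.
move=> dG; have cG : derivable G (x + t *: v) v by exact: diff_derivable.
have eG := deriveEjacobian v dG.
have H : (h^-1 *: ((fun s : R => G (x + s *: v) ord0 i : R^o) (h *: 1 + t) -
    G (x + t *: v) ord0 i : R^o)) @[h --> 0^'] -->
    ((v *m 'J G (x + t *: v)) ord0 i).
  rewrite -eG; have := cvg_comp _ _ cG (@coord_continuous R 1 m ord0 i _).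
  apply: cvg_trans; apply: near_eq_cvg; near=> h => /=.
  by rewrite !mxE /GRing.scale/= mulr1 [h *: v + _]addrC -addrA -scalerDl [t + h]addrC.
by split; [apply/cvg_ex; eexists; exact: H|exact: cvg_lim H].
Unshelve. all: by end_near. Qed.

Lemma segment_lipschitz d m (G : 'rV[R]_d -> 'rV[R]_m) (x y : 'rV[R]_d) (B : R) :
  (forall t : R, 0 <= t <= 1 -> differentiable G (x + t *: (y - x)) /\
     `|'J G (x + t *: (y - x))| <= B) ->
  `|G y - G x| <= d%:R * B * `|y - x|.
Proof.
move=> H; have B0 : 0 <= B by exact: le_trans (normr_ge0 _) (H 0 ltac:(lra)).2.
rewrite [leLHS]/Num.norm/= mx_normrE; apply: bigmax_le => [|[k i] _ /=].
  by rewrite !mulr_ge0.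
rewrite ord1 !mxE; set v := y - x.
pose h (s : R) : R := G (x + s *: v) ord0 i.
have dh (t : R) : 0 <= t <= 1 ->
    is_derive t 1 (h : R -> R^o) ((v *m 'J G (x + t *: v)) ord0 i).
  by move=> /H[dG _]; exact: is_derive_path.
have [||c c01 hE] := @MVT_segment R h
    (fun t => (v *m 'J G (x + t *: v)) ord0 i) 0 1 ler01.
- by move=> t; rewrite in_itv/= => /andP[t0 t1]; apply: dh; rewrite !ltW.
- apply: derivable_within_continuous => t; rewrite in_itv/= => t01.
  by have [] := dh t t01.
have -> : G y ord0 i - G x ord0 i = h 1 - h 0.
  by rewrite /h scale1r scale0r addr0 /v (addrC x) subrK.
rewrite hE subr0 mulr1 mxE; move: c01; rewrite in_itv/= => /H[_ JB].
apply: (@le_trans _ _ (\sum_(j < d) `|v| * B)).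
  apply: (le_trans (ler_norm_sum _ _ _)); apply: ler_sum => j _.
  rewrite normrM; apply: ler_pM => //; first exact: coord_le_norm.
  by rewrite (le_trans _ JB)// [leRHS]/Num.norm/= mx_normrE (le_bigmax _ _ (j, i)).
by rewrite sumr_const card_ord -[leLHS]mulr_natl (mulrC `|v|) mulrA.
Qed.

Lemma compact_in_open_radius d (A U : set 'rV[R]_d) : compact A -> open U ->
  A `<=` U -> exists r : R, 0 < r /\ forall x, A x -> ball x r `<=` U.
Proof.
move=> /compact_near_coveringP nc oU AU.
have := nc R (0 : R)^'+ (fun m x => ball x m `<=` U) _.
case.
  move=> x /AU Ux; have /nbhs_ballP[e /= e0 xeU] := open_nbhs_nbhs (conj oU Ux).
  have e20 : 0 < e / 2 by lra.
  exists (ball x (e / 2), [set m | m <= e / 2]).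
    by split; [exact: nbhsx_ballx|exact: nbhs_right_le].
  move=> [y m] /= [xy mle] z yz; apply: xeU; rewrite [e]splitr.
  by apply: ball_triangle xy _; exact: le_ball yz.
move=> e /= e0 H; exists (e / 2); split; first lra.
move=> x Ax; apply: H => //=; last lra.
by rewrite sub0r normrN gtr0_norm//; lra.
Qed.

(** Since [A] need not be convex, the mean value bound is used only for points closer than [r],
    whose segment stays in the open set [U]. For distant points boundedness of the image suffices:
    2N <= (2N/r) |x - y|. *)
Lemma C1_holder_lipschitz d m (alpha : R) (A : set 'rV[R]_d)
    (F : 'rV[R]_d -> 'rV[R]_m) : 0 < alpha -> compact A -> compact (F @` A) ->
  C1_holder_on alpha A F ->
  exists L : R, 0 < L /\
    forall x y, A x -> A y -> enorm (F x - F y) <= L * enorm (x - y).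
Proof.
move=> alpha0 cA cFA [U [G [oU AU FG dG [L0 JL]]]].
have [->|/set0P[x0 Ax0]] := eqVneq A set0; first by exists 1; split.
have [M [M0 AM]] := compact_enorm_bounded cA.
have [N [N0 FN]] := compact_enorm_bounded cFA.
have [r [r0 rU]] := compact_in_open_radius cA oU AU.
(* Hölder continuity of the Jacobian turns its value at [x0] into a bound at all points of [U] of
   norm at most [M], since these are within 2M of [x0]. *)
pose B := `|'J G x0| + `|L0| * (2 * M) `^ alpha.
have B0 : 0 <= B by rewrite addr_ge0// mulr_ge0 ?powR_ge0.
have LM0 : 0 <= d%:R * B * m%:R by rewrite !mulr_ge0.
have LN0 : 0 < 2 * N / r by rewrite divr_gt0// mulr_gt0.
exists (d%:R * B * m%:R + 2 * N / r); split; first lra.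
move=> x y Ax Ay; rewrite mulrDl.
have [xyr|xyr] := ltP `|x - y| r; last first.
  rewrite ler_wpDl ?mulr_ge0 ?enorm_ge0//.
  rewrite (@le_trans _ _ (2 * N))//.
    have h := enormD (F x) (- F y); rewrite enormN in h.
    have := FN (F x) (imageP _ Ax); have := FN (F y) (imageP _ Ay); lra.
  rewrite -mulrA ler_peMr ?mulr_ge0 ?(ltW N0)// mulrC ler_pdivlMr// mul1r.
  by rewrite (le_trans xyr)// norm_le_enorm.
apply: ler_wpDr; first by rewrite mulr_ge0 ?(ltW LN0) ?enorm_ge0.
rewrite !FG ?inE//; apply: (le_trans (enorm_le_norm _)).
rewrite [_ * m%:R]mulrC -mulrA ler_wpM2l//.
apply: (@le_trans _ _ (d%:R * B * `|x - y|)); last first.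
  by rewrite ler_wpM2l ?mulr_ge0// norm_le_enorm.
apply: segment_lipschitz => t /andP[t0 t1].
set z := y + t *: (x - y).
have Uz : U z.
  apply: (rU y Ay); rewrite -ball_normE /ball_/= /z opprD addrA subrr add0r normrN normrZ.
  by rewrite ger0_norm// (le_lt_trans _ xyr)// ler_piMl.
split; first exact: dG.
rewrite -[X in `|X|](subrK ('J G x0)) addrC (le_trans (ler_normD _ _))// lerD2l.
have zM : enorm z <= M.
  have -> : z = (1 - t) *: y + t *: x.
    by rewrite /z scalerBr scalerBl scale1r -addrA [- _ + _]addrC.
  apply: (le_trans (enormD _ _)); rewrite !enormZ !ger0_norm//; last lra.
  have := ler_wpM2l t0 (AM x Ax).
  have := @ler_wpM2l _ (1 - t) ltac:(lra) _ _ (AM y Ay); lra.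
apply: (le_trans (JL z x0 Uz (AU _ Ax0))).
apply: (@le_trans _ _ (`|L0| * enorm (z - x0) `^ alpha)).
  by rewrite ler_wpM2r ?powR_ge0// ler_norm.
rewrite ler_wpM2l//; apply: ge0_ler_powR; rewrite ?nnegrE ?enorm_ge0 ?(ltW alpha0)//.
  by rewrite mulr_ge0// ltW.
have h := enormD z (- x0); rewrite enormN in h.
have := AM x0 Ax0; lra.
Qed.

Lemma compactly_inside_radius d (K A : set 'rV[R]_d) : compactly_inside K A ->
  exists r : R, 0 < r /\ forall x z, K x -> enorm (z - x) <= r -> A z.
Proof.
move=> [K' [cK' KK' K'A]].
have [r [r0 rA]] := compact_in_open_radius cK' (@open_interior _ A) K'A.
exists (r / 2); split; first lra.
move=> x z Kx zx; apply: (@interior_subset _ A).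
apply: (rA x (KK' _ Kx)); rewrite -ball_normE /ball_/=.
by rewrite (le_lt_trans (norm_le_enorm _))// enormB; lra.
Qed.

End lipschitz_maps.

Section retraction.
Context {R : realType} {d : nat}.
Local Notation E := 'rV[R]_d.

(** Not a continuous retraction: all points outside [A] go to [a]. Composition with it extends a
    function from [A] while keeping measurability and bounds. *)
Definition retr (A : set E) (a x : E) : E := if x \in A then x else a.

Lemma retr_id A a x : A x -> retr A a x = x.
Proof. by move=> Ax; rewrite /retr mem_set. Qed.

Lemma retr_in (A : set E) a x : A a -> A (retr A a x).
Proof. by rewrite /retr; case: ifPn => //; rewrite inE. Qed.

Lemma retr_idem A a x : A a -> retr A a (retr A a x) = retr A a x.
Proof. by move=> Aa; rewrite retr_id//; exact: retr_in. Qed.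

Lemma measurable_retr A a : measurable A -> measurable_fun [set: E] (retr A a).
Proof.
move=> mA; apply: measurable_fun_ifT => //.
- apply: (measurable_fun_bool true); rewrite setTI.
  rewrite (_ : _ @^-1` _ = A)//; apply/seteqP; split => x /=.
    by move=> /set_mem.
  by move=> Ax; rewrite mem_set.
Qed.

Lemma bmf_retr A a (f : E -> R) : measurable A -> A a -> measurable_fun A f ->
  (exists M : R, forall x, A x -> `|f x| <= M) -> bmf (f \o retr A a).
Proof.
move=> mA Aa mf [M fM]; split.
  apply: (measurable_comp mA) => //; last exact: measurable_retr.
  by move=> _ [x _ <-]; exact: retr_in.
by exists M => x; apply: fM; exact: retr_in.
Qed.

End retraction.

(* Both arguments are first retracted to the supports, so that every function
   below is bounded and measurable on the whole space; locked because failing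
   unifications would otherwise unfold it down to the matrix entries. *)
HB.lock Definition tcost {R : realType} {d : nat} (A : set 'rV[R]_d)
    (a : 'rV[R]_d) (B : set 'rV[R]_d) (b : 'rV[R]_d)
    (z : 'rV[R]_d * 'rV[R]_d) : R :=
  cost (retr A a z.1) (retr B b z.2).

(** * Dual pairs *)

Section dual_pairs.
Context {R : realType} {d : nat}.
Local Notation E := 'rV[R]_d.

Lemma tcostE (A : set E) a B b x y :
  tcost A a B b (x, y) = cost (retr A a x) (retr B b y).
Proof. by rewrite unlock. Qed.

Lemma bmf_tcost (A : set E) a B b M : measurable A -> measurable B -> A a -> B b ->
  (forall x, A x -> enorm x <= M) -> (forall x, B x -> enorm x <= M) ->
  bmf (tcost A a B b).
Proof.
move=> mA mB Aa Bb AM BM; rewrite unlock; split.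
  apply: measurable_cost.
    exact: (measurableT_comp (measurable_retr _ mA) measurable_fst).
  exact: (measurableT_comp (measurable_retr _ mB) measurable_snd).
exists (2 * M ^+ 2) => z; apply: cost_le; first by apply: AM; exact: retr_in.
by apply: BM; exact: retr_in.
Qed.

(* Equality of the marginal constraints at two points forbids a uniform gap
   between the corresponding slacks: Lipschitz bounds, and concavity of the
   slack, are read off this. *)
Lemma marginal_mono (P : probability E R) (k eta : R) (h1 h2 : E -> R) :
  1 <= k -> bmf h1 -> bmf h2 -> (forall x, h1 x <= h2 x - eta) ->
  0 < \int[P]_x pos (h1 x) `^ k ->
  \int[P]_x pos (h2 x) `^ k <= \int[P]_x pos (h1 x) `^ k -> eta <= 0.
Proof.
move=> k1 b1 b2 h12; case: (leP eta 0) => // eta0.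
have k0 : 0 <= k by exact: le_trans k1.
have bp (h : E -> R) : bmf h -> bmf (fun x => pos (h x) `^ k).
  by move=> bh; apply: bmf_powR => //; [exact: bmf_pos|move=> x; exact: pos_ge0].
have [M hM] := b2.2.
pose N := Num.max M eta; have N0 : 0 < N by rewrite lt_max eta0 orbT.
(* As h2 <= N, lowering a positive value of [h2] by [eta] shrinks it at least by the factor s < 1.
   Since k >= 1 gives s^k <= s, the integral shrinks by [s] too, which contradicts the comparison of
   the integrals. *)
pose s := 1 - eta / N.
have s0 : 0 <= s by rewrite subr_ge0 ler_pdivrMr// mul1r le_max lexx orbT.
have s1 : s < 1 by rewrite ltrBlDr ltrDl divr_gt0.
have hs x : pos (h1 x) <= s * pos (h2 x).
  rewrite pos_le mulr_ge0 ?pos_ge0 ?andbT//.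
  have [h20|h20] := leP (h2 x) 0.
    by rewrite (le0_pos h20) mulr0; have := h12 x; lra.
  have h2N : h2 x <= N by rewrite (le_trans (ler_norm _))// (le_trans (hM x))// le_max lexx.
  rewrite (gt0_pos h20); apply: (le_trans (h12 x)); rewrite /s mulrBl mul1r lerD2l lerN2.
  by rewrite mulrAC ler_pdivrMr// ler_wpM2l// ltW.
have hk x : pos (h1 x) `^ k <= s * pos (h2 x) `^ k.
  apply: (@le_trans _ _ ((s * pos (h2 x)) `^ k)).
    by apply: ge0_ler_powR => //; rewrite nnegrE ?mulr_ge0 ?pos_ge0.
  rewrite powRM ?pos_ge0// ler_wpM2r ?powR_ge0//.
  have [->|sn0] := eqVneq s 0; first by rewrite powR0// gt_eqF// (lt_le_trans _ k1).
  by apply: ge1r_powR => //; rewrite lt_neqAle eq_sym sn0 s0 ltW.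
have := le_int P (bp _ b1) (bmfZ s (bp _ b2)) hk.
rewrite (intZ P s (bp _ b2)).
move: (\int[P]_x pos (h1 x) `^ k) (\int[P]_x pos (h2 x) `^ k) => u v uv u0 vu.
have := ler_wpM2l s0 vu; have := ltr_pM2r u0 s 1; rewrite s1 mul1r => su vs.
by have := le_lt_trans (le_trans uv vs) su; rewrite ltxx.
Qed.

Section one_sided.
Context (P : probability E R) (A B : set E) (a b : E) (M : R) (k c0 : R).
Hypotheses (mA : measurable A) (mB : measurable B) (Aa : A a) (Bb : B b).
Hypotheses (AM : forall x, A x -> enorm x <= M) (BM : forall x, B x -> enorm x <= M).
Hypotheses (k1 : 1 <= k) (c00 : 0 < c0).
Context (F G : E -> R).
Hypotheses (bF : bmf F) (bG : bmf G).
Let xi z := F z.1 + G z.2 - tcost A a B b z.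
Hypothesis eqG : forall y, \int[P]_x pos (xi (x, y)) `^ k = c0.

Let bxi y : bmf (fun x => xi (x, y)).
Proof.
apply: (bmf_pair2 y (f := xi)); apply: bmfB; last exact: bmf_tcost AM BM.
by apply: bmfD; [exact: bmf_fst|exact: bmf_snd].
Qed.

Let bpow (h : E -> R) : bmf h -> bmf (fun x => pos (h x) `^ k).
Proof.
move=> bh; apply: bmf_powR; [|exact: bmf_pos|by move=> x; exact: pos_ge0].
exact: le_trans k1.
Qed.

(** The cost is 2M-Lipschitz in its second argument. If [G] varied faster, one slack would exceed
    the other by a fixed amount for every first argument, although both satisfy the same marginal
    equation. *)
Lemma potential_lip y y' : B y -> B y' -> `|G y - G y'| <= 2 * M * enorm (y - y').
Proof.
suff H u v : B u -> B v -> G u - G v - 2 * M * enorm (u - v) <= 0.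
  move=> By By'; have h1 := H y y' By By'; have h2 := H y' y By' By.
  rewrite enormB in h2; rewrite ler_norml.
  by move: (2 * M * _) h1 h2 => w h1 h2; apply/andP; split; lra.
move=> Bu Bv; apply: (@marginal_mono P k _ (fun x => xi (x, v)) (fun x => xi (x, u))).
- exact: k1.
- exact: bxi.
- exact: bxi.
- move=> x; rewrite /xi/= !tcostE !(retr_id _ Bu) !(retr_id _ Bv).
  have := cost_lip (AM (retr_in x Aa)) (BM Bu) (BM Bv).
  rewrite ler_norml => /andP[_].
  by move: (2 * M * _) (cost _ _) (cost _ _) => w c1 c2; lra.
- by rewrite eqG.
- by rewrite (eqG u) (eqG v) lexx.
Qed.

(** The slack in y is a function of y alone plus the linear term of x against y, up to a constant,
    so the defect [eta] is the same for every first argument. A positive defect would put the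
    marginal integral at the intermediate point strictly below the average of those at the ends, by
    convexity of the power of the positive part. *)
Lemma slack_concave x y0 y1 t : A x -> B y0 -> B y1 -> 0 <= t <= 1 ->
  B ((1 - t) *: y0 + t *: y1) ->
  (1 - t) * xi (x, y0) + t * xi (x, y1) <= xi (x, (1 - t) *: y0 + t *: y1).
Proof.
move=> Ax B0 B1 t01 Bt; set yt := (1 - t) *: y0 + t *: y1.
pose eta := (1 - t) * xi (x, y0) + t * xi (x, y1) - xi (x, yt).
have shift x' : xi (x', yt) = (1 - t) * xi (x', y0) + t * xi (x', y1) - eta.
  rewrite /eta /xi/= !tcostE (retr_id _ Ax) !(retr_id _ B0) !(retr_id _ B1) !(retr_id _ Bt).
  by rewrite !costE /yt !(dotDr, dotZr); ring.
suff : eta <= 0 by rewrite /eta subr_le0.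
have bh : bmf (fun x' => (1 - t) * xi (x', y0) + t * xi (x', y1)).
  by apply: bmfD; exact: bmfZ.
apply: (@marginal_mono P k _ (fun x' => xi (x', yt))
    (fun x' => (1 - t) * xi (x', y0) + t * xi (x', y1))).
- exact: k1.
- exact: bxi.
- exact: bh.
- by move=> x'; rewrite shift.
- by rewrite eqG.
rewrite eqG; have -> : c0 = \int[P]_x ((1 - t) * pos (xi (x, y0)) `^ k +
    t * pos (xi (x, y1)) `^ k).
  rewrite (intD P (bmfZ (1 - t) (bpow (bxi y0))) (bmfZ t (bpow (bxi y1)))).
  by rewrite (intZ P _ (bpow (bxi y0))) (intZ P _ (bpow (bxi y1))) (eqG y0) (eqG y1); ring.
apply: le_int; [exact: bpow|by apply: bmfD; exact/bmfZ/bpow|].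
by move=> x'; exact: pos_convex.
Qed.

Lemma slack_lip x y y' : B y -> B y' ->
  xi (x, y) - 4 * M * enorm (y - y') <= xi (x, y').
Proof.
move=> By By'; have := potential_lip By By'.
have := cost_lip (AM (retr_in x Aa)) (BM By) (BM By').
rewrite /xi/= !tcostE !(retr_id _ By) !(retr_id _ By') !ler_norml.
have -> : 4 * M * enorm (y - y') = 2 * M * enorm (y - y') + 2 * M * enorm (y - y') by ring.
by move: (2 * M * _) (cost _ _) (cost _ _) => w c1 c2 /andP[? ?] /andP[? ?]; lra.
Qed.

End one_sided.

End dual_pairs.

(** One step of length [s] of a descent for |T x' - y|^2: [W] is this quantity, [D] the pairing of T
    x' - y with the displacement of the image, [v] the squared displacement. With th the factor
    multiplying [W] at the end, this [s] gives both th W <= D and v <= th W. *)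
Lemma descent_step (R : realFieldType) (c LS LT v D W : R) :
  let s := c / (LS ^+ 2 * LT ^+ 2) in
  0 < c -> 0 < LS -> 0 < LT -> 0 <= W -> c * v <= s * D ->
  s ^+ 2 * W <= LS ^+ 2 * v -> v <= LT ^+ 2 * (s ^+ 2 * W) ->
  W - 2 * D + v <= W - c ^+ 2 / (LS ^+ 4 * LT ^+ 2) * W.
Proof.
move=> s c0 LS0 LT0 W0 mono lS2 lT2; set th := _ / _.
have LS20 : 0 < LS ^+ 2 by rewrite exprn_gt0.
have LT20 : 0 < LT ^+ 2 by rewrite exprn_gt0.
have s0 : 0 < s by rewrite divr_gt0// mulr_gt0.
have sE : s * (LS ^+ 2 * LT ^+ 2) = c by rewrite mulfVK// gt_eqF// mulr_gt0.
have thE : th * LS ^+ 2 = c * s by rewrite /th /s; field; rewrite !gt_eqF.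
have thE' : th = LT ^+ 2 * s ^+ 2 by rewrite /th /s; field; rewrite !gt_eqF.
clearbody s th.
have h1 : c * (s * W) <= LS ^+ 2 * D.
  rewrite -(ler_pM2l s0); apply: (@le_trans _ _ (c * (LS ^+ 2 * v))).
    by have := ler_wpM2l (ltW c0) lS2; lra.
  by have := ler_wpM2l (ltW LS20) mono; lra.
have h2 : th * W <= D.
  rewrite -(ler_pM2l LS20) (_ : LS ^+ 2 * (th * W) = (th * LS ^+ 2) * W); last by ring.
  by rewrite thE -mulrA.
have h3 : v <= th * W by rewrite thE' -mulrA.
by lra.
Qed.

(** * Excess cost and distance to the transport map *)

Section approximate_potentials.
Context {R : realType} {d : nat}.
Local Notation E := 'rV[R]_d.
Context (P Q : probability E R) (a b : E) (M k : R).
Local Notation W0 := (msupport P).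
Local Notation W1 := (msupport Q).
Hypotheses (cW0 : compact W0) (cW1 : compact W1).
Hypotheses (PW0 : P W0 = 1%E) (QW1 : Q W1 = 1%E) (W0a : W0 a) (W1b : W1 b).
Hypotheses (M0 : 0 < M) (W0M : forall x, W0 x -> enorm x <= M)
  (W1M : forall y, W1 y -> enorm y <= M) (k1 : 1 <= k).
Local Notation r0 := (retr W0 a).
Local Notation r1 := (retr W1 b).
Local Notation tc := (tcost W0 a W1 b).

Definition slack (F G : E -> R) (z : E * E) : R := F z.1 + G z.2 - tc z.

(** The integral equations are imposed at all points of the space, consistently with those on the
    supports because [F] and [G] factor through the retractions. *)
Definition dual_pair (c0 : R) (F G : E -> R) : Prop :=
  [/\ bmf F /\ bmf G, (forall x, F (r0 x) = F x), (forall y, G (r1 y) = G y),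
    (forall x, \int[Q]_y pos (slack F G (x, y)) `^ k = c0) &
    (forall y, \int[P]_x pos (slack F G (x, y)) `^ k = c0)].

Let mW0 : measurable W0. Proof. exact: measurable_msupport. Qed.
Let mW1 : measurable W1. Proof. exact: measurable_msupport. Qed.

Lemma bmf_tc : bmf tc.
Proof. exact: (bmf_tcost mW0 mW1 W0a W1b W0M W1M). Qed.

Lemma bmf_slack F G : bmf F -> bmf G -> bmf (slack F G).
Proof.
move=> bF bG; apply: bmfB; last exact: bmf_tc.
by apply: bmfD; [exact: bmf_fst|exact: bmf_snd].
Qed.

Lemma slack_retr F G x y : (forall x, F (r0 x) = F x) ->
  (forall y, G (r1 y) = G y) -> slack F G (r0 x, r1 y) = slack F G (x, y).
Proof. by move=> FE GE; rewrite /slack/= !tcostE FE GE !retr_idem. Qed.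

Lemma slack_lip_snd c0 F G x y y' : 0 < c0 -> dual_pair c0 F G ->
  W1 y -> W1 y' ->
  slack F G (x, y) - 4 * M * enorm (y - y') <= slack F G (x, y').
Proof.
move=> c00 [[bF bG] _ _ _ eqG].
exact: (slack_lip (P := P) (F := F) (G := G) mW0 mW1 W0a W1b W0M W1M k1 c00 bF bG eqG).
Qed.

Lemma slack_lip_fst c0 F G x x' y : 0 < c0 -> dual_pair c0 F G ->
  W0 x -> W0 x' ->
  slack F G (x, y) - 4 * M * enorm (x - x') <= slack F G (x', y).
Proof.
move=> c00 [[bF bG] _ _ eqF _].
have sw u v : G v + F u - tcost W1 b W0 a (v, u) = slack F G (u, v).
  by rewrite /slack/= !tcostE costC addrC [G v + _]addrC [RHS]addrC.
have eqF' u : \int[Q]_v pos (G (v, u).1 + F (v, u).2 - tcost W1 b W0 a (v, u)) `^ k = c0.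
  by rewrite -(eqF u); apply: eq_Rintegral => v _; rewrite -sw.
have := slack_lip (P := Q) (F := G) (G := F) mW1 mW0 W1b W0a W1M W0M k1 c00 bG bF eqF' y.
by move=> H W0x W0x'; have := H x x' W0x W0x'; rewrite /= !sw.
Qed.

Lemma small_ball_dist (L eta : R) : 0 <= L -> 0 < eta ->
  exists r : R, 0 < r /\
    forall x y : E, ball x r y -> L * enorm (x - y) <= eta.
Proof.
move=> L0 eta0; exists (eta / (L * d%:R + 1)).
have h0 : 0 < L * d%:R + 1 by rewrite ltr_wpDl// mulr_ge0.
split; first by rewrite divr_gt0.
move=> x y; rewrite -ball_normE /ball_/= => xy.
apply: (le_trans (ler_wpM2l L0 (enorm_le_norm _))).
rewrite mulrA; apply: (@le_trans _ _ (L * d%:R * (eta / (L * d%:R + 1)))).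
  by rewrite ler_wpM2l ?mulr_ge0// ltW.
rewrite mulrA ler_pdivrMr// mulrC ler_wpM2l ?ltW//.
by rewrite ltrDl.
Qed.

(** A slack above [eta] stays above eta/2 on a ball of fixed radius, by the Lipschitz bound. The
    mass of this ball is at least [m], so the marginal integral would be at least m (eta/2)^k. *)
Lemma slack_small eta : 0 < eta -> exists c1 : R, 0 < c1 /\
  forall c0 F G, 0 < c0 < c1 -> dual_pair c0 F G ->
  forall x y, W0 x -> W1 y -> slack F G (x, y) <= eta.
Proof.
move=> eta0; have M40 : 0 <= 4 * M by rewrite mulr_ge0// ltW.
have e20 : 0 < eta / 2 by rewrite divr_gt0.
have [r [rr0 rE]] := small_ball_dist M40 e20.
have [m [m0 mE]] := uniform_ball_mass cW1 rr0.
exists (m * (eta / 2) `^ k); split; first by rewrite mulr_gt0// powR_gt0.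
move=> c0 F G /andP[c00 c01] dFG x y W0x W1y; rewrite leNgt; apply/negP => h.
have k0 : 0 <= k by exact: le_trans k1.
have [[bF bG] _ _ eqF _] := dFG.
have bp := bmf_pair1 x (bmf_slack bF bG).
have bh : bmf (fun y' => pos (slack F G (x, y')) `^ k).
  by apply: bmf_powR => //; [exact: bmf_pos|move=> ?; exact: pos_ge0].
have := @ball_mass_le_int R d Q _ ((eta / 2) `^ k) r m y QW1 bh
  (fun=> powR_ge0 _ _) rr0 (mE y W1y).
rewrite (eqF x) => H; suff hb y' : W1 y' -> ball y r y' ->
    (eta / 2) `^ k <= pos (slack F G (x, y')) `^ k.
  by have := lt_le_trans c01 (H hb (powR_ge0 _ _)); rewrite ltxx.
move=> W1y' yy'; apply: ge0_ler_powR => //; rewrite ?nnegrE ?pos_ge0 ?(ltW e20)//.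
apply: le_trans (pos_ge _); have h1 := slack_lip_snd x c00 dFG W1y W1y'.
by have h2 := rE _ _ yy'; lra.
Qed.

Context (T : E -> E) (LT : R).
Hypotheses (LT0 : 0 < LT) (TW : forall x, W0 x -> W1 (T x))
  (TL : forall x x', W0 x -> W0 x' -> enorm (T x - T x') <= LT * enorm (x - x'))
  (mT : measurable_fun W0 T).

Definition Tr (x : E) : E := T (r0 x).

Lemma measurable_Tr : measurable_fun [set: E] Tr.
Proof.
apply: (measurable_comp mW0) => //; last exact: measurable_retr.
by move=> _ [x _ <-]; exact: (retr_in _ W0a).
Qed.

Lemma Tr_in x : W1 (Tr x).
Proof. exact: (TW (retr_in _ W0a)). Qed.

Lemma bmf_graph (h : E * E -> R) : bmf h -> bmf (fun x => h (x, Tr x)).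
Proof.
apply: bmf_comp; apply: measurable_fun_pair => //; exact: measurable_Tr.
Qed.

(** A slack below -eta at one point of the graph stays below -eta/2 along the graph over a ball of
    mass at least [m]. As the slack is nowhere above eta' = m eta/4, its integral along the graph
    would be negative. *)
Lemma graph_slack eta : 0 < eta -> exists eta' : R, 0 < eta' /\
  forall c0 F G, 0 < c0 -> dual_pair c0 F G ->
  (forall x y, W0 x -> W1 y -> slack F G (x, y) <= eta') ->
  0 <= \int[P]_x slack F G (x, Tr x) ->
  forall x, W0 x -> - eta <= slack F G (x, T x).
Proof.
move=> eta0; have L0 : 0 <= 4 * M * (1 + LT).
  by rewrite mulr_ge0 ?addr_ge0 ?(ltW LT0)// mulr_ge0// ltW.
have e20 : 0 < eta / 2 by rewrite divr_gt0.
have [r [rr0 rE]] := small_ball_dist L0 e20.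
have [m [m0 mE]] := uniform_ball_mass cW0 rr0.
have e'0 : 0 < m * (eta / 2) / 2 by rewrite divr_gt0// mulr_gt0.
exists (m * (eta / 2) / 2); split=> //.
set eta' := m * _ / _ in e'0 *.
move=> c0 F G c00 dFG sle; case: (dFG) => -[bF bG] FE GE _ _.
have sleT x y : slack F G (x, y) <= eta'.
  by rewrite -slack_retr//; exact: (sle _ _ (retr_in _ W0a) (retr_in _ W1b)).
have bg := bmf_graph (bmf_slack bF bG).
pose h x := eta' - slack F G (x, Tr x).
have bh : bmf h by apply: bmfB => //; exact: bmf_cst.
have h0 x : 0 <= h x by rewrite subr_ge0.
have key x : W0 x -> slack F G (x, T x) < - eta ->
    m * (eta / 2) <= \int[P]_x h x.
  move=> W0x sx; apply: (ball_mass_le_int PW0 bh h0 rr0 (mE x W0x)); last exact: ltW.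
  move=> x' W0x' xx'.
  have h1 := slack_lip_fst (T x') c00 dFG W0x' W0x.
  have h2 := slack_lip_snd x c00 dFG (TW W0x') (TW W0x).
  have h3 : 4 * M * enorm (T x' - T x) <= 4 * M * (LT * enorm (x' - x)).
    by rewrite ler_wpM2l ?TL// mulr_ge0// ltW.
  have h4 := rE _ _ xx'; rewrite enormB in h4.
  rewrite /h /Tr retr_id//.
  have h5 := ltW e'0.
  move: h1 h2 h3 h4 h5 sx.
  move: (enorm _) (enorm _) (slack _ _ _) (slack _ _ _) (slack _ _ _) => u v s1 s2 s3.
  by lra.
move=> I0 x W0x; rewrite leNgt; apply/negP => sx.
have := key x W0x sx; rewrite /h intB//; last exact: bmf_cst.
rewrite int_cst => /le_trans/(_ (_ : _ <= eta')) H.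
have {}H := H ltac:(by rewrite gerBl).
by move: H; rewrite leNgt /eta' ltr_pdivrMr// ltr_pMr ?mulr_gt0// ltr1n.
Qed.

(** Kantorovich potentials up to [eta]: dual feasibility, and complementary slackness on the graph
    of [T]. *)
Definition quasi_potentials (eta : R) (F G : E -> R) : Prop :=
  (forall x y, W0 x -> W1 y -> slack F G (x, y) <= eta) /\
  (forall x, W0 x -> - eta <= slack F G (x, T x)).

(* Evaluate the slack at [(z, T z)] with [z = x - s (T x - y)]. *)
Lemma quasi_quadratic (K : set E) (r : R) : 0 < r ->
  (forall x z, K x -> enorm (z - x) <= r -> W0 z) ->
  exists c : R, 0 < c /\ forall eta F G, quasi_potentials eta F G ->
    forall x y, K x -> W1 y ->
    c * enorm (y - T x) ^+ 2 - 3 * eta <= - slack F G (x, y).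
Proof.
move=> rr0 KW.
(* The first bound keeps z within [r] of x, hence in the support; by the second, [T] moves by at
   most half of |T x - y| between x and z. *)
pose s := Num.min (r / (2 * M)) (1 / (2 * LT)).
have s0 : 0 < s by rewrite lt_min !divr_gt0// ?mulr_gt0.
have sr : s * (2 * M) <= r.
  by rewrite -ler_pdivlMr ?mulr_gt0// ge_min lexx.
have sL : s * LT <= 1 / 2.
  have : s <= 1 / (2 * LT) by rewrite ge_min lexx orbT.
  by rewrite ler_pdivlMr ?mulr_gt0//; lra.
exists (s / 2); split; first by rewrite divr_gt0.
move=> eta F G [sle sge] x y Kx W1y.
have W0x : W0 x by apply: (KW x) => //; rewrite subrr enorm0 ltW.
pose z := x - s *: (T x - y).
have TyM : enorm (T x - y) <= 2 * M.
  have h := enormD (T x) (- y); rewrite enormN in h.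
  by have h1 := W1M (TW W0x); have h2 := W1M W1y; lra.
have zx : enorm (x - z) = s * enorm (T x - y).
  by rewrite /z opprB addrCA subrr addr0 enormZ gtr0_norm.
have W0z : W0 z.
  apply: (KW x) => //; rewrite enormB zx (le_trans _ sr)//.
  by rewrite ler_wpM2l// ltW.
(* The potentials cancel here, and the three slacks other than the one at (x, y) account for the
   error 3 eta. *)
have cross : slack F G (z, y) + slack F G (x, T z) - slack F G (x, y) -
    slack F G (z, T z) = dot (x - z) (T z - y).
  rewrite /slack/= !tcostE !(retr_id _ W0x) !(retr_id _ W0z) (retr_id _ W1y).
  rewrite !(retr_id _ (TW W0z)) -cost_cross.
  by move: (F _) (F _) (G _) (G _) (cost _ _) (cost _ _) (cost _ _) (cost _ _) => *; ring.
have dotE : dot (x - z) (T z - y) =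
    s * (enorm (T x - y) ^+ 2 - dot (T x - y) (T x - T z)).
  have -> : x - z = s *: (T x - y) by rewrite /z opprB addrCA subrr addr0.
  have -> : T z - y = (T x - y) - (T x - T z).
    by apply/rowP => i; rewrite !mxE; ring.
  by rewrite dotZl dotDr dotNr -enorm_sqr.
have TzM : enorm (T x - T z) <= LT * (s * enorm (T x - y)) by rewrite -zx TL.
have cs := dot_le (T x - y) (T x - T z).
have h1 := sle z y W0z W1y; have h2 := sle x (T z) W0x (TW W0z).
have h3 := sge z W0z.
rewrite [enorm (y - _)]enormB.
have u0 := enorm_ge0 (T x - y); set u := enorm (T x - y) in TyM zx dotE TzM cs u0 *.
have h4 : u * enorm (T x - T z) <= u ^+ 2 / 2.
  apply: (le_trans (ler_wpM2l u0 TzM)).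
  rewrite (_ : u * (LT * (s * u)) = (s * LT) * u ^+ 2); last by ring.
  by rewrite [leRHS]mulrC; apply: ler_wpM2r; [exact: sqr_ge0|rewrite -div1r].
have h5 : s * (u ^+ 2 / 2) <= dot (x - z) (T z - y).
  by rewrite dotE ler_pM2l//; move: cs h4; lra.
move: cross h5 h1 h2 h3.
move: (dot _ _) (slack _ _ _) (slack _ _ _) (slack _ _ _) (slack _ _ _) (u ^+ 2).
by move=> A B C D' E' U; lra.
Qed.

Hypothesis Hq : forall eta : R, 0 < eta -> exists F G : E -> R,
  [/\ bmf F /\ bmf G, (forall x, F (r0 x) = F x), (forall y, G (r1 y) = G y)
    & quasi_potentials eta F G].

(** [quasi_quadratic] at (x, T z), with an error that can be sent to 0 because its constant does not
    depend on eta. The total error is 6 eta: three from that bound and one from each of the three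
    remaining slacks. *)
Lemma strongly_monotone (K : set E) (r : R) : 0 < r ->
  (forall x z, K x -> enorm (z - x) <= r -> W0 z) ->
  exists c : R, 0 < c /\ forall x z, K x -> W0 z ->
    c * enorm (T x - T z) ^+ 2 <= dot (x - z) (T x - T z).
Proof.
move=> rr0 KW; have [c [c0 cE]] := quasi_quadratic rr0 KW.
exists c; split=> // x z Kx W0z; apply/ler_addgt0Pr => e e0.
have e60 : 0 < e / 6 by rewrite divr_gt0.
have [F [G [_ _ _ qFG]]] := Hq e60.
have W0x : W0 x by apply: (KW x) => //; rewrite subrr enorm0 ltW.
have h1 := cE _ _ _ qFG x (T z) Kx (TW W0z).
have [sle sge] := qFG.
have h2 := sle z (T x) W0z (TW W0x); have h3 := sge x W0x; have h4 := sge z W0z.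
have cross : slack F G (x, T x) + slack F G (z, T z) - slack F G (x, T z) -
    slack F G (z, T x) = dot (x - z) (T x - T z).
  rewrite /slack/= !tcostE !(retr_id _ W0x) !(retr_id _ W0z).
  rewrite !(retr_id _ (TW W0z)) !(retr_id _ (TW W0x)) -cost_cross.
  by move: (F _) (F _) (G _) (G _) (cost _ _) (cost _ _) (cost _ _) (cost _ _) => *; ring.
rewrite enormB; move: cross h1 h2 h3 h4.
move: (dot _ _) (slack _ _ _) (slack _ _ _) (slack _ _ _) (slack _ _ _) (_ ^+ 2).
by move=> A B C D' E' U; lra.
Qed.

Context (LS : R).
Hypotheses (LS0 : 0 < LS)
  (SL : forall x x', W0 x -> W0 x' -> enorm (x - x') <= LS * enorm (T x - T x')).

(* The map is open around K: if y is close to T x but not attained, moving the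
   near-minimizer x' of |T x' - y| in the direction y - T x' improves it by a
   fixed factor, by strong monotonicity. *)
Lemma image_neighbourhood (K : set E) (r : R) : 0 < r ->
  (forall x z, K x -> enorm (z - x) <= r -> W0 z) ->
  exists delta : R, 0 < delta /\
    forall x y, K x -> enorm (y - T x) <= delta -> W1 y.
Proof.
(* Monotonicity is needed at the near-minimizers, which lie close to [K] but not in it; half of the
   margin [r] is spent on that. *)
move=> rr0 KW; pose K1 := [set z | exists x, K x /\ enorm (z - x) <= r / 2].
have r20 : 0 < r / 2 by rewrite divr_gt0.
have K1W x z : K1 x -> enorm (z - x) <= r / 2 -> W0 z.
  move=> [x' [Kx' xx']] zx; apply: (KW x') => //.
  by have := enorm_triangle z x x'; lra.
have [c [c0 cE]] := strongly_monotone r20 K1W.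
pose s := c / (LS ^+ 2 * LT ^+ 2).
pose th := c ^+ 2 / (LS ^+ 4 * LT ^+ 2).
have s0 : 0 < s by rewrite divr_gt0// mulr_gt0// exprn_gt0.
have th0 : 0 < th by rewrite divr_gt0 ?exprn_gt0// mulr_gt0// exprn_gt0.
(* Ensures 3 delta LS <= r/2, so that near-minimizers are in [K1], and 2 delta s <= r/2, so that a
   descent step stays in the support. *)
pose delta := r / (6 * LS + 4 * s).
have D0 : 0 < 6 * LS + 4 * s by rewrite addr_gt0// mulr_gt0.
have delta0 : 0 < delta by rewrite divr_gt0.
have deltaE : delta * (6 * LS + 4 * s) = r by rewrite mulfVK// gt_eqF.
have dLS : 0 <= delta * LS by rewrite mulr_ge0// ltW.
have ds : 0 <= delta * s by rewrite mulr_ge0// ltW.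
exists delta; split=> // x y Kx yx.
have W0x : W0 x by apply: (KW x) => //; rewrite subrr enorm0 ltW.
pose u x' := enorm (T x' - y) ^+ 2.
pose A := [set u x' | x' in W0].
have hA : has_inf A.
  by split; [exists (u x), x|exists 0 => _ [x' _ <-]; exact: sqr_ge0].
have infA x' : W0 x' -> inf A <= u x' by move=> Wx'; apply: (ge_inf hA.2); exists x'.
have step x' : W0 x' -> u x' < 4 * delta ^+ 2 ->
    exists z, W0 z /\ u z <= u x' - th * u x'.
  move=> W0x' ux'; set w := T x' - y.
  have w2 : enorm w < 2 * delta.
    have : enorm w ^+ 2 < (2 * delta) ^+ 2.
      by have -> : (2 * delta) ^+ 2 = 4 * delta ^+ 2 by ring.
    by rewrite ltr_sqr ?nnegrE ?enorm_ge0// mulr_ge0// ltW.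
  have x'x : enorm (x' - x) <= r / 2.
    apply: (le_trans (SL W0x' W0x)).
    have h : enorm (T x' - T x) <= 3 * delta.
      by have := enorm_triangle (T x') y (T x); rewrite -/w; lra.
    by have := ler_wpM2l (ltW LS0) h; lra.
  have K1x' : K1 x' by exists x.
  pose z := x' - s *: w.
  have zx' : enorm (z - x') = s * enorm w.
    by rewrite /z addrAC subrr add0r enormN enormZ gtr0_norm.
  have W0z : W0 z.
    by apply: (K1W x') => //; rewrite zx'; have := ler_wpM2l (ltW s0) (ltW w2); lra.
  exists z; split=> //.
  have mono := cE x' z K1x' W0z.
  have xz : x' - z = s *: w by rewrite /z opprB addrCA subrr addr0.
  rewrite xz dotZl in mono.
  have lS : s * enorm w <= LS * enorm (T x' - T z).
    by rewrite -zx' enormB SL.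
  have lT : enorm (T x' - T z) <= LT * (s * enorm w) by rewrite -zx' [enorm (z - _)]enormB TL.
  have uz : u z = enorm w ^+ 2 - 2 * dot w (T x' - T z) + enorm (T x' - T z) ^+ 2.
    rewrite /u (_ : T z - y = w - (T x' - T z)); last by rewrite /w; apply/rowP => i; rewrite !mxE; ring.
    exact: enorm_sqrB.
  have v0 := enorm_ge0 (T x' - T z); have w0 := enorm_ge0 w.
  have lS2 : (s * enorm w) ^+ 2 <= LS ^+ 2 * enorm (T x' - T z) ^+ 2.
    rewrite -exprMn; apply: lerXn2r => //; rewrite nnegrE.
      by apply: mulr_ge0 => //; exact: ltW.
    by apply: mulr_ge0 => //; first exact: ltW.
  have lT2 : enorm (T x' - T z) ^+ 2 <= LT ^+ 2 * (s * enorm w) ^+ 2.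
    rewrite -exprMn; apply: lerXn2r => //; rewrite nnegrE.
    by apply: mulr_ge0; [exact: ltW|apply: mulr_ge0 => //; exact: ltW].
  have sw : (s * enorm w) ^+ 2 = s ^+ 2 * enorm w ^+ 2 by exact: exprMn.
  rewrite sw in lS2 lT2; rewrite uz.
  exact: (descent_step c0 LS0 LT0 (sqr_ge0 (enorm w)) mono lS2 lT2).
have m0 : inf A = 0.
  apply/eqP; rewrite eq_le; apply/andP; split; last first.
    by apply: lb_le_inf hA.1 _ => _ [x' _ <-]; exact: sqr_ge0.
  rewrite leNgt; apply/negP => m0.
  (* With the first accuracy one descent step falls below a positive infimum; with the second the
     near-minimizer has |T x' - y| < 2 delta, since the infimum is at most delta^2. *)
  have e0 : 0 < Num.min (th * inf A) (3 * delta ^+ 2).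
    rewrite lt_min; apply/andP; split; first exact: mulr_gt0.
    by apply: mulr_gt0 => //; exact: exprn_gt0.
  have [_ [x' W0x' <-] ux'] := inf_adherent e0 hA.
  have mle : inf A <= delta ^+ 2.
    apply: (le_trans (infA x W0x)); rewrite /u enormB.
    by rewrite ler_sqr ?nnegrE ?enorm_ge0 ?(ltW delta0).
  have u1 : u x' < inf A + th * inf A.
    by apply: (lt_le_trans ux'); rewrite lerD2l ge_min lexx.
  have u2 : u x' < 4 * delta ^+ 2.
    apply: (lt_le_trans ux'); apply: (@le_trans _ _ (inf A + 3 * delta ^+ 2)).
      by rewrite lerD2l ge_min lexx orbT.
    by move: mle; lra.
  have [z [W0z uz]] := step x' W0x' u2.
  have h := infA z W0z; have h' := ler_wpM2l (ltW th0) (infA x' W0x').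
  move: h uz u1 h'.
  move: (th * inf A) (th * u x') (inf A) (u z) (u x') => e1 e2 e3 e4 e5.
  by lra.
(* The infimum being 0, [y] is a limit of points of the image of [T], and the support is closed. *)
apply: closed_msupport => B /nbhs_ballP[e /= e0 eB].
have e20 : 0 < e ^+ 2 by rewrite exprn_gt0.
have [_ [x' W0x' <-]] := inf_adherent e20 hA; rewrite m0 add0r => ux'.
exists (T x'); split; first exact: TW.
apply: eB; rewrite -ball_normE /ball_/=; apply: (le_lt_trans (norm_le_enorm _)).
by rewrite enormB -ltr_sqr ?nnegrE ?enorm_ge0 ?(ltW e0).
Qed.

Hypothesis pT : forall B, measurable B -> P (Tr @^-1` B) = Q B.

Definition map_dist2 (K : set E) (z : E * E) : R :=
  \1_K z.1 * enorm (r1 z.2 - Tr z.1) ^+ 2.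

Lemma bmf_map_dist2 K : measurable K -> bmf (map_dist2 K).
Proof.
move=> mK; apply: bmfM.
  exact: (bmf_fst _ (bmf_indic mK)).
split.
  apply: measurable_funX; apply: (measurableT_comp measurable_enorm).
  apply: measurable_addrV.
    exact: (measurableT_comp (measurable_retr _ mW1) measurable_snd).
  under eq_fun do rewrite -scaleN1r; apply: measurable_scalerV.
  exact: (measurableT_comp measurable_Tr measurable_fst).
exists ((2 * M) ^+ 2) => z; rewrite ger0_norm ?sqr_ge0//.
rewrite ler_sqr ?nnegrE ?enorm_ge0 ?mulr_ge0 ?(ltW M0)//.
have h := enormD (r1 z.2) (- Tr z.1); rewrite enormN in h.
have h1 := W1M (retr_in z.2 W1b); have h2 := W1M (@Tr_in z.1).
by move: h h1 h2; move: (enorm _) (enorm _) (enorm _) => *; lra.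
Qed.

(** Integrating [quasi_quadratic] against [rho] costs 3 eta. The potentials integrate to the same
    value against [rho] and along the graph of [T], where the slack is at least -eta; the total
    error 4 eta tends to 0 with [c] fixed. *)
Lemma gap_controls_distance (K : set E) (r : R) : 0 < r -> measurable K ->
  (forall x z, K x -> enorm (z - x) <= r -> W0 z) ->
  exists c : R, 0 < c /\ forall rho : E * E -> R, bmf rho ->
    (forall z, 0 <= rho z) ->
    (forall x, \int[Q]_y rho (x, y) = 1) -> (forall y, \int[P]_x rho (x, y) = 1) ->
    c * dint P Q (fun z => map_dist2 K z * rho z) <=
    dint P Q (fun z => tc z * rho z) - \int[P]_x tc (x, Tr x).
Proof.
move=> rr0 mK KW; have [c [c0 cE]] := quasi_quadratic rr0 KW.
exists c; split=> // rho brho rho0 rhoX rhoY; apply/ler_addgt0Pr => e e0.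
have e40 : 0 < e / 4 by rewrite divr_gt0.
have [F [G [[bF bG] FE GE qFG]]] := Hq e40.
set eta := e / 4 in e40 qFG.
have [sle sge] := qFG.
have pt z : c * map_dist2 K z <= 3 * eta - slack F G z.
  case: z => x y; rewrite -(slack_retr x y FE GE) /map_dist2/= indicE.
  case: (boolP (x \in K)) => [|_] /=.
    rewrite inE mul1r => Kx.
    have W0x : W0 x by apply: (KW x) => //; rewrite subrr enorm0 ltW.
    rewrite /Tr !(retr_id _ W0x).
    by have := cE _ _ _ qFG x _ Kx (retr_in y W1b); lra.
  rewrite mul0r mulr0.
  by have := sle _ _ (retr_in x W0a) (retr_in y W1b); have := e40; lra.
have bq := bmf_map_dist2 mK; have bs := bmf_slack bF bG.
have bqr := bmfM bq brho; have bsr := bmfM bs brho.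
have : dint P Q (fun z => c * (map_dist2 K z * rho z)) <=
    dint P Q (fun z => 3 * eta * rho z - slack F G z * rho z).
  apply: le_dint; [exact: bmfZ|exact: (bmfB (bmfZ _ brho) bsr)|].
  by move=> z; rewrite mulrA -mulrBl ler_wpM2r.
rewrite (dintZ P Q _ bqr) (dintB P Q (bmfZ _ brho) bsr).
have -> : dint P Q (fun z => 3 * eta * rho z) = 3 * eta.
  by have := dint_marginal_fst P (fun=> 3 * eta) brho rhoX; rewrite int_cst.
rewrite (dint_marginals bF bG bmf_tc brho); last 2 first.
- exact: (dint_marginal_fst P F brho rhoX).
- exact: (dint_marginal_snd Q bG brho rhoY).
have : - eta <= \int[P]_x slack F G (x, Tr x).
  rewrite -(int_cst P (- eta)); apply: le_int; [exact: bmf_cst|exact: (bmf_graph bs)|].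
  move=> x; have := sge _ (retr_in x W0a).
  rewrite (_ : slack F G (x, Tr x) = slack F G (r0 x, T (r0 x)))//.
  by rewrite /slack/= !tcostE FE retr_idem.
have -> : \int[P]_x slack F G (x, Tr x) =
    \int[P]_x F x + \int[Q]_y G y - \int[P]_x tc (x, Tr x).
  have bGT : bmf (fun x => G (Tr x)) by apply: bmf_comp bG; exact: measurable_Tr.
  rewrite (int_pushforward measurable_Tr pT bG) -intD// -intB//; first exact: bmfD.
  exact: (bmf_graph bmf_tc).
have -> : e = 4 * eta by rewrite /eta; field.
move: (\int[P]_x F x) (\int[Q]_y G y) (\int[P]_x tc (x, Tr x)) (dint _ _ _) (dint _ _ _).
by move=> iF iG iT d1 d2 h1 h2; lra.
Qed.

(** * Upper bound on the excess cost of the regularized plan *)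

Context (p : R).
Hypotheses (p12 : 1 < p <= 2) (kE : k = conj_exp p - 1).

Definition grid_coord (n : nat) (y : E) (i : 'I_d) : R :=
  (y ord0 i + M) * (n%:R / (2 * M)).

(** There are n + 1 indices per axis because a coordinate equal to [M] is sent to n itself. On the
    support the index is in range, so [inord] returns it unchanged. *)
Definition cell (n : nat) (y : E) : {ffun 'I_d -> 'I_n.+1} :=
  [ffun i => inord (Num.truncn (grid_coord n y i))].

Lemma grid_coord_itv n y i : W1 y -> 0 <= grid_coord n y i <= n%:R.
Proof.
move=> /W1M yM; have := le_trans (enorm_coord y i) yM; rewrite ler_norml => /andP[h1 h2].
have M20 : 0 < 2 * M by rewrite mulr_gt0.
apply/andP; split; first by rewrite mulr_ge0 ?divr_ge0 ?(ltW M20)//; have := M0; lra.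
rewrite /grid_coord mulrCA ler_piMr// ler_pdivrMr// mul1r.
by have := M0; lra.
Qed.

Lemma cell_trunc n y i : W1 y -> cell n y i = Num.truncn (grid_coord n y i) :> nat.
Proof.
move=> /(grid_coord_itv n i)/andP[t0 tn]; rewrite ffunE inordK// ltnS.
by rewrite -(ler_nat R) (le_trans _ tn)// truncn_le.
Qed.

Lemma cell_diam n y y' : (0 < n)%N -> W1 y -> W1 y' -> cell n y = cell n y' ->
  enorm (y - y') <= d%:R * (2 * M / n%:R).
Proof.
move=> n0 W1y W1y' yy'; apply: (le_trans (enorm_le_norm _)); rewrite ler_wpM2l//.
have nR0 : 0 < n%:R :> R by rewrite ltr0n.
rewrite [leLHS]/Num.norm/= mx_normrE; apply: bigmax_le => [|[j i] _].
  by rewrite divr_ge0 ?mulr_ge0// ltW.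
rewrite ord1 !mxE/= ler_pdivlMr//.
have /andP[t0 _] := grid_coord_itv n i W1y.
have /andP[t'0 _] := grid_coord_itv n i W1y'.
have /andP[h1 h2] := truncn_itv t0; have /andP[h1' h2'] := truncn_itv t'0.
have := cell_trunc n i W1y; have := cell_trunc n i W1y'; rewrite yy' => -> e.
rewrite -e in h1 h2.
have M20 : 0 < 2 * M by rewrite mulr_gt0.
have gE : (y ord0 i - y' ord0 i) * n%:R =
    (grid_coord n y i - grid_coord n y' i) * (2 * M).
  by rewrite /grid_coord; field; rewrite gt_eqF.
rewrite -[X in _ * X]ger0_norm ?(ltW nR0)// -normrM gE normrM [X in _ * X]ger0_norm ?(ltW M20)//.
rewrite ler_piMl ?(ltW M20)// ler_norml.
rewrite -[X in _ < X]natr1 in h2; rewrite -[X in _ < X]natr1 in h2'.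
by apply/andP; split; lra.
Qed.

Lemma measurable_cell n j : measurable ((fun x => cell n (Tr x)) @^-1` [set j]).
Proof.
rewrite (_ : _ @^-1` _ = \bigcap_(i in [set: 'I_d])
    ((fun x => grid_coord n (Tr x) i) @^-1` `[(j i)%:R, (j i).+1%:R[%classic)).
  apply: fin_bigcap_measurable; first exact: finite_finset.
  move=> i _; rewrite -[X in measurable X]setTI.
  have : measurable_fun setT (fun x => grid_coord n (Tr x) i).
    apply: measurable_funM => //; apply: measurable_funD => //.
    exact: (measurableT_comp (measurable_coord_rV i) measurable_Tr).
  by apply => //; exact: measurable_itv.
apply/seteqP; split => x /=.
  move=> <- i _; rewrite /= in_itv/= cell_trunc; last exact: Tr_in.
  by apply: truncn_itv; have /andP[] := grid_coord_itv n i (@Tr_in x).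
move=> H; apply/ffunP => i; apply: val_inj; rewrite /= cell_trunc; last exact: Tr_in.
have /andP[t0 _] := grid_coord_itv n i (@Tr_in x).
by have := H i Logic.I; rewrite /= in_itv/= => h; apply/eqP; rewrite truncn_eq.
Qed.

Definition rate (eps : R) : R := eps `^ (1 / (d%:R * (p - 1) + 2)).

Lemma rate_itv eps : 0 < eps <= 1 -> 0 < rate eps <= 1.
Proof.
move=> /andP[e0 e1]; rewrite powR_gt0//= -(powRr0 eps) /rate.
have := p12 => /andP[p1 _].
by apply: ger_powR; rewrite ?e0// divr_ge0// addr_ge0// mulr_ge0// subr_ge0 ltW.
Qed.

Lemma rate_pow eps : 0 < eps -> eps = rate eps `^ (d%:R * (p - 1) + 2).
Proof.
move=> e0; rewrite /rate -powRrM mul1r mulVf ?powRr1 ?(ltW e0)//.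
have := p12 => /andP[p1 _].
by rewrite gt_eqF// ltr_wpDl// mulr_ge0// subr_ge0 ltW.
Qed.

Definition reg_const (eps : R) : R := eps `^ k * conj_exp p `^ k.

Definition reg_density (eps : R) (F G : E -> R) (z : E * E) : R :=
  (reg_const eps)^-1 * pos (slack F G z) `^ k.

Lemma reg_const_gt0 eps : 0 < eps -> 0 < reg_const eps.
Proof.
move=> e0; have /andP[p1 _] := p12.
by rewrite mulr_gt0// powR_gt0// divr_gt0 ?subr_gt0// (lt_trans ltr01).
Qed.

Lemma reg_density_ge0 eps F G z : 0 < eps -> 0 <= reg_density eps F G z.
Proof. by move=> e0; rewrite mulr_ge0 ?powR_ge0// invr_ge0 ltW// reg_const_gt0. Qed.

Lemma bmf_pow_slack F G : bmf F -> bmf G -> bmf (fun z => pos (slack F G z) `^ k).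
Proof.
move=> bF bG; apply: bmf_powR; first exact: le_trans k1.
  exact/bmf_pos/bmf_slack.
by move=> z; exact: pos_ge0.
Qed.

Lemma bmf_reg_density eps F G : bmf F -> bmf G -> bmf (reg_density eps F G).
Proof. by move=> bF bG; apply: bmfZ; exact: bmf_pow_slack. Qed.

Lemma reg_density_fst eps F G : 0 < eps -> dual_pair (reg_const eps) F G ->
  forall x, \int[Q]_y reg_density eps F G (x, y) = 1.
Proof.
move=> e0 [[bF bG] _ _ eqF _] x.
rewrite /reg_density (intZ Q _ (bmf_pair1 x (bmf_pow_slack bF bG))) (eqF x).
by rewrite mulVf// gt_eqF// reg_const_gt0.
Qed.

Lemma reg_density_snd eps F G : 0 < eps -> dual_pair (reg_const eps) F G ->
  forall y, \int[P]_x reg_density eps F G (x, y) = 1.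
Proof.
move=> e0 [[bF bG] _ _ _ eqG] y.
rewrite /reg_density (intZ P _ (bmf_pair2 y (bmf_pow_slack bF bG))) (eqG y).
by rewrite mulVf// gt_eqF// reg_const_gt0.
Qed.

(** Second coordinates are pulled back by [T], so that everything lives on pairs of source points.
    The competitor mixes points whose images share a cell; its symmetrized excess cost is the
    pairing of x - y with T x - T y, at most LS |T x - T y|^2. *)
Lemma gap_block eps F G (n : nat) (N : R) : 0 < eps -> (0 < n)%N -> 0 < N ->
  n.+1%:R ^+ d <= N -> dual_pair (reg_const eps) F G ->
  dint P Q (fun z => tc z * reg_density eps F G z) - \int[P]_x tc (x, Tr x) <=
  LS * (d%:R * (2 * M / n%:R)) ^+ 2 / 2 + eps / (p - 1) * (2 * N `^ (p - 1)).
Proof.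
move=> e0 n0 N0 nN dFG; have [[bF bG] FE GE eqF eqG] := dFG.
have /andP[p1 p2] := p12.
pose J := {ffun 'I_d -> 'I_n.+1}.
pose kk x : J := cell n (Tr x).
have mk (j : J) : measurable (kk @^-1` [set j]) by exact: measurable_cell.
pose C (z : E * E) := tc (z.1, Tr z.2).
have mTr2 : measurable_fun [set: E * E] (fun z => (z.1, Tr z.2)).
  apply: measurable_fun_pair => //.
  exact: (measurableT_comp measurable_Tr measurable_snd).
have bC : bmf C by apply: (bmf_comp (f := tc) mTr2); exact: bmf_tc.
have bGT : bmf (fun x => G (Tr x)) by apply: bmf_comp bG; exact: measurable_Tr.
have pull (h : E * E -> R) : bmf h ->
    dint P P (fun z => h (z.1, Tr z.2)) = dint P Q h.
  move=> bh; apply: eq_Rintegral => x _ /=.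
  by rewrite -(int_pushforward measurable_Tr pT (bmf_pair1 x bh)).
have brho := bmf_reg_density eps bF bG.
have := @regularized_gap R p eps p1 e0 _ _ _ _ P P F (fun x => G (Tr x)) C
  (block_coupling P kk) bF bGT bC (bmf_block_coupling P mk).
rewrite -kE -/(reg_const eps) => H.
have {}H := H _ _ (block_coupling_ge0 P kk) (block_coupling_fst P mk bF)
  (block_coupling_snd P mk bGT).
have e1 : (fun z => (reg_const eps)^-1 * pos (F z.1 + G (Tr z.2) - C z) `^ k) =
    (fun z => reg_density eps F G (z.1, Tr z.2)) by [].
rewrite lerBlDl; apply: (@le_trans _ _ (dint P P (fun z => C z *
    ((reg_const eps)^-1 * pos (F z.1 + G (Tr z.2) - C z) `^ k)))).
  rewrite -(pull (fun z => tc z * reg_density eps F G z)) //.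
  exact: bmfM bmf_tc brho.
apply: (le_trans (H _ _)).
- move=> x; rewrite -(int_pushforward measurable_Tr pT (bmf_pair1 x brho)).
  exact: reg_density_fst.
- by move=> y; rewrite -(reg_density_snd e0 dFG (Tr y)).
rewrite addrA lerD//.
  apply: (block_coupling_cost P mk bC) => x y kxy.
  have := cell_diam n0 (@Tr_in x) (@Tr_in y) kxy.
  set D := d%:R * _ => TD.
  rewrite -lerBlDl /C/= !tcostE.
  rewrite !(retr_id _ (@Tr_in _)).
  have -> : cost (r0 x) (Tr y) + cost (r0 y) (Tr x) -
      (cost (r0 x) (Tr x) + cost (r0 y) (Tr y)) = dot (r0 x - r0 y) (Tr x - Tr y).
    rewrite -cost_cross.
    by move: (cost _ _) (cost _ _) (cost _ _) (cost _ _) => *; ring.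
  apply: (le_trans (dot_le _ _)).
  have h1 := SL (retr_in x W0a) (retr_in y W0a).
  apply: (le_trans (ler_wpM2r (enorm_ge0 _) h1)).
  rewrite -mulrA ler_wpM2l ?(ltW LS0)// -expr2.
  by apply: lerXn2r => //; rewrite nnegrE ?enorm_ge0// (le_trans _ TD)// enorm_ge0.
apply: ler_wpM2l; first by rewrite divr_ge0 ?subr_ge0 ?(ltW e0)// ltW.
apply: (block_coupling_pow P mk) => //.
by rewrite card_ffun !card_ord natrX.
Qed.

(* Blocks of side [rate eps] balance the two error terms of [gap_block]. *)
Lemma gap_upper : exists C : R, 0 < C /\ forall eps F G, 0 < eps <= 1 ->
  dual_pair (reg_const eps) F G ->
  dint P Q (fun z => tc z * reg_density eps F G z) - \int[P]_x tc (x, Tr x) <=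
  C * rate eps ^+ 2.
Proof.
have /andP[p1 p2] := p12; have p10 : 0 < p - 1 by rewrite subr_gt0.
pose C1 := LS * (d%:R * (2 * M)) ^+ 2 / 2.
pose C2 := 2 / (p - 1) * 3 `^ (d%:R * (p - 1)).
have C10 : 0 <= C1 by rewrite divr_ge0 ?mulr_ge0 ?sqr_ge0// ltW.
have C20 : 0 < C2 by rewrite mulr_gt0 ?divr_gt0// powR_gt0.
exists (C1 + C2); split; first by rewrite ltr_wpDl.
move=> eps F G e01 dFG; have /andP[e0 e1] := e01.
have /andP[r00 r01] := rate_itv e01; set delta := rate eps in r00 r01 *.
(* This gives 1/n <= delta and, as delta <= 1, also n + 1 <= 1/delta + 2 <= 3/delta. *)
pose n := (Num.truncn delta^-1).+1.
have ri0 : 0 <= delta^-1 by rewrite invr_ge0 ltW.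
have /andP[n1 n2] := truncn_itv ri0.
have n0 : 0 < n%:R :> R by rewrite ltr0n.
have ri1 : 1 <= delta^-1 by rewrite invf_ge1.
have N0 : 0 < (3 / delta) ^+ d by rewrite exprn_gt0// divr_gt0.
have nN : n.+1%:R ^+ d <= (3 / delta) ^+ d.
  apply: lerXn2r; rewrite ?nnegrE// ?divr_ge0 ?(ltW r00)//.
  by rewrite /n -natr1 -natr1; lra.
apply: (le_trans (gap_block e0 _ N0 nN dFG)) => //.
rewrite [leRHS]mulrDl; apply: lerD.
  rewrite /C1 [leRHS]mulrAC ler_pM2r ?invr_gt0//.
  have nd : n%:R^-1 <= delta by rewrite -[leRHS]invrK lef_pV2 ?posrE ?invr_gt0// ltW.
  rewrite -[leRHS]mulrA ler_wpM2l ?(ltW LS0)// -exprMn.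
  apply: lerXn2r; rewrite ?nnegrE ?mulr_ge0 ?invr_ge0 ?(ltW M0) ?(ltW n0) ?(ltW r00)//.
  rewrite -[leRHS]mulrA; apply: ler_wpM2l => //; apply: ler_wpM2l => //.
  by rewrite mulr_ge0// ltW.
rewrite /C2 [leLHS](_ : _ = 2 / (p - 1) * (eps * ((3 / delta) ^+ d) `^ (p - 1))); last first.
  by move: (_ `^ _) => X; field; rewrite gt_eqF.
rewrite -[leRHS]mulrA ler_wpM2l ?divr_ge0 ?(ltW p10)//.
have -> : ((3 / delta) ^+ d) `^ (p - 1) = 3 `^ (d%:R * (p - 1)) * (delta `^ (d%:R * (p - 1)))^-1.
  rewrite -powR_mulrn ?divr_ge0 ?(ltW r00)// -powRrM powRM ?invr_ge0 ?(ltW r00)//.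
  by rewrite -powR_inv1 ?(ltW r00)// -powRrM mulN1r powRN.
(* The exponent of the rate is made for this: eps delta^(-d(p-1)) = delta^2, the order of the
   transport term. *)
have -> : eps = delta `^ (d%:R * (p - 1)) * delta ^+ 2.
  rewrite {1}(rate_pow e0) -/delta powRD; last by rewrite (gt_eqF r00) implybT.
  by rewrite powR_mulrn// ltW.
rewrite le_eqVlt; apply/orP; left; apply/eqP.
have : delta `^ (d%:R * (p - 1)) != 0 by rewrite gt_eqF// powR_gt0.
by move: (delta `^ _) (3 `^ _) => X Y X0; field.
Qed.

End approximate_potentials.

(** * Radius of the sections *)

Section measure_comparison.
Context {R : realType}.

(** The comparison of measures is known inside [D] only; for the restrictions to [D] it holds on all
    measurable sets. *)
Lemma ge0_le_measure_integral_on d (X : measurableType d)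
    (m1 m2 : {measure set X -> \bar R}) (D : set X) (C : R) (f : X -> \bar R) :
  measurable D -> 0 <= C ->
  (forall A, measurable A -> A `<=` D -> m1 A <= C%:E * m2 A)%E ->
  (forall x, 0 <= f x)%E -> measurable_fun [set: X] f ->
  (\int[m1]_(x in D) f x <= C%:E * \int[m2]_(x in D) f x)%E.
Proof.
move=> mD C0 m12 f0 mf.
rewrite (eq_measure_integral (mrestr m1 mD)); last first.
  by move=> A mA AD; rewrite /= /mrestr setIidl.
rewrite [X in (_ <= _ * X)%E](eq_measure_integral (mrestr m2 mD)); last first.
  by move=> A mA AD; rewrite /= /mrestr setIidl.
rewrite -(ge0_integral_mscale _ mD (NngNum C0))//; last exact: measurable_funTS.
apply: ge0_le_measure_integral => // A mA; rewrite /= /mscale /= /mrestr.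
by apply: m12; [exact: measurableI|exact: subIsetr].
Qed.

End measure_comparison.

Lemma eq_int_full {R : realType} d (X : measurableType d) (Q : probability X R)
    (D : set X) (f g : X -> R) : Q D = 1%E -> measurable D -> bmf f -> bmf g ->
  (forall z, D z -> f z = g z) -> \int[Q]_z f z = \int[Q]_z g z.
Proof.
move=> QD mD bf bg fg; rewrite /Rintegral; congr fine.
apply: ae_eq_integral; first exact: measurableT.
- by apply/measurable_EFinP; exact: bf.1.
- by apply/measurable_EFinP; exact: bg.1.
have QD0 : Q (~` D) = 0%E by rewrite probability_setC// QD subee.
exists (~` D); split => //; first exact: measurableC.
by move=> z /=; apply: contra_not => Dz _; rewrite fg.
Qed.

Section affine_images.
Context {R : realType} {d : nat}.
Local Notation E := 'rV[R]_d.
Context (Q : probability E R) (al be : R).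
Local Notation W1 := (msupport Q).
Hypotheses (QW1 : Q W1 = 1%E) (al0 : 0 < al) (be0 : 0 <= be).
Hypothesis Qd : forall A, measurable A -> A `<=` W1 ->
  (al%:E * lebesgue_rV d A <= Q A)%E /\ (Q A <= be%:E * lebesgue_rV d A)%E.

Let mW1 : measurable W1. Proof. exact: measurable_msupport. Qed.

Lemma msupport_setI A : measurable A -> Q (W1 `&` A) = Q A.
Proof.
move=> mA; rewrite [RHS](measureDI Q mA mW1) setIC.
rewrite [X in _ = (X + _)%E](_ : _ = 0%E) ?add0e//.
apply/eqP; rewrite eq_le measure_ge0 andbT.
have <- : Q (~` W1) = 0%E by rewrite probability_setC// QW1 subee.
apply: le_measure; rewrite ?inE; [exact: measurableD|exact: measurableC|].
by move=> z [].
Qed.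

Lemma measurable_affine_rV (a : E) (s : R) :
  measurable_fun [set: E] (fun z => a + s *: z).
Proof.
by apply: measurable_addrV => //; exact: measurable_scalerV.
Qed.

(** The preimage has s^(-d) times the volume of [A], and the density lies between [al] and [be]. The
    preimage may leave the support, but only its part inside has mass. *)
Lemma affine_preimage_mass (a : E) (s : R) A : 0 < s -> measurable A -> A `<=` W1 ->
  (Q ((fun z : E => a + s *: z)%R @^-1` A) <= (be * s^-1 ^+ d / al)%:E * Q A)%E.
Proof.
move=> s0 mA AW.
have mwA : measurable ((fun z : E => a + s *: z) @^-1` A).
  by rewrite -[X in measurable X]setTI; exact: measurable_affine_rV.
rewrite -msupport_setI//.
have [_ h1] := Qd (measurableI _ _ mW1 mwA) (@subIsetl _ _ _).
apply: (le_trans h1).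
apply: (@le_trans _ _ (be%:E * ((s^-1 ^+ d)%:E * lebesgue_rV d A))%E).
  apply: lee_wpmul2l; first by rewrite lee_fin.
  rewrite -(lebesgue_rV_affine a s0 mA).
  by apply: le_measure; rewrite ?inE; [exact: measurableI| |exact: subIsetr].
have [h2 _] := Qd mA AW.
rewrite muleA -EFinM [(_ / al)%:E]EFinM -muleA; apply: lee_wpmul2l.
  by rewrite lee_fin mulr_ge0// exprn_ge0// invr_ge0 ltW.
apply: (@le_trans _ _ (al^-1%:E * (al%:E * lebesgue_rV d A))%E).
  by rewrite muleA -EFinM mulVf ?mul1e// gt_eqF.
by apply: lee_wpmul2l => //; rewrite lee_fin invr_ge0 ltW.
Qed.

(** The pushforward of [Q] is compared with [Q] only inside the support, whence the requirement that
    [h] vanish elsewhere. *)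
Lemma affine_image_integral (a : E) (s : R) (h : E -> R) : 0 < s -> bmf h ->
  (forall z, 0 <= h z) -> (forall z, ~ W1 z -> h z = 0) ->
  \int[Q]_z h (a + s *: z) <= be * s^-1 ^+ d / al * \int[Q]_z h z.
Proof.
move=> s0 bh h0 hW.
have mw := measurable_affine_rV a s.
have bhw : bmf (fun z : E => h (a + s *: z)) by exact: bmf_comp mw bh.
have C0 : 0 <= be * s^-1 ^+ d / al.
  by rewrite divr_ge0 ?(ltW al0)// mulr_ge0// exprn_ge0// invr_ge0 ltW.
rewrite -lee_fin EFinM !int_EFin//.
have off (g : E -> E) : (\int[Q]_z (h (g z))%:E =
    \int[Q]_(z in g @^-1` W1) (h (g z))%:E)%E.
  rewrite [RHS]integral_mkcond; apply: eq_integral => z _; rewrite patchE.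
  by case: ifPn => //; rewrite notin_setE => nW; rewrite hW.
rewrite (off (fun z => a + s *: z)) (off id) preimage_id.
rewrite -(ge0_integral_pushforward mw Q (f := EFin \o h)) //; first last.
  - by move=> z _; rewrite lee_fin.
  - by apply: measurable_funTS; apply/measurable_EFinP; exact: bh.1.
apply: ge0_le_measure_integral_on => //.
- by move=> A mA AW; exact: affine_preimage_mass.
- by apply/measurable_EFinP; exact: bh.1.
Qed.

End affine_images.

Lemma half_convex_le (R : realFieldType) (a b c p : R) :
  (1 - 2^-1) * a + 2^-1 * b <= c -> c <= p -> 0 < a -> b <= 2 * p.
Proof. by move=> h1 h2 h3; lra. Qed.

Lemma midpoint_bound (R : realFieldType) (C1 C2 I1 I2 I3 D : R) :
  0 <= C1 -> 0 <= C2 -> I2 <= I3 -> I1 <= C1 * I2 -> D <= C2 * I1 + 2 * I3 ->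
  D <= (C2 * C1 + 2) * I3.
Proof.
move=> C10 C20 hN h1 h2; apply: (le_trans h2).
rewrite [leRHS]mulrDl lerD2r -mulrA ler_wpM2l//.
by apply: (le_trans h1); rewrite ler_wpM2l.
Qed.

Section section_distance.
Context {R : realType} {d : nat}.
Local Notation E := 'rV[R]_d.
Context (P Q : probability E R) (a b : E) (M k : R).
Local Notation W0 := (msupport P).
Local Notation W1 := (msupport Q).
Hypotheses (QW1 : Q W1 = 1%E) (W0a : W0 a) (W1b : W1 b).
Hypotheses (W0M : forall x, W0 x -> enorm x <= M)
  (W1M : forall y, W1 y -> enorm y <= M) (k1 : 1 <= k).
Local Notation r1 := (retr W1 b).
Context (al be : R).
Hypotheses (al0 : 0 < al) (be0 : 0 <= be).
Hypothesis Qd : forall A, measurable A -> A `<=` W1 ->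
  (al%:E * lebesgue_rV d A <= Q A)%E /\ (Q A <= be%:E * lebesgue_rV d A)%E.
Context (c0 : R) (F G : E -> R).
Hypotheses (c00 : 0 < c0) (dFG : dual_pair P Q a b k c0 F G).
Local Notation xi := (slack P Q a b F G).

Let mW0 : measurable W0. Proof. exact: measurable_msupport. Qed.
Let mW1 : measurable W1. Proof. exact: measurable_msupport. Qed.

Lemma slack_concave_snd x y0 y1 t : W0 x -> W1 y0 -> W1 y1 -> 0 <= t <= 1 ->
  W1 ((1 - t) *: y0 + t *: y1) ->
  (1 - t) * xi (x, y0) + t * xi (x, y1) <= xi (x, (1 - t) *: y0 + t *: y1).
Proof.
have [[bF bG] _ _ _ eqG] := dFG.
exact: (slack_concave mW0 mW1 W0a W1b W0M W1M k1 c00 bF bG eqG).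
Qed.

Lemma bmf_section_slack x : bmf (fun z => xi (x, z)).
Proof.
have [[bF bG] _ _ _ _] := dFG.
exact: (bmf_pair1 x (bmf_slack W0a W1b W0M W1M bF bG)).
Qed.

Let rho x z := c0^-1 * pos (xi (x, z)) `^ k.

Let k0 : 0 <= k. Proof. exact: le_trans k1. Qed.

Let brho x : bmf (rho x).
Proof.
apply: bmfZ; apply: bmf_powR => //; first exact/bmf_pos/bmf_section_slack.
by move=> z; exact: pos_ge0.
Qed.

Let rho_ge0 x z : 0 <= rho x z.
Proof. by rewrite mulr_ge0 ?powR_ge0// invr_ge0 ltW. Qed.

Lemma bmf_dist2 (t : E) : bmf (fun z => enorm (r1 z - t) ^+ 2).
Proof.
split.
  apply: measurable_funX; apply: (measurableT_comp measurable_enorm).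
  apply: measurable_addrV => //.
  exact: (measurable_retr _ mW1).
exists ((M + enorm t) ^+ 2) => z; rewrite ger0_norm ?sqr_ge0//.
have h := enormD (r1 z) (- t); rewrite enormN in h.
have h1 := W1M (retr_in z W1b).
have M0 : 0 <= M by exact: le_trans (enorm_ge0 _) h1.
rewrite ler_sqr ?nnegrE ?enorm_ge0 ?addr_ge0 ?enorm_ge0//.
by move: h h1; move: (enorm _) (enorm _) (enorm _) => *; lra.
Qed.

(** The 8 and the last 2 come from |y - t|^2 <= 8 |w - t|^2 + 2 |z - t|^2 for the midpoint w of y
    and z, 2^k from the ratio of the densities at z and w, and the bracket from the change of
    variables z -> w. *)
Definition section_const : R := 8 * 2 `^ k * (be * 2 ^+ d / al) + 2.

Lemma section_const_ge0 : 0 <= section_const.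
Proof.
rewrite addr_ge0// mulr_ge0 ?mulr_ge0 ?powR_ge0//.
by rewrite invr_ge0 ltW.
Qed.

(* By concavity of the slack, the density at the midpoint of y and z is at
   least 2^(-k) times the density at z; so half of the mass of the section of x
   is, up to a constant, carried by midpoints, which are at distance comparable
   to |y - t| from t whenever z is not. *)
Lemma section_distance x y (t : E) : W0 x -> W1 y -> 0 < xi (x, y) ->
  (forall z, W1 z -> 0 < xi (x, z) -> W1 (2^-1 *: y + 2^-1 *: z)) ->
  enorm (y - t) ^+ 2 <=
  section_const * \int[Q]_z (enorm (r1 z - t) ^+ 2 * rho x z).
Proof.
move=> W0x W1y xy mid.
have i20 : 0 < 2^-1 :> R by rewrite invr_gt0.
have C10 : 0 <= be * 2 ^+ d / al by rewrite divr_ge0 ?mulr_ge0// ltW.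
have C20 : 0 <= 8 * 2 `^ k by rewrite mulr_ge0 ?powR_ge0.
have [[bF bG] FE GE eqF _] := dFG.
pose N z := enorm (r1 z - t) ^+ 2 * rho x z.
have bN : bmf N by apply: bmfM => //; exact: bmf_dist2.
have N0 z : 0 <= N z by rewrite mulr_ge0// sqr_ge0.
(* Because of the retraction inside it, [N] need not vanish off the support; the indicator makes
   [affine_image_integral] applicable. *)
pose h z := \1_W1 z * N z.
have bh : bmf h by apply: bmfM => //; exact: bmf_indic.
have h0 z : 0 <= h z by rewrite mulr_ge0.
have hW z : ~ W1 z -> h z = 0.
  by move=> nW; rewrite /h indicE memNset// mul0r.
have rho_r z : rho x (r1 z) = rho x z.
  rewrite /rho; congr (_ * pos _ `^ _).
  by rewrite /slack/= !tcostE GE retr_idem.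
pose w z := 2^-1 *: y + 2^-1 *: z.
have bhw : bmf (fun z => h (w z)).
  by apply: (bmf_comp _ bh); exact: measurable_affine_rV.
have bhwr : bmf (fun z => h (w (r1 z))).
  by apply: (bmf_comp _ bhw); exact: measurable_retr.
have pt z : enorm (y - t) ^+ 2 * rho x z <=
    8 * 2 `^ k * h (w (r1 z)) + 2 * N z.
  rewrite -(rho_r z) (_ : N z = N (r1 z)); last first.
    by rewrite /N rho_r retr_idem.
  have := retr_in z W1b; move: (r1 z) => {}z W1z.
  have [xz|xz] := ltP 0 (xi (x, z)); last first.
    rewrite {1}/rho le0_pos// powR0; last by rewrite gt_eqF// (lt_le_trans _ k1).
    rewrite !mulr0; apply: addr_ge0; last exact: mulr_ge0.
    by apply: mulr_ge0 => //; rewrite mulr_ge0 ?powR_ge0.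
  have W1w := mid z W1z xz; rewrite -/(w z) in W1w.
  have -> : h (w z) = enorm (w z - t) ^+ 2 * rho x (w z).
    by rewrite /h /N indicE mem_set// mul1r retr_id.
  rewrite /N retr_id//.
  have rw : rho x z <= 2 `^ k * rho x (w z).
    rewrite /rho mulrCA ler_wpM2l ?invr_ge0 ?(ltW c00)//.
    rewrite -powRM ?pos_ge0//; apply: ge0_ler_powR => //; rewrite ?nnegrE ?mulr_ge0 ?pos_ge0//.
    have t01 : 0 <= (2^-1 : R) <= 1 by rewrite invr_ge0 ler0n invf_le1 ?ler1n.
    have wE : (1 - 2^-1) *: y + 2^-1 *: z = w z.
      by rewrite /w (_ : 1 - 2^-1 = 2^-1)//; field.
    have := @slack_concave_snd x y z _ W0x W1y W1z t01.
    rewrite wE => /(_ W1w) hc.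
    have := pos_ge (xi (x, w z)); rewrite (gt0_pos xz) => hp.
    exact: half_convex_le hc hp xy.
  have yt : enorm (y - t) ^+ 2 <= 8 * enorm (w z - t) ^+ 2 + 2 * enorm (z - t) ^+ 2.
    (* Then |u - v|^2 <= 2 |u|^2 + 2 |v|^2, the missing term being |u + v|^2 >= 0. *)
    have -> : y - t = 2 *: (w z - t) - (z - t).
      by apply/rowP => i; rewrite !mxE; field.
    have e := enorm_sqrB (2 *: (w z - t)) (z - t).
    have e' : 0 <= enorm (2 *: (w z - t) + (z - t)) ^+ 2 by exact: sqr_ge0.
    rewrite -[X in enorm (_ + X)]opprK enorm_sqrB dotNr enormN in e'.
    rewrite e enormZ in e' *; rewrite ger0_norm// in e' *.
    by move: e'; move: (dot _ _) (enorm _) (enorm _) => A B C'; lra.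
  apply: (le_trans (ler_wpM2r (rho_ge0 x z) yt)).
  rewrite mulrDl; apply: lerD; last by rewrite -mulrA.
  rewrite -[leLHS]mulrA -[leRHS]mulrA; apply: ler_wpM2l => //.
  by rewrite [leRHS]mulrCA; apply: ler_wpM2l => //; exact: sqr_ge0.
have rho1 : \int[Q]_z rho x z = 1.
  have := intZ Q c0^-1 (f := fun z => pos (xi (x, z)) `^ k).
  rewrite eqF mulVf ?gt_eqF// => -> //.
  apply: bmf_powR => //; first exact/bmf_pos/bmf_section_slack.
  by move=> z; exact: pos_ge0.
have := le_int Q (bmfZ (enorm (y - t) ^+ 2) (brho x))
  (bmfD (bmfZ (8 * 2 `^ k) bhwr) (bmfZ 2 bN)) pt.
rewrite (intZ Q _ (brho x)) rho1 mulr1.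
rewrite (intD Q (bmfZ _ bhwr) (bmfZ _ bN)) (intZ Q _ bhwr) (intZ Q _ bN).
have hwE : \int[Q]_z h (w (r1 z)) = \int[Q]_z h (w z).
  by apply: (eq_int_full QW1 mW1 bhwr bhw) => z W1z; rewrite retr_id.
have hN : \int[Q]_z h z <= \int[Q]_z N z.
  apply: (le_int Q bh bN) => z; rewrite /h indicE.
  by case: (_ \in _); rewrite ?mul1r ?mul0r.
have := affine_image_integral QW1 al0 be0 Qd (2^-1 *: y) i20 bh h0 hW.
rewrite invrK hwE -/w; rewrite /section_const.
rewrite -/N.
exact: (midpoint_bound C10 C20 hN).
Qed.

End section_distance.

(** If [c] were positive, more than m(B)/c of the disjoint copies could not fit into [B]. *)
Lemma disjoint_copies_null {R : realType} d (X : measurableType d)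
    (m : {measure set X -> \bar R}) (A : nat -> set X) (B : set X) (c : \bar R) :
  (forall i, measurable (A i)) -> trivIset [set: nat] A ->
  measurable B -> (forall i, A i `<=` B) -> (m B < +oo)%E ->
  (0 <= c)%E -> (forall i, c <= m (A i))%E -> c = 0%E.
Proof.
move=> mA tA mB AB mBoo c0 cA.
have mAB i : (m (A i) <= m B)%E by apply: le_measure; rewrite ?inE.
have nc n : (\sum_(i < n) c <= m B)%E.
  apply: (@le_trans _ _ (\sum_(i < n) m (A i))%E); first exact: lee_sum.
  rewrite -measure_bigsetU//; apply: le_measure; rewrite ?inE//.
    exact: bigsetU_measurable.
  by move=> x; rewrite -bigcup_mkord => -[i _]; exact: AB.
have coo : (c < +oo)%E by exact: le_lt_trans (le_trans (cA 0%N) (mAB 0%N)) mBoo.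
case: c c0 coo nc {cA} => // r r0 _ nc.
have mBf : m B \is a fin_num by rewrite ge0_fin_numE.
congr EFin; rewrite lee_fin in r0; apply/eqP; rewrite eq_le r0 andbT leNgt.
apply/negP => rp.
have s0 : 0 <= fine (m B) / r by rewrite divr_ge0 ?fine_ge0// ltW.
have := nc (Num.truncn (fine (m B) / r)).+1.
rewrite sumEFin big_const_ord iter_addr_0 -(fineK mBf) lee_fin.
have /andP[_] := truncn_itv s0; rewrite ltr_pdivrMr// mulr_natl.
by move=> h1 h2; have := lt_le_trans h1 h2; rewrite ltxx.
Qed.

(** * Gradient of the regularized potential *)

Section derivative_weight.
Context {R : realType}.
Implicit Types (k a : R).

Lemma wpos_mul k a : 1 <= k -> pos a * wpos k a = pos a `^ k.
Proof.
move=> k1; rewrite /wpos; case: ltP => a0.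
  by rewrite (gt0_pos a0) mulr_powRB1 ?(lt_le_trans _ k1)// ltW.
by rewrite (le0_pos a0) mul0r powR0// gt_eqF// (lt_le_trans _ k1).
Qed.

Lemma wpos_le k a B : 1 <= k -> a <= B -> wpos k a <= pos B `^ (k - 1).
Proof.
move=> k1 aB; rewrite /wpos; case: ifP => a0; last exact: powR_ge0.
apply: ge0_ler_powR; rewrite ?nnegrE ?pos_ge0 ?(ltW a0) ?subr_ge0//.
exact: le_trans aB (pos_ge B).
Qed.

Lemma bmf_wpos d (X : measurableType d) k (f : X -> R) : 1 <= k -> bmf f ->
  bmf (fun x => wpos k (f x)).
Proof.
move=> k1 [mf [B fB]]; split.
  rewrite /wpos; apply: measurable_fun_ifT => //.
    exact: measurable_fun_ltr.
  exact: (measurableT_comp (measurable_powR (k - 1))).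
exists (pos B `^ (k - 1)) => x; rewrite ger0_norm ?wpos_ge0//.
by apply: wpos_le => //; exact: le_trans (ler_norm _) (fB x).
Qed.

(** The value 0 is excluded because for k = 1 the weight is an indicator, which jumps there. *)
Lemma wpos_cvg k (u : nat -> R) a : a != 0 -> u @ \oo --> a ->
  (fun n => wpos k (u n)) @ \oo --> wpos k a.
Proof.
move=> a0 ua; rewrite /wpos; have [ap|an] := ltP 0 a.
  have cp : {for a, continuous (fun b : R => b `^ (k - 1))}.
    apply: differentiable_continuous; apply/derivable1_diffP.
    by apply: derivable_powR; rewrite in_itv/= ap.
  have H : (fun n => u n `^ (k - 1)) @ \oo --> a `^ (k - 1) by exact: continuous_cvg cp ua.
  apply: cvg_trans H; apply: near_eq_cvg; near=> n; rewrite ifT//.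
  by near: n; exact: (cvgr_gt a).
have {}an : a < 0 by rewrite lt_neqAle a0.
apply: cvg_near_cst; near=> n; rewrite ifF//; apply/negbTE; rewrite -leNgt ltW//.
by near: n; exact: (cvgr_lt a).
Unshelve. all: by end_near.
Qed.

End derivative_weight.

Lemma int_sum {R : realType} d (X : measurableType d) (Q : probability X R)
    (I : finType) (h : I -> X -> R) : (forall i, bmf (h i)) ->
  \int[Q]_x (\sum_i h i x) = \sum_i \int[Q]_x h i x.
Proof.
move=> bh; suff H (s : seq I) : bmf (fun x => \sum_(i <- s) h i x) /\
    \int[Q]_x (\sum_(i <- s) h i x) = \sum_(i <- s) \int[Q]_x h i x.
  exact: (H _).2.
elim: s => [|i s [IH1 IH2]].
  split; first by under eq_fun do rewrite big_nil; exact: bmf_cst.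
  by under eq_Rintegral do rewrite big_nil; rewrite big_nil int_cst.
split; first by under eq_fun do rewrite big_cons; exact: bmfD.
by under eq_Rintegral do rewrite big_cons; rewrite big_cons intD// IH2.
Qed.

Lemma bounded_convergence {R : realType} d (X : measurableType d)
    (Q : probability X R) (u : nat -> X -> R) (h : X -> R) (N : set X) (B : R) :
  (forall n, bmf (u n)) -> bmf h -> (forall n x, `|u n x| <= B) ->
  measurable N -> Q N = 0%E ->
  (forall x, ~ N x -> (fun n => u n x) @ \oo --> h x) ->
  (fun n => \int[Q]_x u n x) @ \oo --> \int[Q]_x h x.
Proof.
move=> bu bh uB mN QN uh.
have bB := bmf_integrable Q (bmf_cst X B).
have [] := @dominated_convergence _ _ _ Q setT measurableT
  (fun n x => (u n x)%:E) (EFin \o h) (EFin \o cst B).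
- by move=> n; apply/measurable_EFinP; exact: (bu n).1.
- by apply/measurable_EFinP; exact: bh.1.
- exists N; split=> // x /=; apply: contra_notP => Nx _.
  by apply: cvg_EFin; [near=> n|exact: uh].
- exact: bB.
- by apply: aeW => x n _ /=; rewrite lee_fin.
move=> _ _ H; apply: fine_cvg; move: H.
by rewrite -int_EFin.
Unshelve. all: by end_near.
Qed.

Lemma cvg_dist0 {R : realType} (f : nat -> R) (l : R) : f @ \oo --> l ->
  (fun n => `|f n - l|) @ \oo --> (0 : R).
Proof.
move=> fl; apply/norm_cvg0P; rewrite -(subrr l).
by apply: cvgB => //; exact: cvg_cst.
Qed.

(** Whatever the sign of the step [s], the two one-sided bounds on the increment place the
    difference quotient between [m] and [m']. *)
Lemma quotient_between {R : realFieldType} (s A B m m' : R) : s != 0 ->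
  A - B <= s * m' -> B - A <= - (s * m) -> `|s^-1 * (A - B) - m| <= `|m' - m|.
Proof.
move=> s0 h1 h2; set q := s^-1 * _.
have qE : A - B = s * q by rewrite /q mulVKf.
have h3 : s * m <= s * q by rewrite -qE; lra.
rewrite qE in h1; have := s0; rewrite neq_lt => /orP[sn|sp].
  rewrite !ler_nM2l// in h1 h3.
  by rewrite !ler0_norm ?subr_le0 ?(le_trans h1)//; lra.
rewrite !ler_pM2l// in h1 h3.
by rewrite !ger0_norm ?subr_ge0 ?(le_trans h3)//; lra.
Qed.

Section gradient.
Context {R : realType} {d : nat}.
Local Notation E := 'rV[R]_d.
Context (P Q : probability E R) (a b : E) (M k : R).
Local Notation W0 := (msupport P).
Local Notation W1 := (msupport Q).
Hypotheses (PW0 : P W0 = 1%E) (QW1 : Q W1 = 1%E) (W0a : W0 a) (W1b : W1 b).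
Hypotheses (M0 : 0 < M) (W0M : forall x, W0 x -> enorm x <= M)
  (W1M : forall y, W1 y -> enorm y <= M) (k1 : 1 <= k).
Local Notation r0 := (retr W0 a).
Local Notation r1 := (retr W1 b).
Context (be : R).
Hypothesis Qd : forall A, measurable A -> A `<=` W1 ->
  (Q A <= be%:E * lebesgue_rV d A)%E.
Context (c0 : R) (F G : E -> R).
Hypotheses (c00 : 0 < c0) (dFG : dual_pair P Q a b k c0 F G).
Local Notation xi := (slack P Q a b F G).

Let mW0 : measurable W0. Proof. exact: measurable_msupport. Qed.
Let mW1 : measurable W1. Proof. exact: measurable_msupport. Qed.

Let bxi x : bmf (fun y => xi (x, y)).
Proof. exact: (bmf_section_slack W0a W1b W0M W1M dFG). Qed.

Let bpow x : bmf (fun y => pos (xi (x, y)) `^ k).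
Proof.
apply: bmf_powR; [exact: le_trans k1|exact/bmf_pos/bxi|].
by move=> y; exact: pos_ge0.
Qed.

Let eqF x : \int[Q]_y pos (xi (x, y)) `^ k = c0.
Proof. by have [_ _ _ ->] := dFG. Qed.

Let xi_retr x y : xi (r0 x, r1 y) = xi (x, y).
Proof. by have [_ FE GE _ _] := dFG; exact: slack_retr. Qed.

Lemma section_nonempty x : exists y, W1 y /\ 0 < xi (x, y).
Proof.
apply: contrapT => /forallNP H; have : \int[Q]_y pos (xi (x, y)) `^ k = 0.
  have -> : (fun y => pos (xi (x, y)) `^ k) = fun=> 0.
    apply/funext => y; rewrite -xi_retr le0_pos ?powR0//.
      by rewrite gt_eqF// (lt_le_trans _ k1).
    rewrite leNgt; apply/negP => h.
    case: (H (r1 y)); split; first exact: (retr_in y W1b).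
    by rewrite -xi_retr (retr_idem y W1b).
  exact: int_cst.
by rewrite eqF => c0E; have := c00; rewrite c0E ltxx.
Qed.

(* The dilations of the zero set about a point of positive slack are pairwise
   disjoint by concavity along segments. *)
Lemma level_null x : W0 x -> Q (W1 `&` [set y | xi (x, y) = 0]) = 0%E.
Proof.
move=> W0x; set N := W1 `&` _.
have mN : measurable N.
  apply: measurableI => //.
  have := (bxi x).1 measurableT _ (measurable_set1 0); rewrite setTI.
  exact.
have [y0 [W1y0 xy0]] := section_nonempty x.
(* Infinitely many distinct ratios in [1/2, 1): all dilated copies stay in a bounded set and keep at
   least the fraction 2^(-d) of the volume. *)
pose s (n : nat) : R := 1 - n.+2%:R^-1.
have s12 n : 2^-1 <= s n < 1.
  rewrite /s lerBrDr gtrBl invr_gt0 ltr0n andbT.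
  have : n.+2%:R^-1 <= 2^-1 :> R by rewrite lef_pV2 ?posrE ?ltr0n// ler_nat.
  by move=> h; rewrite [leRHS](splitr 1) div1r lerD2l.
have s0 n : 0 < s n by have /andP[h _] := s12 n; rewrite (lt_le_trans _ h)// invr_gt0.
have smono m n : (m < n)%N -> s m < s n.
  by move=> mn; rewrite /s ltrD2l ltrN2 ltf_pV2 ?posrE ?ltr0n// ltr_nat !ltnS.
(* The dilation of [N] about [y0] with ratio [s n], written as a preimage under the inverse map so
   that measurability and volume follow from the lemmas on preimages. *)
pose A n := (fun z : E => (1 - (s n)^-1) *: y0 + (s n)^-1 *: z)%R @^-1` N.
have mA n : measurable (A n).
  by rewrite -[X in measurable X]setTI; exact: measurable_affine_rV.
have AE n z : A n z -> z = (1 - s n) *: y0 + s n *: ((1 - (s n)^-1) *: y0 + (s n)^-1 *: z).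
  move=> _; apply/rowP => i; rewrite !mxE; field.
  by rewrite gt_eqF.
have lt_disj m n z : (m < n)%N -> A m z -> A n z -> False.
  move=> mn Am An; have sm := smono _ _ mn.
  set y := (1 - (s m)^-1) *: y0 + (s m)^-1 *: z.
  set y' := (1 - (s n)^-1) *: y0 + (s n)^-1 *: z.
  have [W1y /= xy] : N y := Am.
  have [W1y' /= xy'] : N y' := An.
  pose t := s m / s n.
  have t01 : 0 <= t <= 1 by rewrite divr_ge0 ?(ltW (s0 _))//= ler_pdivrMr// mul1r ltW.
  have t1 : t < 1 by rewrite ltr_pdivrMr// mul1r.
  (* A common point would place one zero of the slack strictly between [y0], where the slack is
     positive, and another zero; concavity makes the slack positive there. *)
  have yt : (1 - t) *: y0 + t *: y = y'.
    apply/rowP => i; rewrite /y /y' !mxE /t; field.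
    by rewrite !gt_eqF.
  have := slack_concave_snd W0a W1b W0M W1M k1 c00 dFG W0x W1y0 W1y t01.
  rewrite yt xy xy' mulr0 addr0 => /(_ W1y'); rewrite leNgt mulr_gt0//.
  by rewrite subr_gt0.
have tA : trivIset [set: nat] A.
  apply/trivIsetP => m n _ _; rewrite neq_ltn => /orP[mn|nm].
    by apply/seteqP; split => z // -[Am An]; exact: (lt_disj _ _ _ mn Am An).
  by apply/seteqP; split => z // -[Am An]; exact: (lt_disj _ _ _ nm An Am).
pose B := [set z : E | enorm z <= M].
have mB : measurable B.
  have -> : B = setT `&` @enorm R d @^-1` `]-oo, M].
    by rewrite setTI; apply/seteqP; split => z; rewrite /B/= in_itv.
  exact: measurable_enorm.
have AB n : A n `<=` B.
  move=> z Az; rewrite /B/= (AE n z Az).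
  have [W1y _] := Az; have h1 := W1M W1y0; have h2 := W1M W1y.
  apply: (le_trans (enormD _ _)); rewrite !enormZ.
  have /andP[_ sn1] := s12 n.
  rewrite ger0_norm ?subr_ge0 ?(ltW sn1)// gtr0_norm//.
  have : (1 - s n) * enorm y0 <= (1 - s n) * M by rewrite ler_wpM2l ?subr_ge0 ?(ltW sn1).
  have : s n * enorm ((1 - (s n)^-1) *: y0 + (s n)^-1 *: z) <= s n * M.
    by rewrite ler_wpM2l// ltW.
  by move=> u v; have := lerD v u; rewrite -mulrDl subrK mul1r.
have Boo : (lebesgue_rV d B < +oo)%E by apply: (lebesgue_rV_bounded (M := M) mB).
have LA n : ((2^-1 ^+ d)%:E * lebesgue_rV d N <= lebesgue_rV d (A n))%E.
  rewrite /A lebesgue_rV_affine ?invr_gt0// invrK lee_wpmul2r// lee_fin.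
  have /andP[sn1 _] := s12 n.
  by apply: lerXn2r => //; rewrite nnegrE ?invr_ge0 ?ler0n ?(ltW (s0 n)).
have := disjoint_copies_null mA tA mB AB Boo _ LA.
rewrite mule_ge0 ?lee_fin ?exprn_ge0 ?invr_ge0// => /(_ isT) /eqP.
rewrite mule_eq0 => /orP[|/eqP LN].
  by rewrite eqe expf_eq0 invr_eq0 pnatr_eq0 andbF.
have := Qd mN (@subIsetl _ _ _); rewrite LN mule0 => h.
by apply/eqP; rewrite eq_le h measure_ge0.
Qed.

Lemma cvg_slack (u : nat -> E) x y : W0 x ->
  (fun n => enorm (u n - x)) @ \oo --> (0 : R) ->
  (\forall n \near \oo, W0 (u n)) ->
  (fun n => xi (u n, y)) @ \oo --> xi (x, y).
Proof.
move=> W0x ux W0u; apply: cvg_zero; apply: norm_cvg0.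
apply: (@squeeze_cvgr _ _ _ _ (fun=> 0) (fun n => 4 * M * enorm (u n - x))).
- near=> n; have W0n : W0 (u n) by near: n.
  rewrite normr_ge0/= ler_norml.
  have h1 := slack_lip_fst W0a W1b W0M W1M k1 y c00 dFG W0n W0x.
  have h2 := slack_lip_fst W0a W1b W0M W1M k1 y c00 dFG W0x W0n.
  rewrite enormB in h2; rewrite !fctE /=.
  move: h1 h2; move: (4 * M * _) (xi (u n, y)) (xi (x, y)) => A B C h1 h2.
  by apply/andP; split; lra.
- exact: cvg_cst.
- by rewrite -[X in _ --> X](mulr0 (4 * M)); exact: cvgMr.
Unshelve. all: by end_near.
Qed.

Let w x y := wpos k (xi (x, y)).

Let bw x : bmf (w x).
Proof. exact: (bmf_wpos k1 (bxi x)). Qed.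

Lemma weight_gt0 x : 0 < \int[Q]_y w x y.
Proof.
have [B xB] := (bxi x).2; have [y [_ xy]] := section_nonempty x.
have B0 : 0 < B by exact: lt_le_trans xy (le_trans (ler_norm _) (xB y)).
rewrite -(pmulr_rgt0 _ B0) -(intZ Q _ (bw x)); apply: (lt_le_trans c00).
rewrite -(eqF x); apply: (le_int Q (bpow x) (bmfZ B (bw x))) => z.
rewrite -wpos_mul// ler_wpM2r ?wpos_ge0// pos_le (ltW B0) andbT.
exact: le_trans (ler_norm _) (xB z).
Qed.

(** Bounded convergence: the slack converges at every y, and the weight is continuous at the limit
    except on the zero level, which is null by [level_null]. *)
Lemma cvg_weight (u : nat -> E) x (th : E -> R) : W0 x ->
  (fun n => enorm (u n - x)) @ \oo --> (0 : R) ->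
  (\forall n \near \oo, W0 (u n)) -> bmf th ->
  (fun n => \int[Q]_y (w (u n) y * th y)) @ \oo --> \int[Q]_y (w x y * th y).
Proof.
move=> W0x ux W0u bth; have [Bt thB] := bth.2.
have [[bF bG] _ _ _ _] := dFG.
have [B xB] := (bmf_slack W0a W1b W0M W1M bF bG).2.
pose N := ~` W1 `|` (W1 `&` [set y | xi (x, y) = 0]).
have mN : measurable N.
  apply: measurableU; first exact: measurableC.
  apply: measurableI => //.
  by have := (bxi x).1 measurableT _ (measurable_set1 0); rewrite setTI; exact.
apply: (@bounded_convergence _ _ _ _ _ _ N (pos B `^ (k - 1) * Bt)) => //.
- by move=> n; apply: bmfM.
- by apply: bmfM.
- move=> n y; rewrite normrM ger0_norm ?wpos_ge0//; apply: ler_pM => //.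
    exact: wpos_ge0.
  by apply: wpos_le => //; exact: le_trans (ler_norm _) (xB _).
- have h1 : Q (~` W1) = 0%E by rewrite probability_setC// QW1 subee.
  have h2 := level_null W0x.
  apply: (null_set_setU _ _ h1 h2); first exact: measurableC.
  apply: measurableI => //.
  by have := (bxi x).1 measurableT _ (measurable_set1 0); rewrite setTI; exact.
move=> y Ny; apply: cvgMl; apply: wpos_cvg; last exact: cvg_slack.
apply/negP => /eqP xy; apply: Ny; have [W1y|W1y] := pselect (W1 y); last by left.
by right.
Qed.

Lemma bmf_dot_retr (v : E) : bmf (fun y => dot v (r1 y)).
Proof.
apply: (bmf_sum (h := fun i y => v ord0 i * r1 y ord0 i)) => i; apply: bmfZ; split.
  exact: (measurableT_comp (measurable_coord_rV i) (measurable_retr _ mW1)).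
exists M => y; apply: (le_trans (enorm_coord _ _)).
exact: (W1M (retr_in y W1b)).
Qed.

(** When k = q - 1 the weight on the section is the power q - 2 of the slack, so this is the
    gradient formula for the regularized potential, paired with [v]. *)
Definition mean x (v : E) : R :=
  (\int[Q]_y w x y)^-1 * \int[Q]_y (w x y * dot v (r1 y)).

Context (phi : E -> R).
Hypothesis phiE : forall z, W0 z -> phi z = 2^-1 * enorm z ^+ 2 - F z.

(** Integrate in y the tangent inequality for the power of the positive part, taken at the slack of
    x'. Both powers integrate to [c0], so the weighted integral of the slack difference, which is
    the increment minus the pairing of x' - x with y, is at most 0. *)
Lemma potential_increment x x' : W0 x -> W0 x' ->
  phi x' - phi x <= mean x' (x' - x).
Proof.
move=> W0x W0x'; set D := phi x' - phi x.
rewrite /mean -ler_pdivrMl ?invr_gt0 ?weight_gt0// invrK.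
have bd := bmf_dot_retr (x' - x).
have bwd := bmfM (bw x') bd.
have pt y : k * (w x' y * D - w x' y * dot (x' - x) (r1 y)) <=
    pos (xi (x, y)) `^ k - pos (xi (x', y)) `^ k.
  rewrite lerBrDl -mulrBr.
  have -> : D - dot (x' - x) (r1 y) = xi (x, y) - xi (x', y).
    rewrite /D !phiE// /slack/= !tcostE !(retr_id _ W0x) !(retr_id _ W0x') !costE.
    rewrite dotDl dotNl.
    by move: (dot _ _) (dot _ _) (enorm _ ^+ 2) (enorm _ ^+ 2) (enorm _ ^+ 2) => *; ring.
  exact: pos_tangent.
have bl := bmfZ k (bmfB (bmfM (bw x') (bmf_cst _ D)) bwd).
have := le_int Q bl (bmfB (bpow x) (bpow x')) pt.
rewrite (intB Q (bpow x) (bpow x')) !eqF subrr.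
rewrite (intZ Q k (bmfB (bmfM (bw x') (bmf_cst _ D)) bwd)).
rewrite (intB Q (bmfM (bw x') (bmf_cst _ D)) bwd).
rewrite (pmulr_rle0 _ (lt_le_trans ltr01 k1)) subr_le0.
suff -> : \int[Q]_y (w x' y * D) = (\int[Q]_y w x' y) * D by [].
by rewrite mulrC -(intZ Q D (bw x')); apply: eq_Rintegral => y _; rewrite mulrC.
Qed.

Lemma mean_scale x s v : mean x (s *: v) = s * mean x v.
Proof.
rewrite /mean mulrCA -(intZ Q s (bmfM (bw x) (bmf_dot_retr v))).
by congr (_ * _); apply: eq_Rintegral => y _; rewrite dotZl mulrCA.
Qed.

Lemma cvg_mean (u : nat -> E) x v : W0 x ->
  (fun n => enorm (u n - x)) @ \oo --> (0 : R) ->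
  (\forall n \near \oo, W0 (u n)) ->
  (fun n => mean (u n) v) @ \oo --> mean x v.
Proof.
move=> W0x ux W0u; apply: cvgM; last exact: cvg_weight (bmf_dot_retr v).
apply: cvgV; first by rewrite gt_eqF// weight_gt0.
have := cvg_weight W0x ux W0u (bmf_cst _ 1).
by under eq_fun do under eq_Rintegral do rewrite mulr1;
  under [X in _ --> X]eq_Rintegral do rewrite mulr1.
Qed.

(** [potential_increment] from x to x + u v and back traps the difference quotient between the means
    at the two points, and the mean is continuous. Sequences replace general limits because this
    continuity comes from a convergence theorem for sequences. *)
Lemma derive_potential x v : W0^° x -> 'D_v (phi : E -> R^o) x = mean x v.
Proof.
move=> ix; have W0x : W0 x := interior_subset ix.
apply: cvg_lim => //.
apply/cvgr_dnbhsP => u [u0 uc].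
have uxc : (fun n => u n *: v + x) @ \oo --> x.
  rewrite -[X in _ --> X]add0r -[X in _ --> X + _](scale0r v).
  by apply: cvgD; [exact: cvgZl|exact: cvg_cst].
have W0u : \forall n \near \oo, W0 (u n *: v + x) by exact: uxc.
have ue : (fun n => enorm (u n *: v + x - x)) @ \oo --> (0 : R).
  under eq_fun do rewrite addrK enormZ.
  have := @cvgMl _ _ _ _ _ _ (enorm v) (cvg_norm uc); rewrite normr0 mul0r.
  exact.
have cm := @cvg_mean _ _ v W0x ue W0u.
apply: cvg_zero; apply: norm_cvg0.
apply: (@squeeze_cvgr _ _ _ _ (fun=> 0)
  (fun n => `|mean (u n *: v + x) v - mean x v|)).
- near=> n; have W0n : W0 (u n *: v + x) by near: n.
  have h1 := potential_increment W0x W0n.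
  have h2 := potential_increment W0n W0x.
  rewrite normr_ge0/= !fctE/=.
  rewrite addrK mean_scale in h1.
  have xu : x - (u n *: v + x) = (- u n) *: v by rewrite opprD addrCA subrr addr0 scaleNr.
  rewrite xu mean_scale mulNr in h2.
  exact: (quotient_between (u0 n) h1 h2).
- exact: cvg_cst.
- exact: cvg_dist0 cm.
Unshelve. all: by end_near.
Qed.

(** A weighted mean of points of the section lies in every closed ball containing the section. The
    mean is tested against the vector v from [t] to the gradient, which gives |v|^2 <= |v| D. *)
Lemma grad_potential_dist x (t : E) (D : R) : W0^° x ->
  (forall y, W1 y -> 0 < xi (x, y) -> enorm (y - t) <= D) ->
  enorm (grad phi x - t) <= D.
Proof.
move=> ix HD; have W0x : W0 x := interior_subset ix.
have [y0 [W1y0 xy0]] := section_nonempty x.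
have D0 : 0 <= D by exact: le_trans (enorm_ge0 _) (HD _ W1y0 xy0).
set v := grad phi x - t.
have dg : dot v (grad phi x) = mean x v.
  transitivity (\sum_i v ord0 i * mean x (delta_mx ord0 i)).
    by apply: eq_bigr => i _; rewrite !mxE derive_potential.
  rewrite /mean; under eq_bigr do rewrite mulrCA.
  rewrite -mulr_sumr; congr (_ * _).
  have bwe i := bmfM (bw x) (bmf_dot_retr (delta_mx ord0 i)).
  under eq_bigr => i _ do rewrite -(intZ Q _ (bwe i)).
  rewrite -(int_sum Q (fun i => bmfZ (v ord0 i) (bwe i))).
  apply: eq_Rintegral => y _; under eq_bigr do rewrite mulrCA.
  by rewrite -mulr_sumr -dot_sum -row_sum_delta.
have le : mean x v - dot v t <= enorm v * D.
  rewrite lerBlDl /mean ler_pdivrMl ?weight_gt0// mulrC.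
  rewrite -(intZ Q _ (bw x)).
  apply: (le_int Q (bmfM (bw x) (bmf_dot_retr v)) (bmfZ _ (bw x))) => y.
  rewrite mulrC; have [xy|xy] := ltP 0 (xi (x, y)); last first.
    by rewrite /w /wpos ltNge xy !mulr0.
  apply: ler_wpM2r; first exact: wpos_ge0.
  have W1y := retr_in y W1b.
  rewrite -xi_retr (retr_id _ W0x) in xy.
  have := HD _ W1y xy; move: (r1 y) => z zD.
  have := dot_le v (z - t); rewrite dotDr dotNr.
  have := ler_wpM2l (enorm_ge0 v) zD.
  by move: (enorm v * _) (enorm v * _) (dot _ _) (dot _ _) => *; lra.
have : enorm v ^+ 2 <= enorm v * D.
  by rewrite enorm_sqr {2}/v dotDr dotNr dg.
have [->//|v0] := eqVneq (enorm v) 0.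
by rewrite expr2 ler_pM2l// lt_neqAle eq_sym v0 enorm_ge0.
Qed.

End gradient.

Lemma Tr_id {R : realType} {d : nat} (P : probability 'rV[R]_d R) a
    (T : 'rV[R]_d -> 'rV[R]_d) x : msupport P x -> Tr P a T x = T x.
Proof. by move=> Px; rewrite /Tr retr_id. Qed.

(** * Small regularization *)

Section regularized_family.
Context {R : realType} {d : nat}.
Local Notation E := 'rV[R]_d.
Context (P Q : probability E R) (a b : E) (M k : R).
Local Notation W0 := (msupport P).
Local Notation W1 := (msupport Q).
Hypotheses (cW0 : compact W0) (cW1 : compact W1).
Hypotheses (PW0 : P W0 = 1%E) (QW1 : Q W1 = 1%E) (W0a : W0 a) (W1b : W1 b).
Hypotheses (M0 : 0 < M) (W0M : forall x, W0 x -> enorm x <= M)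
  (W1M : forall y, W1 y -> enorm y <= M) (k1 : 1 <= k).
Local Notation tc := (tcost W0 a W1 b).
Context (T : E -> E) (LT LS : R).
Hypotheses (LT0 : 0 < LT) (TW : forall x, W0 x -> W1 (T x))
  (TL : forall x x', W0 x -> W0 x' -> enorm (T x - T x') <= LT * enorm (x - x'))
  (mT : measurable_fun W0 T).
Hypotheses (LS0 : 0 < LS)
  (SL : forall x x', W0 x -> W0 x' -> enorm (x - x') <= LS * enorm (T x - T x')).
Local Notation Tr := (Tr P a T).
Hypothesis pT : forall B, measurable B -> P (Tr @^-1` B) = Q B.
Context (p : R).
Hypotheses (p12 : 1 < p <= 2) (kE : k = conj_exp p - 1).
Context (al be : R).
Hypotheses (al0 : 0 < al) (be0 : 0 <= be).
Hypothesis Qd : forall A, measurable A -> A `<=` W1 ->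
  (al%:E * lebesgue_rV d A <= Q A)%E /\ (Q A <= be%:E * lebesgue_rV d A)%E.
Context (F G : R -> E -> R).
Local Notation dens eps := (reg_density P Q a b k p eps (F eps) (G eps)).
Local Notation xi eps := (slack P Q a b (F eps) (G eps)).
Hypothesis dFG : forall eps, 0 < eps ->
  dual_pair P Q a b k (reg_const k p eps) (F eps) (G eps).
Hypothesis opt : forall eps, 0 < eps ->
  \int[P]_x tc (x, Tr x) <= dint P Q (fun z => tc z * dens eps z).

Let mW0 : measurable W0. Proof. exact: measurable_msupport. Qed.
Let mW1 : measurable W1. Proof. exact: measurable_msupport. Qed.

Let bdens eps : 0 < eps -> bmf (dens eps).
Proof.
move=> e0; have [[bF bG] _ _ _ _] := dFG e0.
exact: (bmf_reg_density W0a W1b W0M W1M k1 p eps bF bG).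
Qed.

(** By optimality of [T] the slack integrates to at least as much along the graph as against the
    regularized density, and that density vanishes where the slack is negative. *)
Lemma graph_slack_ge0 eps : 0 < eps -> 0 <= \int[P]_x xi eps (x, Tr x).
Proof.
move=> e0; have [[bF bG] FE GE _ _] := dFG e0.
have btc := bmf_tc W0a W1b W0M W1M.
have bs := bmf_slack W0a W1b W0M W1M bF bG.
have mTr := measurable_Tr W0a mT.
have bGT : bmf (fun x => G eps (Tr x)) by exact: bmf_comp mTr bG.
have btcT := bmf_graph W0a mT btc.
have -> : \int[P]_x xi eps (x, Tr x) =
    \int[P]_x F eps x + \int[Q]_y G eps y - \int[P]_x tc (x, Tr x).
  by rewrite (int_pushforward mTr pT bG) -(intD P bF bGT) -(intB P (bmfD bF bGT) btcT).
have := opt e0; have := dint_marginals bF bG btc (bdens e0)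
  (dint_marginal_fst P (F eps) (bdens e0) (reg_density_fst W0a W1b W0M W1M k1 p12 e0 (dFG e0)))
  (dint_marginal_snd Q bG (bdens e0) (reg_density_snd W0a W1b W0M W1M k1 p12 e0 (dFG e0))).
have : 0 <= dint P Q (fun z => xi eps z * dens eps z).
  rewrite [leLHS](_ : 0 = dint P Q (fun=> 0)); last first.
    by rewrite /dint; under eq_Rintegral do rewrite int_cst; rewrite int_cst.
  apply: le_dint; [exact: bmf_cst|exact: bmfM bs (bdens e0)|].
  move=> z; have [xz|xz] := leP 0 (xi eps z).
    by rewrite mulr_ge0// reg_density_ge0.
  rewrite /reg_density (le0_pos (ltW xz)) powR0 ?mulr0//.
  by rewrite gt_eqF// (lt_le_trans _ k1).
rewrite -/(xi eps _).
move: (\int[P]_x F eps x) (\int[Q]_y G eps y) (\int[P]_x tc _) => iF iG iT.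
move: (dint P Q (fun z => tc z * _)) => D1.
by move: (dint _ _ _) => D2 h1 h2 h3; rewrite -/D2; lra.
Qed.

Lemma reg_const_small c1 : 0 < c1 -> exists eps0 : R, 0 < eps0 <= 1 /\
  forall eps, 0 < eps <= eps0 -> reg_const k p eps < c1.
Proof.
move=> c10; have /andP[p1 p2] := p12.
have q0 : 0 < conj_exp p by rewrite divr_gt0 ?subr_gt0// (lt_trans ltr01).
have k0 : 0 < k by exact: lt_le_trans k1.
pose s := (c1 / 2) `^ k^-1.
have s0 : 0 < s by apply: powR_gt0; rewrite divr_gt0.
exists (Num.min 1 (s / conj_exp p)); split.
  by rewrite lt_min ltr01 divr_gt0//= ge_min lexx.
move=> eps /andP[e0]; rewrite le_min => /andP[_]; rewrite ler_pdivlMr// => es.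
rewrite /reg_const -powRM ?(ltW e0) ?(ltW q0)//.
apply: (@le_lt_trans _ _ (s `^ k)).
  apply: ge0_ler_powR; first exact: ltW.
  - by rewrite nnegrE mulr_ge0// ltW.
  - by rewrite nnegrE ltW.
  - exact: es.
rewrite /s -powRrM mulVf ?gt_eqF// powRr1 ?divr_ge0 ?(ltW c10)//.
by rewrite ltr_pdivrMr// ltr_pMr// ltr1n.
Qed.

Lemma quasi_small eta : 0 < eta -> exists eps0 : R, 0 < eps0 <= 1 /\
  forall eps, 0 < eps <= eps0 -> quasi_potentials P Q a b T eta (F eps) (G eps).
Proof.
move=> eta0.
have [eta' [eta'0 etaP]] :=
  graph_slack cW0 PW0 W0a W1b M0 W0M W1M k1 LT0 TW TL mT eta0.
have m0 : 0 < Num.min eta eta' by rewrite lt_min eta0.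
have [c1 [c10 c1P]] := slack_small cW1 QW1 W0a W1b M0 W0M W1M k1 m0.
have [eps0 [e01 e0P]] := reg_const_small c10.
exists eps0; split=> // eps e0s; have /andP[e0 _] := e0s.
have rc0 : 0 < reg_const k p eps by exact: reg_const_gt0.
have small := c1P _ _ _ _ (dFG e0).
have {}small x y : W0 x -> W1 y -> xi eps (x, y) <= Num.min eta eta'.
  by apply: small; rewrite rc0 e0P.
split=> [x y W0x W1y|].
  by apply: (le_trans (small x y W0x W1y)); rewrite ge_min lexx.
apply: (etaP _ _ _ rc0 (dFG e0)); last exact: graph_slack_ge0.
by move=> x y W0x W1y; apply: (le_trans (small x y W0x W1y)); rewrite ge_min lexx orbT.
Qed.

(** Supplies the hypothesis [Hq] under which monotonicity, openness of the map and the excess cost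
    estimate were proved. *)
Lemma quasi_exist eta : 0 < eta -> exists F G : E -> R,
  [/\ bmf F /\ bmf G, (forall x, F (retr W0 a x) = F x),
     (forall y, G (retr W1 b y) = G y) & quasi_potentials P Q a b T eta F G].
Proof.
move=> eta0; have [eps0 [/andP[e0 _] eP]] := quasi_small eta0.
exists (F eps0), (G eps0); have [bFG FE GE _ _] := dFG e0; split=> //.
by apply: eP; rewrite e0 lexx.
Qed.

Context (K : set E) (r : R).
Hypotheses (r0 : 0 < r) (mK : measurable K)
  (KW : forall x z, K x -> enorm (z - x) <= r -> W0 z).

(** The condition that separates the two claims of the theorem: immediate for all eps when the
    target support is convex, otherwise a consequence of the sections being small. *)
Definition midpoints (eps : R) : Prop := forall x y z, K x -> W1 y -> W1 z ->
  0 < xi eps (x, y) -> 0 < xi eps (x, z) -> W1 (2^-1 *: y + 2^-1 *: z).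

(** Positive slack at (x, u) forces c |u - T x|^2 < 3 eta; with eta = c de^2 / 3 the section lies in
    the ball of radius [de] about T x, which is convex and contained in the support. *)
Lemma midpoints_small : exists eps0 : R, 0 < eps0 <= 1 /\
  forall eps, 0 < eps <= eps0 -> midpoints eps.
Proof.
have [de [de0 deP]] := image_neighbourhood M0 W1M LT0 TW TL quasi_exist LS0 SL r0 KW.
have [c [cp cP]] := quasi_quadratic a b M0 W1M LT0 TW TL r0 KW.
have eta0 : 0 < c * de ^+ 2 / 3 by rewrite divr_gt0// mulr_gt0// exprn_gt0.
have [eps0 [e01 eP]] := quasi_small eta0.
exists eps0; split=> // eps e0s x y z Kx W1y W1z xy xz.
have near_T u : W1 u -> 0 < xi eps (x, u) -> enorm (u - T x) <= de.
  move=> W1u xu; have := cP _ _ _ (eP _ e0s) x u Kx W1u => h.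
  rewrite -ler_sqr ?nnegrE ?enorm_ge0 ?(ltW de0)// -(ler_pM2l cp).
  move: h xu; move: (xi eps _) (c * _) (c * _) => A B C h xu.
  by lra.
apply: (deP x) => //.
have -> : 2^-1 *: y + 2^-1 *: z - T x = 2^-1 *: (y - T x) + 2^-1 *: (z - T x).
  by apply/rowP => i; rewrite !mxE; field.
apply: (le_trans (enormD _ _)); rewrite !enormZ ger0_norm ?invr_ge0//.
have := near_T y W1y xy; have := near_T z W1z xz.
by move: (enorm _) (enorm _) => A B; lra.
Qed.

(** [H] is a multiple of the average of |y - T x|^2 over the section: a measurable majorant of the
    squared radius, whose integral over [K] the excess cost controls. Neither constant used depends
    on eps, so every eps in (0,1] with the midpoint property is covered. *)
Lemma section_radius_bound : exists C : R, 0 < C /\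
  forall eps, 0 < eps <= 1 -> midpoints eps ->
  exists H : E -> R, [/\ bmf H, (forall x, 0 <= H x),
    (forall x y, K x -> W1 y -> 0 < xi eps (x, y) -> enorm (y - T x) ^+ 2 <= H x)
    & \int[P]_x (\1_K x * H x) <= C * rate (d := d) p eps ^+ 2].
Proof.
have [c [cp cP]] := gap_controls_distance W0a W1b M0 W0M W1M LT0 TW TL mT
  quasi_exist pT r0 mK KW.
have [C1 [C10 C1P]] := gap_upper W0a W1b M0 W0M W1M k1 TW mT LS0 SL pT p12 kE.
pose C2 := section_const (d := d) k al be + 1.
have C20 : 0 < C2.
  by rewrite ltr_wpDl ?ltr01//; exact: section_const_ge0.
exists (C2 * (C1 / c)); split; first by rewrite mulr_gt0 ?divr_gt0.
move=> eps e01 mid; have /andP[e0 e1] := e01.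
have bm := bmf_map_dist2 W0a W1b M0 W1M TW mT (K := setT) measurableT.
have bmr := bmfM bm (bdens e0).
exists (fun x => C2 * \int[Q]_y (map_dist2 P Q a b T setT (x, y) * dens eps (x, y))).
have I0 x : 0 <= \int[Q]_y (map_dist2 P Q a b T setT (x, y) * dens eps (x, y)).
  apply: Rintegral_ge0 => y _; apply: mulr_ge0; last exact: reg_density_ge0.
  by rewrite /map_dist2 mulr_ge0 ?sqr_ge0.
split.
- by apply: bmfZ; exact: (bmf_int P Q bmr).
- by move=> x; rewrite mulr_ge0// ltW.
- move=> x y Kx W1y xy; have W0x : W0 x by apply: (KW Kx); rewrite subrr enorm0 ltW.
  have := section_distance QW1 W0a W1b W0M W1M k1 al0 be0 Qd
    (reg_const_gt0 k p12 e0) (dFG e0) (T x) W0x W1y xy.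
  move=> /(_ (fun z W1z xz => mid x y z Kx W1y W1z xy xz)) h; apply: (le_trans h).
  have -> : (fun z => enorm (retr W1 b z - T x) ^+ 2 *
      ((reg_const k p eps)^-1 * pos (xi eps (x, z)) `^ k)) =
      (fun z => map_dist2 P Q a b T setT (x, z) * dens eps (x, z)).
    apply/funext => z; rewrite /map_dist2 /= indicE in_setT mul1r.
    by rewrite Tr_id.
  by apply: ler_wpM2r => //; rewrite lerDl.
have mE : \int[P]_x (\1_K x * (C2 * \int[Q]_y (map_dist2 P Q a b T setT (x, y) * dens eps (x, y))))
    = C2 * dint P Q (fun z => map_dist2 P Q a b T K z * dens eps z).
  rewrite /dint -intZ; last exact: (bmf_int P Q (bmfM (bmf_map_dist2 W0a W1b M0 W1M TW mT mK) (bdens e0))).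
  apply: eq_Rintegral => x _; rewrite mulrCA; congr (_ * _).
  rewrite -(intZ Q _ (bmf_pair1 x bmr)); apply: eq_Rintegral => y _.
  by rewrite /map_dist2/= indicT mul1r !mulrA.
rewrite mE -mulrA; apply: ler_wpM2l; first exact: ltW.
rewrite mulrAC ler_pdivlMr// mulrC.
apply: le_trans (C1P _ _ _ e01 (dFG e0)).
apply: cP; first exact: bdens.
- by move=> z; exact: reg_density_ge0.
- exact: (reg_density_fst W0a W1b W0M W1M k1 p12 e0 (dFG e0)).
- exact: (reg_density_snd W0a W1b W0M W1M k1 p12 e0 (dFG e0)).
Qed.

End regularized_family.

Lemma int_EFin_full {R : realType} d (X : measurableType d) (Q : probability X R)
    (D : set X) (h : X -> R) : Q D = 1%E -> measurable D -> bmf h ->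
  (\int[Q]_x h x)%:E = (\int[Q]_(x in D) (h x)%:E)%E.
Proof.
move=> QD mD bh; rewrite int_EFin// [RHS]integral_mkcond.
have QD0 : Q (~` D) = 0%E by rewrite probability_setC// QD subee.
apply: ae_eq_integral; first exact: measurableT.
- by apply/measurable_EFinP; exact: bh.1.
- by apply/(measurable_restrictT _ mD); apply: measurable_funTS; apply/measurable_EFinP; exact: bh.1.
exists (~` D); split => //; first exact: measurableC.
by move=> x /=; apply: contra_not => Dx _; rewrite patchE mem_set.
Qed.

(** * Norms and optimizers *)

Section L2norm.
Context {R : realType} {d : nat}.
Local Notation E := 'rV[R]_d.
Implicit Types (K : set E) (h : E -> \bar R).
Local Open Scope ereal_scope.

(* No measurability, unlike [ge0_le_integral]: the supremum over a section is
   not known to be a measurable function of the base point. *)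
Lemma ge0_le_integral_nonmeasurable d' (X : measurableType d') (m : {measure set X -> \bar R})
    (f g : X -> \bar R) : (forall x, 0 <= f x) -> (forall x, f x <= g x) ->
  \int[m]_x f x <= \int[m]_x g x.
Proof.
move=> f0 fg; have g0 x : 0 <= g x := le_trans (f0 x) (fg x).
rewrite !ge0_integralE//; apply: le_ereal_sup => _ [h /= hf <-].
exists h => //= x; apply: (le_trans (hf x)).
by rewrite !patchE in_setT.
Qed.

Lemma le_poweR (x y : \bar R) (r : R) : (0 <= r)%R -> 0 <= x -> x <= y ->
  x `^ r <= y `^ r.
Proof.
move=> r0 x0 xy; apply: gt0_ler_poweR => //.
  by rewrite in_itv/= x0 leey.
by rewrite in_itv/= (le_trans x0) ?leey.
Qed.

Lemma L2norm_mono K h1 h2 : (forall x, K x -> 0 <= h1 x <= h2 x) ->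
  L2norm K h1 <= L2norm K h2.
Proof.
move=> h12; rewrite /L2norm unlock.
have pt x : 0 <= (h1 \_ K) x <= (h2 \_ K) x.
  rewrite !patchE; case: ifPn => [|_]; last by rewrite lexx.
  by rewrite inE => /h12.
apply: le_poweR; first by rewrite invr_ge0.
  by apply: integral_ge0 => x _; exact: poweR_ge0.
apply: ge0_le_integral_nonmeasurable => [x|x]; first exact: poweR_ge0.
have /andP[h0 h1h2] := pt x.
apply: le_poweR => //.
by rewrite !gee0_abs ?(le_trans h0).
Qed.

Lemma L2norm_le K h (H : E -> R) (c : R) : measurable K -> (0 <= c)%R ->
  measurable_fun [set: E] H -> (forall x, 0 <= H x)%R ->
  (forall x, K x -> 0 <= h x <= (Num.sqrt (H x))%:E) ->
  \int[lebesgue_rV d]_(x in K) (H x)%:E <= (c ^+ 2)%:E -> L2norm K h <= c%:E.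
Proof.
move=> mK c0 mH H0 hH Hc; rewrite /L2norm unlock.
apply: (@le_trans _ _ ((c ^+ 2)%:E `^ 2^-1)); last first.
  by rewrite poweR_EFin powR12_sqrt ?sqr_ge0// sqrtr_sqr ger0_norm.
apply: le_poweR; first by rewrite invr_ge0.
  by apply: integral_ge0 => x _; exact: poweR_ge0.
apply: le_trans Hc; rewrite [leRHS]integral_mkcond.
apply: ge0_le_integral_nonmeasurable => [x|x]; first exact: poweR_ge0.
rewrite !patchE; case: ifPn => [|_]; last by rewrite /= normr0 powR0// pnatr_eq0.
rewrite inE => /hH/andP[h0 h1]; rewrite gee0_abs//.
apply: (@le_trans _ _ ((Num.sqrt (H x))%:E `^ 2)).
  exact: le_poweR.
by rewrite poweR_EFin powR_mulrn ?sqrtr_ge0// sqr_sqrtr.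
Qed.

End L2norm.

(** * From the given dual optimizers and plans to dual pairs on the whole space *)

Section optimizers.
Context {R : realType} {d : nat}.
Local Notation E := 'rV[R]_d.
Context (P Q : probability E R) (a b : E) (M k : R).
Local Notation W0 := (msupport P).
Local Notation W1 := (msupport Q).
Hypotheses (PW0 : P W0 = 1%E) (QW1 : Q W1 = 1%E) (W0a : W0 a) (W1b : W1 b).
Hypotheses (W0M : forall x, W0 x -> enorm x <= M)
  (W1M : forall y, W1 y -> enorm y <= M) (k1 : 1 <= k).
Local Notation r0 := (retr W0 a).
Local Notation r1 := (retr W1 b).
Local Notation tc := (tcost W0 a W1 b).
Context (p eps : R) (kE : k = conj_exp p - 1).
Context (plan : probability (E * E)%type R) (f g : E -> R).
Hypothesis fg : dual_optimizers p eps P Q plan f g.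
Local Notation F := (f \o r0).
Local Notation G := (g \o r1).

Let mW0 : measurable W0. Proof. exact: measurable_msupport. Qed.
Let mW1 : measurable W1. Proof. exact: measurable_msupport. Qed.

Let bF : bmf F.
Proof.
have [[mf _] [N [fN _]] _ _ _] := fg.
by apply: (bmf_retr mW0 W0a mf); exists N.
Qed.

Let bG : bmf G.
Proof.
have [[_ mg] [N [_ gN]] _ _ _] := fg.
by apply: (bmf_retr mW1 W1b mg); exists N.
Qed.

Let FE x : F (r0 x) = F x.
Proof. by rewrite /= retr_idem. Qed.

Let GE y : G (r1 y) = G y.
Proof. by rewrite /= retr_idem. Qed.

Lemma slack_optimizers x y : W0 x -> W1 y ->
  slack P Q a b F G (x, y) = f x + g y - cost x y.
Proof. by move=> W0x W1y; rewrite /slack/= tcostE !retr_id. Qed.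

Lemma slack_powE x y : W0 x -> W1 y ->
  pos (slack P Q a b F G (x, y)) `^ k = slack_pow p f g x y.
Proof. by move=> W0x W1y; rewrite slack_optimizers// kE. Qed.

Lemma section_suppE x : 0 < reg_const k p eps -> W0 x ->
  section_supp p eps Q f g x =
  [set y | W1 y /\ 0 < slack P Q a b F G (x, y)].
Proof.
move=> c0 W0x; rewrite /reg_const kE in c0.
have rhoE y : W1 y -> (0 < rho_eps p eps f g x y) = (0 < slack P Q a b F G (x, y)).
  move=> W1y; rewrite /rho_eps pmulr_rgt0 ?invr_gt0// -slack_powE//.
  have [xi0|xi0] := ltP 0 (slack P Q a b F G (x, y)).
    by rewrite gt0_pos// powR_gt0.
  by rewrite le0_pos// powR0 ?ltxx// gt_eqF// (lt_le_trans _ k1).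
by apply/seteqP; split => y [W1y]; [rewrite rhoE|move=> h; split=> //; rewrite rhoE].
Qed.

Let bpow : bmf (fun z => pos (slack P Q a b F G z) `^ k).
Proof. exact: (bmf_pow_slack W0a W1b W0M W1M k1 bF bG). Qed.

(** The slack is invariant under the retractions, so the equation at a point is the given one at its
    retraction; the supports having full measure, the domain of integration does not matter. *)
Lemma dual_pair_optimizers : dual_pair P Q a b k (reg_const k p eps) F G.
Proof.
have [_ _ eqf eqg _] := fg; rewrite /reg_const kE; split=> //.
- move=> x; apply: EFin_inj; rewrite -(eqf _ (retr_in x W0a)) -kE.
  have bx := bmf_pair1 x bpow.
  rewrite (int_EFin_full QW1 mW1 bx); apply: eq_integral => y; rewrite inE => W1y.
  have := slack_powE (retr_in x W0a) W1y; rewrite -{1}(retr_id b W1y).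
  by rewrite (slack_retr W0a W1b)// => ->.
- move=> y; apply: EFin_inj; rewrite -(eqg _ (retr_in y W1b)) -kE.
  have bx := bmf_pair2 y bpow.
  rewrite (int_EFin_full PW0 mW0 bx); apply: eq_integral => x; rewrite inE => W0x.
  have := slack_powE W0x (retr_in y W1b); rewrite -{1}(retr_id a W0x).
  by rewrite (slack_retr W0a W1b)// => ->.
Qed.

Hypotheses (cp : coupling P Q plan) (ac : plan `<< product_probability P Q).

Lemma coupling_full : plan (W0 `*` W1) = 1%E.
Proof.
have [h1 _] := cp mW0; have [_ h2] := cp mW1.
have -> : W0 `*` W1 = (W0 `*` setT) `&` (setT `*` W1).
  by apply/seteqP; split => z /= [] // [h _] [_ h'].
apply/eqP; rewrite eq_le probability_le1; last first.
  by apply: measurableI; exact: measurableX.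
have mA : measurable (W0 `*` [set: E]) by exact: measurableX.
have mB : measurable ([set: E] `*` W1) by exact: measurableX.
have pA0 : plan (~` ([set: E] `*` W1)) = 0%E.
  by rewrite probability_setC// h2 QW1 subee.
rewrite /= -[leLHS]PW0 -[leLHS]h1 (measureDI plan mA mB).
rewrite [X in (X + _ <= _)%E](_ : _ = 0%E) ?add0e//.
apply/eqP; rewrite eq_le measure_ge0 andbT -pA0.
apply: le_measure; rewrite ?inE; [exact: measurableD|exact: measurableC|].
by move=> z [].
Qed.

Lemma product_full : product_probability P Q (W0 `*` W1) = 1%E.
Proof.
transitivity (P W0 * Q W1)%E; first exact: product_measure1E.
by rewrite PW0 QW1 mule1.
Qed.

(** Radon-Nikodym change of variables. The density formula holds almost everywhere on the product of
    the supports, which has full measure for the plan and for the product probability. *)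
Lemma plan_cost : (\int[plan]_z (cost z.1 z.2)%:E)%E =
  (dint P Q (fun z => tc z * reg_density P Q a b k p eps F G z))%:E.
Proof.
have btc := bmf_tc W0a W1b W0M W1M.
have brho := bmf_reg_density W0a W1b W0M W1M k1 p eps bF bG.
have mWW : measurable (W0 `*` W1) by exact: measurableX.
have plan0 : plan (~` (W0 `*` W1)) = 0%E by rewrite probability_setC// coupling_full subee.
have prod0 : product_probability P Q (~` (W0 `*` W1)) = 0%E.
  by rewrite probability_setC// product_full subee.
transitivity (\int[plan]_z (tc z)%:E)%E.
  apply: ae_eq_integral; first exact: measurableT.
  - apply/measurable_EFinP; exact: measurable_cost measurable_fst measurable_snd.
  - by apply/measurable_EFinP; exact: btc.1.
  exists (~` (W0 `*` W1)); split => //; first exact: measurableC.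
  move=> [x y] /=; apply: contra_not => -[/= W0x W1y] _.
  by rewrite tcostE !retr_id.
have [_ _ _ _ dE] := fg.
have itc : plan.-integrable setT (EFin \o tc) by exact: bmf_integrable.
rewrite -(Radon_Nikodym_change_of_variables ac measurableT itc).
rewrite /dint.
transitivity (\int[product_probability P Q]_z
    (tc z * reg_density P Q a b k p eps F G z)%:E)%E; last first.
  rewrite -(integral12_prod_meas1 (bmf_integrableX P Q (bmfM btc brho))).
  have bI := bmf_int P Q (bmfM btc brho).
  rewrite (int_EFin P bI); apply: eq_integral => x _.
  by rewrite (int_EFin Q (bmf_pair1 x (bmfM btc brho))).
apply: ae_eq_integral; first exact: measurableT.
- apply: emeasurable_funM; first by apply/measurable_EFinP; exact: btc.1.
  exact: (measurable_int _ (@Radon_Nikodym_integrable _ _ _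
    (charge_of_finite_measure plan) (product_probability P Q) ac)).
- by apply/measurable_EFinP; exact: (bmfM btc brho).1.
have [N [mN N0 NE]] := dE.
exists (N `|` ~` (W0 `*` W1)); split.
- by apply: measurableU => //; exact: measurableC.
- by apply: null_set_setU => //; exact: measurableC.
move=> [x y] /=; apply: contra_notP => /not_orP[Nxy /contrapT [/= W0x W1y]] _.
have := contra_not (@NE (x, y)) Nxy => /contrapT/(_ (conj W0x W1y)) /=.
move=> e; transitivity ((tc (x, y))%:E * density P Q plan (x, y))%E; first by [].
rewrite e -EFinM; congr (_ * _)%:E.
by rewrite /rho_eps /reg_density slack_powE// /reg_const kE.
Qed.

End optimizers.

Lemma convex_set_midpoint {R : realType} {d : nat} (A : set 'rV[R]_d) y z :
  convex_set A -> A y -> A z -> A (2^-1 *: y + 2^-1 *: z).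
Proof.
move=> cA Ay Az.
have h0 : 0 <= (2^-1 : R) by rewrite invr_ge0.
have h1 : 2^-1 <= (1 : R) by rewrite invf_le1 ?ler1n.
have := cA y z (Itv01 h0 h1) (mem_set Ay) (mem_set Az); rewrite inE.
congr (A (_ + _ *: _)).
have e : 1 - 2^-1 = 2^-1 :> R by field.
exact: e.
Qed.

(** Inside the support Lebesgue measure is at most 1/al0 times [P], which converts the bound on [H]
    under [P] into a norm over [K]. The gradient is compared pointwise, as it lies within the
    section radius of G x. *)
Lemma L2norm_sections {R : realType} {d : nat} (P Q : probability 'rV[R]_d R)
    (a b : 'rV[R]_d) (M k : R) (al0 be : R) (c0 : R) (f g : 'rV[R]_d -> R)
    (K : set 'rV[R]_d) (G : 'rV[R]_d -> 'rV[R]_d) (H : 'rV[R]_d -> R) (c : R) :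
  let F1 := f \o retr (msupport P) a in
  let G1 := g \o retr (msupport Q) b in
  let xi := slack P Q a b F1 G1 in
  let Sec x := [set y | msupport Q y /\ 0 < xi (x, y)] in
  P (msupport P) = 1%E -> Q (msupport Q) = 1%E -> msupport P a -> msupport Q b ->
  (forall x, msupport P x -> enorm x <= M) ->
  (forall y, msupport Q y -> enorm y <= M) -> 1 <= k ->
  0 < al0 ->
  (forall A, measurable A -> A `<=` msupport P ->
     (al0%:E * lebesgue_rV d A <= P A)%E) ->
  (forall A, measurable A -> A `<=` msupport Q ->
     (Q A <= be%:E * lebesgue_rV d A)%E) ->
  0 < c0 -> dual_pair P Q a b k c0 F1 G1 ->
  measurable K -> K `<=` (msupport P)^° ->
  bmf H -> (forall x, 0 <= H x) ->
  (forall x y, K x -> msupport Q y -> 0 < xi (x, y) ->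
     enorm (y - G x) ^+ 2 <= H x) ->
  0 <= c -> \int[P]_x (\1_K x * H x) <= al0 * c ^+ 2 ->
  (L2norm K (fun x => (enorm (grad (phi_eps f) x - G x))%:E)
     <= L2norm K (sup_dist Sec G))%E /\
  (L2norm K (sup_dist Sec G) <= c%:E)%E.
Proof.
move=> F1 G1 xi Sec PW0 QW1 W0a W1b W0M W1M k1 al00 Pd Qd c00 dFG mK KW0 bH H0 HK cp Hc.
have SecH x y : K x -> Sec x y -> enorm (y - G x) <= Num.sqrt (H x).
  move=> Kx [W1y xy]; rewrite -[leLHS]ger0_norm ?enorm_ge0// -sqrtr_sqr.
  by apply: ler_wsqrtr; exact: HK.
have sup_le x : K x -> (sup_dist Sec G x <= (Num.sqrt (H x))%:E)%E.
  by move=> Kx; apply: ge_ereal_sup => _ [y Sy <-]; rewrite lee_fin; exact: SecH.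
have sup_ub x y : Sec x y -> ((enorm (y - G x))%:E <= sup_dist Sec G x)%E.
  by move=> Sy; apply: ereal_sup_ubound; exists y.
have sup_ge0 x : (0 <= sup_dist Sec G x)%E.
  have [y Sy] := section_nonempty W0a W1b k1 c00 dFG x.
  by apply: le_trans (sup_ub x y Sy); rewrite lee_fin enorm_ge0.
split.
  apply: L2norm_mono => x Kx; rewrite lee_fin enorm_ge0/=.
  have sf : sup_dist Sec G x \is a fin_num.
    by rewrite ge0_fin_numE// (le_lt_trans (sup_le x Kx)) ?ltry.
  rewrite -(fineK sf) lee_fin.
  have phiE z : msupport P z -> phi_eps f z = 2^-1 * enorm z ^+ 2 - F1 z.
    by move=> W0z; rewrite /phi_eps /F1/= retr_id.
  apply: (grad_potential_dist QW1 W0a W1b W0M W1M k1 Qd c00 dFG phiE (KW0 _ Kx)).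
  move=> y W1y xy; rewrite -lee_fin fineK//.
  by apply: sup_ub; split.
apply: (L2norm_le mK cp bH.1 H0) => [x Kx|].
  by rewrite sup_ge0 sup_le.
have KW : K `<=` msupport P by move=> x /KW0; exact: interior_subset.
have ai0 : 0 <= al0^-1 by rewrite invr_ge0 ltW.
apply: (@le_trans _ _ (al0^-1%:E * \int[P]_(x in K) (H x)%:E)%E).
  apply: ge0_le_measure_integral_on => //.
  - move=> A mA AK; rewrite -(@lee_pmul2l _ al0%:E) ?lte_fin// muleA -EFinM.
    rewrite mulfV ?gt_eqF// mul1e; apply: Pd => //.
    exact: subset_trans AK KW.
  - by apply/measurable_EFinP; exact: bH.1.
have -> : (\int[P]_(x in K) (H x)%:E)%E = (\int[P]_x (\1_K x * H x))%:E.
  rewrite int_EFin; last by apply: bmfM => //; exact: bmf_indic.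
  rewrite integral_mkcond; apply: eq_integral => x _; rewrite patchE indicE.
  by case: ifPn => xK; rewrite ?mul1r ?mul0r.
by rewrite -EFinM lee_fin ler_pdivrMl.
Qed.

Theorem corollary3p3 (R : realType) (d : nat) (hd : (0 < d)%N)
    (lambda mu : probability 'rV[R]_d R)
    (hlambda : compact (msupport lambda)) (hmu : compact (msupport mu))
    (alpha : R) (halpha : 0 < alpha)
    (dlambda : regular_density alpha lambda) (dmu : regular_density alpha mu)
    (T : 'rV[R]_d -> 'rV[R]_d) (phi : 'rV[R]_d -> R)
    (hT : optimal_transport_map lambda mu T)
    (hdiffeo : C1_holder_diffeo alpha (msupport lambda) (msupport mu) T)
    (hphi : forall x, (msupport lambda)^° x ->
       differentiable (phi : 'rV[R]_d -> R^o) x /\ grad phi x = T x)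
    (p : R) (hp : 1 < p <= 2)
    (plan : R -> probability ('rV[R]_d * 'rV[R]_d)%type R)
    (f g : R -> 'rV[R]_d -> R)
    (hplan : forall eps : R, 0 < eps -> reg_optimal p eps lambda mu (plan eps))
    (hfg : forall eps : R, 0 < eps ->
       dual_optimizers p eps lambda mu (plan eps) (f eps) (g eps))
    (K0 : set 'rV[R]_d) (mK0 : measurable K0)
    (hK0 : compactly_inside K0 (msupport lambda)) :
  let bound (C eps : R) :=
    (L2norm K0 (fun x => (enorm (grad (phi_eps (f eps)) x - grad phi x))%:E)
       <= L2norm K0
            (sup_dist (section_supp p eps mu (f eps) (g eps)) (grad phi)))%E
    /\ (L2norm K0
          (sup_dist (section_supp p eps mu (f eps) (g eps)) (grad phi))
       <= (C * eps `^ (1 / (d%:R * (p - 1) + 2)))%:E)%E in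
  (exists C eps0 : R, [/\ 0 < C, 0 < eps0 &
     forall eps : R, 0 < eps <= eps0 -> bound C eps])
  /\ (convex_set (msupport mu) ->
      exists C : R, 0 < C /\ forall eps : R, 0 < eps <= 1 -> bound C eps).
Proof.
move=> bound.
have /andP[p1 p2] := hp.
have PW0 := msupport_full dlambda; have QW1 := msupport_full dmu.
have mW0 := measurable_msupport lambda; have mW1 := measurable_msupport mu.
have nonempty (P : probability 'rV[R]_d R) : P (msupport P) = 1%E ->
    exists x, msupport P x.
  move=> PS; apply/set0P; apply: contraPneq PS => ->; rewrite measure0 => /eqP.
  by rewrite eq_sym onee_eq0.
have [a W0a] := nonempty _ PW0; have [b W1b] := nonempty _ QW1.
have [M1 [M10 W0M1]] := compact_enorm_bounded hlambda.
have [M2 [_ W1M2]] := compact_enorm_bounded hmu.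
pose M := Num.max M1 M2.
have M0 : 0 < M by rewrite lt_max M10.
have W0M x : msupport lambda x -> enorm x <= M.
  by move=> /W0M1 h; rewrite le_max h.
have W1M x : msupport mu x -> enorm x <= M.
  by move=> /W1M2 h; rewrite le_max h orbT.
have [S [TS TK CT CS]] := hdiffeo.
have cTW : compact (T @` msupport lambda) by rewrite TS.
have SS : S @` msupport mu = msupport lambda.
  rewrite -TS; apply/seteqP; split => [_ [_ [x W0x <-] <-]|x W0x].
    by rewrite TK// inE.
  by exists (T x); [exists x|rewrite TK// inE].
have cSW : compact (S @` msupport mu) by rewrite SS.
have [LT [LT0 TL]] := C1_holder_lipschitz halpha hlambda cTW CT.
have [LS [LS0 SL']] := C1_holder_lipschitz halpha hmu cSW CS.
have TW x : msupport lambda x -> msupport mu (T x).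
  by move=> W0x; rewrite -TS; exists x.
have SL x x' : msupport lambda x -> msupport lambda x' ->
    enorm (x - x') <= LS * enorm (T x - T x').
  move=> W0x W0x'; have := SL' _ _ (TW _ W0x) (TW _ W0x').
  by rewrite !TK ?inE.
have [mT Tmu Topt] := hT.
have mTr := measurable_Tr W0a mT.
have pT B : measurable B -> lambda (Tr lambda a T @^-1` B) = mu B.
  move=> mB; rewrite -Tmu// -(msupport_setI PW0); last first.
    by rewrite -[X in measurable X]setTI; exact: mTr.
  congr (lambda _); apply/seteqP; split => x [W0x /=]; rewrite Tr_id//.
pose k := conj_exp p - 1; have kE : k = conj_exp p - 1 by [].
have k1 : 1 <= k.
  by rewrite kE (conj_exp_subE p1) invf_ge1 ?subr_gt0// lerBlDr.
have [alP [beP [alP0 abP PD]]] := density_bounds dlambda.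
have [al [be [al0 ab QD]]] := density_bounds dmu.
have be0 : 0 <= be by exact: le_trans (ltW al0) ab.
pose F eps := f eps \o retr (msupport lambda) a.
pose G eps := g eps \o retr (msupport mu) b.
have dFG eps : 0 < eps ->
    dual_pair lambda mu a b k (reg_const k p eps) (F eps) (G eps).
  move=> e0; have := dual_pair_optimizers PW0 QW1 W0a W1b W0M W1M k1 kE (hfg eps e0).
  exact.
have opt eps : 0 < eps ->
    \int[lambda]_x tcost (msupport lambda) a (msupport mu) b (x, Tr lambda a T x) <=
    dint lambda mu (fun z => tcost (msupport lambda) a (msupport mu) b z *
      reg_density lambda mu a b k p eps (F eps) (G eps) z).
  move=> e0; have [cp ac _] := hplan eps e0.
  rewrite -lee_fin -(plan_cost PW0 QW1 W0a W1b W0M W1M k1 kE (hfg eps e0) cp ac).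
  rewrite (int_EFin_full PW0 mW0 (bmf_graph W0a mT (bmf_tc W0a W1b W0M W1M))).
  apply: le_trans (Topt _ cp); rewrite le_eqVlt; apply/orP; left; apply/eqP.
  apply: eq_integral => x; rewrite inE => W0x.
  by rewrite tcostE Tr_id// !retr_id//; exact: TW.
have [r [r0 KW]] := compactly_inside_radius hK0.
have KW0 : K0 `<=` (msupport lambda)^°.
  by have [K' [_ KK' K'W]] := hK0; exact: subset_trans KK' K'W.
have [C [C0 CP]] := section_radius_bound hlambda hmu PW0 QW1 W0a W1b M0 W0M W1M k1
  LT0 TW TL mT LS0 SL pT hp kE al0 be0 QD dFG opt r0 mK0 KW.
(* [C] bounds an integral of squares against lambda; dividing by the lower density bound passes to
   Lebesgue measure, and the root to the norm. *)
pose C1 := Num.sqrt (C / alP).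
have C10 : 0 < C1 by rewrite sqrtr_gt0 divr_gt0.
(* Both claims reduce to this with the same constant; they differ only in how the midpoint property
   is obtained. *)
have main eps : 0 < eps <= 1 -> midpoints lambda mu a b F G K0 eps -> bound C1 eps.
  move=> e01 mid; have /andP[e0 _] := e01.
  have [H [bH H0 HK HC]] := CP eps e01 mid.
  have rc0 : 0 < reg_const k p eps by exact: reg_const_gt0.
  have gradE x : K0 x -> grad phi x = T x by move=> /KW0/hphi[].
  have KW1 x : K0 x -> msupport lambda x by move=> /KW0; exact: interior_subset.
  have secE x : K0 x -> section_supp p eps mu (f eps) (g eps) x =
      [set y | msupport mu y /\ 0 < slack lambda mu a b (F eps) (G eps) (x, y)].
    by move=> Kx; rewrite (section_suppE mu a b k1 kE (f eps) (g eps) rc0 (KW1 x Kx)).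
  have supE x : K0 x -> sup_dist (section_supp p eps mu (f eps) (g eps)) (grad phi) x =
      sup_dist (fun x => [set y | msupport mu y /\
        0 < slack lambda mu a b (F eps) (G eps) (x, y)]) T x.
    by move=> Kx; rewrite /sup_dist secE// gradE.
  have c0 : 0 <= C1 * rate (d := d) p eps.
    by rewrite mulr_ge0 ?(ltW C10)// powR_ge0.
  have Hc : \int[lambda]_x (\1_K0 x * H x) <= alP * (C1 * rate (d := d) p eps) ^+ 2.
    rewrite exprMn sqr_sqrtr ?divr_ge0 ?(ltW C0) ?(ltW alP0)//.
    by rewrite [leRHS]mulrA [alP * _]mulrC mulfVK ?gt_eqF.
  have [h1 h2] := L2norm_sections PW0 QW1 W0a W1b W0M W1M k1 alP0
    (fun A mA AW => (PD A mA AW).1) (fun A mA AW => (QD A mA AW).2)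
    rc0 (dFG eps e0) mK0 KW0 bH H0 HK c0 Hc.
  have L2E (u v : 'rV[R]_d -> \bar R) : (forall x, K0 x -> u x = v x) ->
      L2norm K0 u = L2norm K0 v.
    move=> uv; rewrite /L2norm; congr Lnorm; apply/funext => x; rewrite !patchE.
    by case: ifPn => //; rewrite inE => /uv.
  rewrite /bound (L2E _ _ supE).
  rewrite (L2E _ (fun x => (enorm (grad (phi_eps (f eps)) x - T x))%:E)).
    by split.
  by move=> x Kx; rewrite gradE.
split; last first.
  move=> cW1; exists C1; split=> // eps e01; apply: main => // x y z _ W1y W1z _ _.
  exact: (convex_set_midpoint cW1 W1y W1z).
have [eps0 [/andP[e00 e01] midP]] := midpoints_small hlambda hmu PW0 QW1 W0a W1b
  M0 W0M W1M k1 LT0 TW TL mT LS0 SL pT hp dFG opt r0 KW.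
exists C1, eps0; split=> // eps e0s; have /andP[e0 es] := e0s.
by apply: main; [rewrite e0 (le_trans es)|exact: midP].
Qed.
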